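(* There is a constant $C>0$, depending only on $T$, $\mathcal O$ and the regularity parameters of $\mathcal V_h$, such that for every $g\in L_{\mathbb F}^2(\Omega;L^2(0,T;L^2(\mathcal O)))$, $$\|\mathcal S_2g\|_{L^2(\Omega;L^2(0,T;L^2(\mathcal O)))}\leqslant C\|g\|_{L^2(\Omega;L^2(0,T;L^2(\mathcal O)))}.$$
   Context: Setting. $\{W(t)\mid t\geqslant0\}$ is a one-dimensional Brownian motion on a complete probability space $(\Omega,\mathcal F,\mathbb P)$ and $\mathbb F=\{\mathcal F_t\}_{t\geqslant0}$ is its natural filtration. $\mathcal O\subset\mathbb R^d$ ($d=1,2,3$) is a convex polytope, $0<T<\infty$, and $\Delta$ is the realization of the Laplace operator with homogeneous Dirichlet boundary condition in $L^2(\mathcal O)$. For $\beta\geqslant0$, $\dot H^\beta(\mathcal O):=\{(-\Delta)^{-\beta/2}v: v\in L^2(\mathcal O)\}$ with norm $\|(-\Delta)^{\beta/2}v\|_{L^2(\mathcal O)}$. For a separable Banach space $X$, $L_{\mathbb F}^2(\Omega;L^2(0,T;X))$ is the set of $\mathbb F$-progressively measurable $\varphi:(0,T)\times\Omega\to X$ with $\int_0^T\mathbb E\|\varphi(t)\|_X^2\,\mathrm dt<\infty$. Discretization. $J$ is a positive integer, $\tau:=T/J$, $t_j:=j\tau$; it is assumed that $J>2$ and $\tau<2/5$. $\mathcal K_h$ is a conforming, shape regular and quasi-uniform triangulation of $\mathcal O$ consisting of $d$-simplexes with maximum element diameter $h$; $\mathcal V_h:=\{v_h\in\dot H^1(\mathcal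 O)\mid v_h\text{ piecewise linear on each }K\in\mathcal K_h\}$; the regularity parameters of $\mathcal V_h$ are the shape-regularity and quasi-uniformity constants of $\mathcal K_h$. $\mathcal X_{h,\tau}:=\{V\in L_{\mathbb F}^2(\Omega;L^2(0,T;\mathcal V_h))\mid V\text{ is constant on }[t_j,t_{j+1})\ \forall\,0\leqslant j<J\}$. $Q_h$ is the $L^2(\mathcal O)$-orthogonal projection onto $\mathcal V_h$, and $\Delta_h:\mathcal V_h\to\mathcal V_h$ is defined by $\int_{\mathcal O}(\Delta_hv_h)w_h=-\int_{\mathcal O}\nabla v_h\cdot\nabla w_h$ for all $v_h,w_h\in\mathcal V_h$. We write $v_j:=v(t_j)$, $0\leqslant j\leqslant J$. The operators $\mathcal S_1,\mathcal S_2$. For $g\in L_{\mathbb F}^2(\Omega;L^2(0,T;L^2(\mathcal O)))$, $\mathcal S_1g\in\mathcal X_{h,\tau}$ and $\mathcal S_2g\in L_{\mathbb F}^2(\Omega;L^2(0,T;\mathcal V_h))$ are defined by $(\mathcal S_1g)_J=0$ and, for each $0\leqslant j<J$, $$(\mathcal S_1g)_j-(\mathcal S_1g)_{j+1}=\tau\Delta_h(\mathcal S_1g)_j+\int_{t_j}^{t_{j+1}}(\mathcal S_2g+Q_hg)(t)\,\mathrm dt-\int_{t_j}^{t_{j+1}}(\mathcal S_2g)(t)\,\mathrm dW(t).$$ *)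

(* Defs.v *)
From Stdlib Require List.
From HB Require Import structures.
From mathcomp Require Import all_boot all_order all_algebra.
From mathcomp Require Import all_classical all_reals all_analysis.

Set Implicit Arguments.
Unset Strict Implicit.
Unset Printing Implicit Defensive.

Import Order.TTheory GRing.Theory Num.Theory.
Import numFieldNormedType.Exports.

Local Open Scope classical_set_scope.
Local Open Scope ring_scope.

(** * Lebesgue measure on R^n *)

Definition rV_display : measure_display. Proof. exact. Qed.

Section measurable_rV.
Context {R : realType} (n : nat).

Let coord (i : 'I_n) (x : 'rV[R]_n) : R := x 0 i.

Let rV_set0 : g_sigma_preimage coord set0.
Proof. exact: sigma_algebra0. Qed.

Let rV_setC A : g_sigma_preimage coord A -> g_sigma_preimage coord (~` A).
Proof. exact: sigma_algebraC. Qed.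

Let rV_bigcup (F : (set 'rV[R]_n)^nat) :
  (forall i, g_sigma_preimage coord (F i)) ->
  g_sigma_preimage coord (\bigcup_i (F i)).
Proof. exact: sigma_algebra_bigcup. Qed.

HB.instance Definition _ := @isMeasurable.Build rV_display
  'rV[R]_n (g_sigma_preimage coord) rV_set0 rV_setC rV_bigcup.

Lemma measurable_coord (i : 'I_n) :
  measurable_fun [set: 'rV[R]_n] (fun x : 'rV[R]_n => x 0 i : R).
Proof.
move=> _ Y mY; rewrite setTI; apply: sub_sigma_algebra => /=.
rewrite -bigcup_seq/=; exists i => /=; first by rewrite mem_index_enum.
by exists Y => //; rewrite setTI.
Qed.

Lemma measurable_fun_rV d (T : measurableType d) (f : T -> 'rV[R]_n) :
  (forall i, measurable_fun [set: T] (fun t => f t 0 i : R)) ->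
  measurable_fun [set: T] f.
Proof.
move=> mf _ Y mY; rewrite setTI.
suff : g_sigma_preimage coord `<=` [set A | measurable (f @^-1` A)] by apply.
apply: smallest_sub.
  split => /=.
  - by rewrite preimage_set0.
  - by move=> A mA; rewrite setTD preimage_setC; exact: measurableC.
  - by move=> F mF; rewrite preimage_bigcup; exact: bigcup_measurable.
rewrite -bigcup_seq; apply: bigcup_sub => i _ A [B mB <-] /=.
by rewrite setTI -[X in measurable X]setTI; exact: mf.
Qed.

End measurable_rV.

Definition cons_rV (R : realType) n (p : R * 'rV[R]_n) : 'rV[R]_n.+1 :=
  \row_(i < n.+1) oapp (p.2 0) p.1 (unlift ord0 i).

Lemma measurable_cons_rV (R : realType) n :
  measurable_fun [set: R * 'rV[R]_n] (@cons_rV R n).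
Proof.
apply: measurable_fun_rV => i; case: (unliftP ord0 i) => [j ->|->].
- rewrite (_ : (fun _ => _) = (fun x : 'rV[R]_n => x 0 j : R) \o snd).
    by apply: measurableT_comp; [exact: measurable_coord|exact: measurable_snd].
  by apply/funext => p /=; rewrite mxE liftK.
- rewrite (_ : (fun _ => _) = fst); first exact: measurable_fst.
  by apply/funext => p /=; rewrite mxE unlift_none.
Qed.

Section lebesgue_cons.
Local Open Scope ereal_scope.
Context (R : realType) (n : nat)
  (m : {sigma_finite_measure set 'rV[R]_n -> \bar R}).

Definition lebesgue_cons (A : set 'rV[R]_n.+1) : \bar R :=
  (@lebesgue_measure R \x m) (@cons_rV R n @^-1` A).

Let lebesgue_cons0 : lebesgue_cons set0 = 0.
Proof. by rewrite /lebesgue_cons preimage_set0 measure0. Qed.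

Let lebesgue_cons_ge0 A : 0 <= lebesgue_cons A.
Proof. exact: measure_ge0. Qed.

Let mpre A : measurable A -> measurable (@cons_rV R n @^-1` A).
Proof.
by move=> mA; rewrite -[X in measurable X]setTI; exact: measurable_cons_rV.
Qed.

Let lebesgue_cons_sigma_additive : semi_sigma_additive lebesgue_cons.
Proof.
move=> F mF tF mUF; rewrite /lebesgue_cons preimage_bigcup.
apply: measure_semi_sigma_additive.
- by move=> i; exact: mpre.
- apply/trivIsetP => i j _ _ ij; rewrite -preimage_setI.
  by move/trivIsetP : tF => ->//; rewrite preimage_set0.
- by rewrite -preimage_bigcup; exact: mpre.
Qed.

HB.instance Definition _ := isMeasure.Build _ _ _ lebesgue_cons
  lebesgue_cons0 lebesgue_cons_ge0 lebesgue_cons_sigma_additive.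

Let uncons (x : 'rV[R]_n.+1) : R * 'rV[R]_n :=
  (x 0%R ord0, (\row_j x 0 (lift ord0 j))%R).

Let measurable_uncons : measurable_fun setT uncons.
Proof.
apply: measurable_fun_pair; first exact: measurable_coord.
apply: measurable_fun_rV => i.
rewrite (_ : (fun _ => _) = (fun x : 'rV[R]_n.+1 => x 0%R (lift ord0 i) : R)).
  exact: measurable_coord.
by apply/funext => x; rewrite mxE.
Qed.

Let cons_rVK : cancel (@cons_rV R n) uncons.
Proof.
move=> [a x]; rewrite /uncons /= mxE unlift_none /=; congr pair.
by apply/rowP => j; rewrite !mxE liftK.
Qed.

Let lebesgue_cons_sigma_finite : sigma_finite setT lebesgue_cons.
Proof.
have /sigma_finiteP[F [UF ndF mF]] := sigma_finiteT (@lebesgue_measure R).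
have /sigma_finiteP[G [UG ndG mG]] := sigma_finiteT m.
exists (fun k => uncons @^-1` (F k `*` G k)).
  rewrite -preimage_bigcup; apply/seteqP; split => // x _ /=.
  have [i _ Fi] : (\bigcup_i F i) (uncons x).1 by rewrite -UF.
  have [j _ Gj] : (\bigcup_i G i) (uncons x).2 by rewrite -UG.
  exists (maxn i j) => //; split.
  - by move: Fi; exact/subsetPset/ndF/leq_maxl.
  - by move: Gj; exact/subsetPset/ndG/leq_maxr.
move=> k; have [mFk Fk] := mF k; have [mGk Gk] := mG k; split.
  rewrite -[X in measurable X]setTI; apply: measurable_uncons => //.
  exact: measurableX.
rewrite /lebesgue_cons (_ : _ @^-1` _ = F k `*` G k); last first.
  by apply/funext => p; exact: (congr1 (F k `*` G k) (cons_rVK p)).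
by rewrite product_measure1E// lte_mul_pinfty// ge0_fin_numE.
Qed.

HB.instance Definition _ := Measure_isSigmaFinite.Build _ _ _ lebesgue_cons
  lebesgue_cons_sigma_finite.

End lebesgue_cons.

Fixpoint lebesgue_rV (R : realType) (n : nat) :
    {sigma_finite_measure set 'rV[R]_n -> \bar R} :=
  match n with
  | 0 => dirac (0 : 'rV[R]_0)
  | n'.+1 => lebesgue_cons (lebesgue_rV R n')
  end.

Lemma lebesgue_rV_box (R : realType) (n : nat) (A : 'I_n -> set R) :
  (forall i, measurable (A i)) ->
  lebesgue_rV R n [set x | forall i, A i (x 0 i)] =
  (\prod_(i < n) lebesgue_measure (A i))%E.
Proof.
elim: n A => [|n IHn] A mA.
  by rewrite big_ord0 /= diracE mem_set// => -[].
rewrite big_ord_recl -IHn//=.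
set B := fun x : 'rV[R]_n => forall i : 'I_n, A (lift ord0 i) (x 0 i).
have mB : measurable B.
  rewrite (_ : B = \bigcap_(i in [set: 'I_n])
     ((fun x : 'rV[R]_n => x 0 i : R) @^-1` A (lift ord0 i))).
    apply: fin_bigcap_measurable => [|i _]; first exact: finite_finset.
    by rewrite -[X in measurable X]setTI; exact: measurable_coord.
  by apply/seteqP; split => x /= h i; [move=> _|]; exact: h.
rewrite /lebesgue_cons (_ : _ @^-1` _ = A ord0 `*` B).
  by apply: (@product_measure1E _ _ (measurableTypeR R) _ _ lebesgue_measure (lebesgue_rV R n)); [exact: mA|exact: mB].
apply/seteqP; split => -[a x] /=.
  move=> h; split; first by have := h ord0; rewrite mxE unlift_none.
  by move=> i; have := h (lift ord0 i); rewrite mxE liftK.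
move=> [ha hx] i; rewrite mxE.
by case: (unliftP ord0 i) => [j ->|->] /=.
Qed.

(** * The space L^2(O)

   An element of L^2(O) is represented by a function on R^n, of which only the
   restriction to O matters, up to almost everywhere equality. *)

Section L2_space.
Context (R : realType) (n : nat) (O : set 'rV[R]_n).

Local Notation leb := (lebesgue_rV R n).
Local Notation fn := ('rV[R]_n -> R).

Definition L2 : set fn := [set u | (u \_ O) \in Lfun leb 2%:E].

Definition L2norm (u : fn) : \bar R := 'N[leb]_2%:E[EFin \o (u \_ O)].

Definition L2ip (u v : fn) : R := (\int[leb]_(x in O) (u x * v x))%R.

Definition L2eq (u v : fn) : Prop := u = v %[ae leb in O].

Definition L2open (U : set fn) : Prop :=
  forall u, L2 u -> U u ->
  exists2 e : R, 0 < e &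
    forall v, L2 v -> (L2norm (v \- u)%R < e%:E)%E -> U v.

(* Measurability of [f : D -> L^2(O)] from the sigma-algebra [G] to the Borel
   sigma-algebra of L^2(O); as L^2(O) is separable this is also strong
   measurability. *)
Definition L2measurable (X : Type) (G : set (set X)) (D : set X)
    (f : X -> fn) : Prop :=
  forall U, L2open U -> G (D `&` f @^-1` U).

(** Bochner integral over the interval (a, b), as the limit of the integrals of
    simple functions, given as lists of pairs (measurable set, value). *)

Definition simple_fun (l : seq (set R * fn)) (t : R) : fn :=
  fun x => \sum_(e <- l) \1_(e.1) t * e.2 x.

Definition simple_integral (a b : R) (l : seq (set R * fn)) : fn :=
  fun x => \sum_(e <- l)
    fine (lebesgue_measure (e.1 `&` `]a, b[%classic)) * e.2 x.

Definition is_bochner (a b : R) (f : R -> fn) (I : fn) : Prop :=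
  [/\ forall t, a < t < b -> L2 (f t),
      L2measurable measurable `]a, b[%classic f,
      L2 I &
      exists l : nat -> seq (set R * fn),
      [/\ forall k, List.Forall (fun e => measurable e.1 /\ L2 e.2) (l k),
          (fun k => \int[lebesgue_measure]_(t in `]a, b[%classic)
             L2norm (simple_fun (l k) t \- f t)%R)%E @ \oo --> 0%E &
          L2norm (simple_integral a b (l k) \- I) @[k --> \oo] --> 0%E]].

End L2_space.

(** * The Dirichlet Laplacian and the space \dot H^1(O) *)

Section dirichlet_laplacian.
Context (R : realType) (n : nat) (O : set 'rV[R]_n).

Local Notation fn := ('rV[R]_n -> R).

Definition partial (i : 'I_n) (phi : fn) : fn :=
  fun x => 'D_(delta_mx 0 i : 'rV[R]_n) (phi : _ -> R^o) x.

Fixpoint Ck (k : nat) (phi : fn) : Prop :=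
  continuous phi /\
  match k with
  | 0 => True
  | k'.+1 => forall i : 'I_n,
      (forall x, derivable (phi : _ -> R^o) x (delta_mx 0 i)) /\
      Ck k' (partial i phi)
  end.

Definition test_function (phi : fn) : Prop :=
  (forall k, Ck k phi) /\
  exists K : set 'rV[R]_n,
    [/\ compact K, K `<=` O & forall x, ~ K x -> phi x = 0].

(* u belongs to H^1_0(O), the closure of the test functions in H^1(O), and G is
   its weak gradient. *)
Definition H10 (u : fn) (G : 'I_n -> fn) : Prop :=
  [/\ L2 O u, forall i, L2 O (G i) &
      exists phi : nat -> fn,
      [/\ forall k, test_function (phi k),
          L2norm O (phi k \- u) @[k --> \oo] --> 0%E &
          forall i, L2norm O (partial i (phi k) \- G i) @[k --> \oo] --> 0%E]].

(* u is in the domain of the Dirichlet Laplacian and [f] is its Laplacian. *)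
Definition dirichlet_laplacian (u f : fn) : Prop :=
  L2 O f /\
  exists2 G, H10 u G &
    forall phi, test_function phi ->
      L2ip O f phi = - \sum_(i < n) L2ip O (G i) (partial i phi).

(* B is (- Laplacian)^(-1/2): the nonnegative self-adjoint operator on L^2(O)
   whose square is the inverse of minus the Dirichlet Laplacian. *)
Definition is_inv_sqrt_laplacian (B : fn -> fn) : Prop :=
  [/\ forall f, L2 O f -> L2 O (B f),
      forall (a : R) f g, L2 O f -> L2 O g ->
        L2eq O (B (fun x => a * f x + g x)) (fun x => a * B f x + B g x),
      forall f g, L2 O f -> L2 O g -> L2ip O (B f) g = L2ip O f (B g),
      forall f, L2 O f -> 0 <= L2ip O (B f) f &
      forall f, L2 O f -> dirichlet_laplacian (B (B f)) (\- f)].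

(* [get] is a definite description: such an operator is unique up to almost
   everywhere equality. *)
Definition inv_sqrt_laplacian : fn -> fn := get is_inv_sqrt_laplacian.

Definition Hdot1 : set fn :=
  [set u | L2 O u /\ exists2 v, L2 O v & L2eq O u (inv_sqrt_laplacian v)].

End dirichlet_laplacian.

(** * Convex polytopes, triangulations and finite elements *)

Section finite_elements.
Context (R : realType) (n : nat).

Local Notation leb := (lebesgue_rV R n).
Local Notation pt := 'rV[R]_n.
Local Notation fn := ('rV[R]_n -> R).

Definition dotp (x y : pt) : R := \sum_(i < n) x 0 i * y 0 i.

(* The norm of the library on 'rV[R]_n is the max norm. *)
Definition enorm (x : pt) : R := Num.sqrt (dotp x x).

Definition convex_hull (A : set pt) : set pt :=
  [set x | exists m (p : 'I_m -> pt) (c : 'I_m -> R),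
     [/\ forall i, A (p i), forall i, 0 <= c i, \sum_i c i = 1 &
         x = \sum_i c i *: p i]].

(* As a domain, a convex polytope is open. *)
Definition convex_polytope (O : set pt) : Prop :=
  O !=set0 /\ exists s : seq pt, O = interior (convex_hull [set` s]).

Definition diameter (A : set pt) : R :=
  sup [set r | exists x y, [/\ A x, A y & r = enorm (x - y)]].

(* Diameter of the largest ball contained in A. *)
Definition inball_diameter (A : set pt) : R :=
  sup [set r | 0 <= r /\
    exists x, [set y | enorm (y - x) <= r / 2] `<=` A].

(* The rows of a matrix are the vertices of a simplex. *)
Definition vertices (K : 'M[R]_(n.+1, n)) : set pt := [set row i K | i in setT].

Definition simplex (K : 'M[R]_(n.+1, n)) : set pt := convex_hull (vertices K).

Definition affinely_independent (K : 'M[R]_(n.+1, n)) : Prop :=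
  forall c : 'I_n.+1 -> R,
    \sum_i c i = 0 -> \sum_i c i *: row i K = 0 -> forall i, c i = 0.

(* Conformity: two elements meet along the face spanned by their common
   vertices, possibly empty. *)
Definition triangulation (O : set pt) (mesh : seq 'M[R]_(n.+1, n)) : Prop :=
  [/\ forall K, K \in mesh -> affinely_independent K,
      closure O = [set x | exists2 K, K \in mesh & simplex K x] &
      forall K L, K \in mesh -> L \in mesh ->
        simplex K `&` simplex L = convex_hull (vertices K `&` vertices L)].

Definition mesh_size (mesh : seq 'M[R]_(n.+1, n)) : R :=
  \big[Num.max/0]_(K <- mesh) diameter (simplex K).

Definition shape_regular (s : R) (mesh : seq 'M[R]_(n.+1, n)) : Prop :=
  forall K, K \in mesh ->
    diameter (simplex K) <= s * inball_diameter (simplex K).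

Definition quasi_uniform (q : R) (mesh : seq 'M[R]_(n.+1, n)) : Prop :=
  forall K, K \in mesh -> mesh_size mesh <= q * diameter (simplex K).

Context (O : set pt) (mesh : seq 'M[R]_(n.+1, n)).

Definition Vh : set fn :=
  [set v | Hdot1 O v /\
     forall K, K \in mesh ->
     exists (a : pt) (b : R),
       {ae leb, forall x, simplex K x -> v x = dotp a x + b}].

(* An element v of V_h is in H^1(O), and its gradient is computed elementwise: G
   is equal on each element K to the slope of the affine function v|_K. *)
Definition is_grad (v : fn) (G : 'I_n -> fn) : Prop :=
  (forall i, L2 O (G i)) /\
  forall K, K \in mesh ->
  exists (a : pt) (b : R),
    {ae leb, forall x, simplex K x ->
       v x = dotp a x + b /\ forall i, G i x = a 0 i}.

Definition is_L2_projection (Qh : fn -> fn) : Prop :=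
  forall v, L2 O v ->
    Vh (Qh v) /\ forall w, Vh w -> L2ip O (Qh v) w = L2ip O v w.

Definition is_discrete_laplacian (Dh : fn -> fn) : Prop :=
  forall v, Vh v ->
    Vh (Dh v) /\
    forall w G H, Vh w -> is_grad v G -> is_grad w H ->
      L2ip O (Dh v) w = - \sum_(i < n) L2ip O (G i) (H i).

End finite_elements.

(** * Brownian motion, progressively measurable processes, Ito integral *)

Section stochastic.
Context (R : realType) (d : measure_display) (Omega : measurableType d)
  (P : probability Omega R) (W : R -> Omega -> R).

Definition natural_filtration (t : R) : set (set Omega) :=
  <<s [set A | exists (s : R) (B : set R),
         [/\ 0 <= s <= t, measurable B & A = W s @^-1` B]] >>.

Definition brownian_motion : Prop :=
  [/\ forall t, 0 <= t -> measurable_fun setT (W t),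
      {ae P, forall w, W 0 w = 0},
      {ae P, forall w, {within `[0, +oo[%classic, continuous (W ^~ w)}},
      forall (s t : R) (B : set R), 0 <= s < t -> measurable B ->
        P ((W t \- W s) @^-1` B) = normal_prob 0 (Num.sqrt (t - s)) B &
      forall (s t : R) (A : set Omega) (B : set R), 0 <= s < t ->
        natural_filtration s A -> measurable B ->
        P (A `&` (W t \- W s) @^-1` B) =
        (P A * P ((W t \- W s)%R @^-1` B))%E].

Context (n : nat) (O : set 'rV[R]_n).

Local Notation fn := ('rV[R]_n -> R).
Local Notation process := (R -> Omega -> 'rV[R]_n -> R).

Definition prod_sigma (G : set (set Omega)) : set (set (R * Omega)) :=
  <<s [set S | exists (A : set R) (B : set Omega),
         [/\ measurable A, G B & S = A `*` B]] >>.

Definition progressively_measurable (T : R) (Z : process) : Prop :=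
  forall t, 0 < t < T ->
    L2measurable O (prod_sigma (natural_filtration t))
      (`]0, t]%classic `*` setT) (fun p => Z p.1 p.2).

(* The space L^2_F(Omega; L^2(0, T; X)), for X a closed subspace of L^2(O). *)
Definition L2F (T : R) (X : set fn) : set process :=
  [set Z | [/\ forall t w, 0 < t < T -> X (Z t w),
      progressively_measurable T Z &
      (\int[lebesgue_measure]_(t in `]0%R, T[%classic) \int[P]_w
         (L2norm O (Z t w)) ^+ 2 < +oo)%E]].

(* The norm of L^2(Omega; L^2(0, T; L^2(O))). *)
Definition L2F_norm (T : R) (Z : process) : \bar R :=
  ((\int[P]_w \int[lebesgue_measure]_(t in `]0%R, T[%classic)
      (L2norm O (Z t w)) ^+ 2) `^ 2^-1)%E.

(** Ito integral on (a, b): the mean-square limit of the integrals of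
    elementary processes, which are finite sums of terms
    1_A(omega) 1_(s, r](t) v with A in F_s. *)

Record ito_term := ItoTerm {
  term_start : R;
  term_end : R;
  term_event : set Omega;
  term_value : fn }.

Definition ito_term_on (a b : R) (e : ito_term) : Prop :=
  [/\ a <= term_start e, term_start e <= term_end e, term_end e <= b,
      natural_filtration (term_start e) (term_event e) &
      L2 O (term_value e)].

Definition elementary_process (l : seq ito_term) : process :=
  fun t w x => \sum_(e <- l)
    \1_(term_event e) w * \1_(`]term_start e, term_end e]%classic) t *
    term_value e x.

Definition elementary_integral (l : seq ito_term) (w : Omega) : fn :=
  fun x => \sum_(e <- l)
    \1_(term_event e) w * (W (term_end e) w - W (term_start e) w) *
    term_value e x.

Definition is_ito (a b : R) (Z : process) (I : Omega -> fn) : Prop :=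
  [/\ forall w, L2 O (I w),
      L2measurable O measurable setT I &
      exists l : nat -> seq ito_term,
      [/\ forall k, List.Forall (ito_term_on a b) (l k),
          (fun k => \int[lebesgue_measure]_(t in `]a, b[%classic) \int[P]_w
             (L2norm O (elementary_process (l k) t w \- Z t w)%R) ^+ 2)%E
            @ \oo --> 0%E &
          (fun k => \int[P]_w
             (L2norm O (elementary_integral (l k) w \- I w)%R) ^+ 2)%E
            @ \oo --> 0%E]].

End stochastic.

(** * The space X_{h,tau} and the operators S_1, S_2 *)

Section scheme.
Context (R : realType) (d : measure_display) (Omega : measurableType d)
  (P : probability Omega R) (W : R -> Omega -> R).
Context (n : nat) (O : set 'rV[R]_n) (mesh : seq 'M[R]_(n.+1, n)).

Local Notation fn := ('rV[R]_n -> R).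
Local Notation process := (R -> Omega -> 'rV[R]_n -> R).

Definition node (T : R) (J j : nat) : R := j%:R * (T / J%:R).

(* Elements of X_{h,tau} have values at every node, including t_0 = 0 and
   t_J = T. *)
Definition Xhtau (T : R) (J : nat) : set process :=
  [set V | [/\ L2F P W O T (Vh O mesh) V,
      forall t w, 0 <= t <= T -> Vh O mesh (V t w) &
      forall j t w, (j < J)%N -> node T J j <= t < node T J j.+1 ->
        L2eq O (V t w) (V (node T J j) w)]].

(* p = S_1 g and z = S_2 g *)
Definition is_S1_S2 (T : R) (J : nat) (Qh Dh : fn -> fn) (g p z : process) :
    Prop :=
  [/\ Xhtau T J p,
      L2F P W O T (Vh O mesh) z,
      {ae P, forall w, L2eq O (p (node T J J) w) (cst 0)} &
      forall j, (j < J)%N ->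
      exists A I : Omega -> fn,
      is_ito P W O (node T J j) (node T J j.+1) z I /\
      {ae P, forall w,
        is_bochner O (node T J j) (node T J j.+1)
          (fun t => z t w \+ Qh (g t w)) (A w) /\
        L2eq O (p (node T J j) w \- p (node T J j.+1) w)
          (fun x => T / J%:R * Dh (p (node T J j) w) x + A w x - I w x)}].

End scheme.

(* Main.v *)
(* With p_j and z the two components of the solution, the scheme reads
   p_(j+1) + A_j = q_j + I_j, where q_j := p_j - tau Dh p_j, A_j is the Bochner
   integral of z + Qh g and I_j the Ito integral of z over (t_j, t_(j+1)).
   As q_j is F_(t_j)-measurable it is orthogonal to I_j, so that
   E|q_j|^2 + E|I_j|^2 = E|p_(j+1) + A_j|^2. Here |q_j| >= |p_j| because Dh is
   symmetric and dissipative, and E|I_j|^2 = Z_j, the integral of E|z|^2 over the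
   step, by the Ito isometry. On the right, Young's inequality with weight 5 tau
   gives (1 + 5 tau) E|p_(j+1)|^2 + (3/4) Z_j + 3 G_j, G_j being the integral of
   E|g|^2; the condition tau < 2/5 is what lets Z_j / 4 survive on the left.
   A discrete Gronwall argument, backwards from p_J = 0, bounds the sum of the Z_j
   by 12 exp(5T) times that of the G_j. All this is done coordinatewise in an
   orthonormal basis of the finite-dimensional space V_h, so that only real-valued
   processes have to be integrated. *)
Require Import Defs.
From mathcomp Require Import all_boot all_order all_algebra.
From mathcomp Require Import all_classical all_reals all_analysis.
From mathcomp Require Import measurable_realfun ring lra.

Set Implicit Arguments.
Unset Strict Implicit.
Unset Printing Implicit Defensive.

Import Order.TTheory GRing.Theory Num.Theory.
Import numFieldNormedType.Exports.

Local Open Scope classical_set_scope.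
Local Open Scope ring_scope.

(** Measurability is at hand only for inner products with fixed functions and for squared norms. The
    errors in [is_ito] and [is_bochner] are integrals of norms whose measurability is not given;
    they serve as upper bounds only, and the integral of a nonnegative function, being a supremum,
    is monotone without measurability. Membership in [Vh] goes through the definite description
    [inv_sqrt_laplacian], so closure under linear combinations cannot be read off from it: when an
    orthonormal family is enlarged, the new vector is a value of [Qh], and the coordinates of q_j
    are taken as inner products of p_j with the fixed functions e_i - tau Dh e_i. Progressive
    measurability concerns 0 < t < T, which leaves out t_0 = 0; p_j is therefore used as
    F_u-measurable for every u in (t_j, t_(j+1)), and its orthogonality to I_j follows by letting u
    decrease to t_j. Young's inequality is applied twice: with weight 5 tau to p_(j+1) + A_j, then
    with weight 1/4 to z + Qh g, which is where 3/4 and 3 arise; the factor 12 is 4 * 3, and exp(5T)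
    bounds (1 + 5 tau)^J. *)

Section integral_lemmas.
Context d (T : measurableType d) (R : realType).
Variable mu : {measure set T -> \bar R}.
Local Open Scope ereal_scope.

(* Unlike [ge0_le_integral], no measurability is required. *)
Lemma ge0_le_integral_nomeas (D : set T) (f g : T -> \bar R) :
  (forall x, D x -> 0 <= f x) -> (forall x, D x -> f x <= g x) ->
  \int[mu]_(x in D) f x <= \int[mu]_(x in D) g x.
Proof.
move=> f0 fg.
have g0 x : D x -> 0 <= g x by move=> Dx; exact: le_trans (f0 _ Dx) (fg _ Dx).
rewrite !ge0_integralE//; apply: ereal_sup_le => _ [h hf <-] /=.
exists h => // x.
apply: (le_trans (hf x)); rewrite /patch; case: ifPn => // /set_mem.
exact: fg.
Qed.

End integral_lemmas.

(** * The inner product of square-integrable functions *)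

Section square_integrable.
Context d (T : measurableType d) (R : realType).
Variable mu : {measure set T -> \bar R}.
Implicit Types f g h : T -> R.

Local Notation L2f := (Lfun mu 2%:E).

Definition mip f g : R := (\int[mu]_x (f x * g x))%R.
Definition mnorm f : R := Num.sqrt (mip f f).

Lemma Lfun2_measurable f : f \in L2f -> measurable_fun setT f.
Proof. by move=> /andP[]; rewrite inE. Qed.

Lemma Lfun2P f : f \in L2f <->
  measurable_fun setT f /\ (\int[mu]_x ((f x) ^+ 2)%:E < +oo)%E.
Proof.
split=> [lf|[mf lf]].
  split; first exact: Lfun2_measurable.
  have /integrableP[_] := Lfun2_integrable_sqr lf.
  by apply: le_lt_trans; apply: ge0_le_integral_nomeas => x _ /=;
    rewrite lee_fin ?sqr_ge0// ler_norm.
rewrite inE; apply/andP; split; first by rewrite inE.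
rewrite inE/= /finite_norm unlock poweR_lty//.
apply: le_lt_trans lf; apply: ge0_le_integral_nomeas => x _ /=.
  by rewrite lee_fin powR_ge0.
by rewrite lee_fin powR_mulrn// real_normK// num_real.
Qed.

Lemma Lfun2M f g : f \in L2f -> g \in L2f ->
  mu.-integrable setT (EFin \o (f \* g)).
Proof. by move=> lf lg; apply/Lfun1_integrable; exact: Lfun2_mul_Lfun1. Qed.

Lemma Lfun2D f g : f \in L2f -> g \in L2f -> (fun x => f x + g x) \in L2f.
Proof. by move=> lf lg; exact: (Lfun_addr_closed mu (lee1n 2)).2. Qed.

Lemma Lfun2Z (a : R) f : f \in L2f -> (fun x => a * f x) \in L2f.
Proof.
move=> lf.
rewrite (_ : (fun x => _) = a \o* f); last by apply/funext => x; rewrite mulrC.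
by apply: Lfun_scale => //; rewrite ler1n.
Qed.

Lemma Lfun2N f : f \in L2f -> (fun x => - f x) \in L2f.
Proof. by move=> lf; exact: (Lfun_oppr_closed (lf)). Qed.

Lemma Lfun2B f g : f \in L2f -> g \in L2f -> (fun x => f x - g x) \in L2f.
Proof. by move=> lf lg; apply: Lfun2D => //; exact: Lfun2N. Qed.

Lemma Lfun2_0 : (fun=> 0) \in L2f.
Proof. exact: (Lfun_addr_closed mu (lee1n 2)).1. Qed.

Lemma Lfun2_sum I (s : seq I) (F : I -> T -> R) :
  List.Forall (fun i => F i \in L2f) s ->
  (fun x => \sum_(i <- s) F i x) \in L2f.
Proof.
elim: s => [_|i s IH hs].
  rewrite (_ : (fun _ => _) = (fun=> 0)); first exact: Lfun2_0.
  by apply/funext => x; rewrite big_nil.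
inversion hs; subst.
rewrite (_ : (fun _ => _) = (fun x => F i x + \sum_(j <- s) F j x)).
  by apply: Lfun2D => //; exact: IH.
by apply/funext => x; rewrite big_cons.
Qed.

Lemma mipC f g : mip f g = mip g f.
Proof. by rewrite /mip; congr fine; apply: eq_integral => x _; rewrite mulrC. Qed.

Lemma mipDl f g h : f \in L2f -> g \in L2f -> h \in L2f ->
  mip (fun x => f x + g x) h = mip f h + mip g h.
Proof.
move=> lf lg lh; rewrite /mip -RintegralD//; last 2 first.
- exact: Lfun2M lf lh.
- exact: Lfun2M lg lh.
by congr fine; apply: eq_integral => x _; rewrite mulrDl.
Qed.

Lemma mipZl (a : R) f g : f \in L2f -> g \in L2f ->
  mip (fun x => a * f x) g = a * mip f g.
Proof.
move=> lf lg; rewrite /mip -RintegralZl//; last exact: Lfun2M lf lg.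
by congr fine; apply: eq_integral => x _; rewrite mulrA.
Qed.

Lemma mipBl f g h : f \in L2f -> g \in L2f -> h \in L2f ->
  mip (fun x => f x - g x) h = mip f h - mip g h.
Proof.
move=> lf lg lh; rewrite /mip -RintegralB//; last 2 first.
- exact: Lfun2M lf lh.
- exact: Lfun2M lg lh.
by congr fine; apply: eq_integral => x _; rewrite mulrBl.
Qed.

Lemma mipDr f g h : f \in L2f -> g \in L2f -> h \in L2f ->
  mip h (fun x => f x + g x) = mip h f + mip h g.
Proof. by move=> lf lg lh; rewrite mipC mipDl// !(mipC h). Qed.

Lemma mipBr f g h : f \in L2f -> g \in L2f -> h \in L2f ->
  mip h (fun x => f x - g x) = mip h f - mip h g.
Proof. by move=> lf lg lh; rewrite mipC mipBl// !(mipC h). Qed.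

Lemma mipZr (a : R) f g : f \in L2f -> g \in L2f ->
  mip f (fun x => a * g x) = a * mip f g.
Proof. by move=> lf lg; rewrite mipC mipZl// mipC. Qed.

Lemma mip0l f : mip (fun=> 0) f = 0.
Proof.
rewrite /mip (_ : (fun x => _) = cst 0) ?/Rintegral ?integral0//.
by apply/funext => x; rewrite /= mul0r.
Qed.

Lemma mip_suml I (s : seq I) (F : I -> T -> R) g :
  List.Forall (fun i => F i \in L2f) s -> g \in L2f ->
  mip (fun x => \sum_(i <- s) F i x) g = \sum_(i <- s) mip (F i) g.
Proof.
move=> + lg; elim: s => [_|i s IH hs].
  rewrite big_nil -[RHS](mip0l g); congr (mip _ g).
  by apply/funext => x; rewrite big_nil.
inversion hs; subst.
rewrite big_cons -IH// -mipDl//; last exact: Lfun2_sum.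
by congr mip; apply/funext => x; rewrite big_cons.
Qed.

Lemma mip_sumr I (s : seq I) (F : I -> T -> R) g :
  List.Forall (fun i => F i \in L2f) s -> g \in L2f ->
  mip g (fun x => \sum_(i <- s) F i x) = \sum_(i <- s) mip g (F i).
Proof.
move=> hs lg; rewrite mipC mip_suml//.
by apply: eq_bigr => i _; rewrite mipC.
Qed.

Lemma mip_ge0 f : 0 <= mip f f.
Proof. by apply: Rintegral_ge0 => x _; rewrite -expr2 sqr_ge0. Qed.

Lemma mip_sqrE f : f \in L2f -> (mip f f)%:E = (\int[mu]_x ((f x) ^+ 2)%:E)%E.
Proof.
move=> lf; rewrite /mip /Rintegral fineK.
  by apply: eq_integral => x _; rewrite expr2.
by apply: integrable_fin_num => //; exact: (Lfun2M lf (lf)).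
Qed.

Lemma ae_eq_mip f f' g g' : measurable_fun setT f -> measurable_fun setT f' ->
  measurable_fun setT g -> measurable_fun setT g' ->
  f = f' %[ae mu] -> g = g' %[ae mu] -> mip f g = mip f' g'.
Proof.
move=> mf mf' mg mg' ff' gg'; congr fine; apply: ae_eq_integral => //.
- by apply/measurable_EFinP; exact: measurable_funM.
- by apply/measurable_EFinP; exact: measurable_funM.
- by apply: filterS2 ff' gg' => x /= /(_ I) -> /(_ I) ->.
Qed.

(** The quadratic polynomial a -> |f - a g|^2 is nonnegative. Its minimum, at a = <f, g> / <g, g>,
    gives the bound; if g has norm 0 the polynomial is affine, which forces <f, g> = 0. *)
Lemma CauchySchwarz_mip f g : f \in L2f -> g \in L2f ->
  mip f g ^+ 2 <= mip f f * mip g g.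
Proof.
move=> lf lg.
have key (a : R) : 0 <= mip f f - 2 * a * mip f g + a ^+ 2 * mip g g.
  have := mip_ge0 (fun x => f x - a * g x).
  have lag := Lfun2Z a lg.
  rewrite (mipBl lf lag (Lfun2B lf lag)) (mipBr lf lag lf) (mipBr lf lag lag).
  rewrite (mipZl a lg lf) (mipZl a lg lag) !mipZr// (mipC g f).
  by congr (0 <= _); ring.
have [g0|g0] := eqVneq (mip g g) 0.
  have [->|fg0] := eqVneq (mip f g) 0; first by rewrite g0 mulr0 expr0n.
  (* At this point the affine polynomial takes the value -1. *)
  have := key ((mip f f + 1) / (2 * mip f g)).
  rewrite g0 mulr0 addr0.
  rewrite (_ : 2 * _ * _ = mip f f + 1); last by field.
  by lra.
have gp : 0 < mip g g by rewrite lt_neqAle eq_sym g0 mip_ge0.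
have := key (mip f g / mip g g).
rewrite (_ : _ - _ + _ = mip f f - mip f g ^+ 2 / mip g g); last by field.
by rewrite subr_ge0 ler_pdivrMr.
Qed.

Lemma mnorm_ge0 f : 0 <= mnorm f. Proof. exact: sqrtr_ge0. Qed.

Lemma sqr_mnorm f : mnorm f ^+ 2 = mip f f.
Proof. by rewrite sqr_sqrtr// mip_ge0. Qed.

Lemma ler_norm_mip f g : f \in L2f -> g \in L2f ->
  `|mip f g| <= mnorm f * mnorm g.
Proof.
move=> lf lg; rewrite -(@ler_pXn2r _ 2)// ?nnegrE// ?mulr_ge0 ?mnorm_ge0//.
by rewrite real_normK ?num_real// exprMn !sqr_mnorm CauchySchwarz_mip.
Qed.

Lemma ler_mnormD f g : f \in L2f -> g \in L2f ->
  mnorm (fun x => f x + g x) <= mnorm f + mnorm g.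
Proof.
move=> lf lg; rewrite -(@ler_pXn2r _ 2)// ?nnegrE// ?addr_ge0 ?mnorm_ge0//.
rewrite sqrrD !sqr_mnorm mipDl ?Lfun2D// !mipDr// (mipC g f).
have := ler_norm_mip lf lg; have := ler_norm (mip f g).
rewrite -mulr_natl; lra.
Qed.

Lemma mnormBC f g : mnorm (fun x => f x - g x) = mnorm (fun x => g x - f x).
Proof.
congr (Num.sqrt (fine _)); apply: eq_integral => x _; congr EFin; ring.
Qed.

Lemma ler_dist_mnorm f g : f \in L2f -> g \in L2f ->
  `|mnorm f - mnorm g| <= mnorm (fun x => f x - g x).
Proof.
move=> lf lg.
have H u v : u \in L2f -> v \in L2f ->
    mnorm u - mnorm v <= mnorm (fun x => u x - v x).
  move=> lu lv; rewrite lerBlDr.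
  have := ler_mnormD (Lfun2B lu lv) lv.
  by under eq_fun do rewrite subrK.
have := H _ _ lf lg; have := H _ _ lg lf; rewrite (mnormBC g f).
by rewrite ler_norml => ? ?; apply/andP; split; lra.
Qed.

Lemma cvg_mnorm (u : nat -> T -> R) f : f \in L2f -> (forall k, u k \in L2f) ->
  (fun k => mip (fun x => u k x - f x) (fun x => u k x - f x)) @ \oo --> 0 ->
  (fun k => mip (u k) (u k)) @ \oo --> mip f f.
Proof.
move=> lf lu uf.
have nuf : (fun k => mnorm (fun x => u k x - f x)) @ \oo --> 0.
  rewrite -(sqrtr0 R); apply: continuous_cvg => //; exact: sqrt_continuous.
have {}nuf : (fun k => mnorm (u k)) @ \oo --> mnorm f.
  apply/cvgrPdist_le => e e0; have /cvgrPdist_le/(_ e e0) := nuf.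
  apply: filterS => k; rewrite sub0r normrN ger0_norm ?mnorm_ge0//.
  by apply: le_trans; rewrite distrC; exact: ler_dist_mnorm.
rewrite -sqr_mnorm; under eq_fun do rewrite -sqr_mnorm.
by under eq_fun do rewrite expr2; rewrite expr2; exact: cvgM.
Qed.

Lemma cvg_mip (u : nat -> T -> R) f g : f \in L2f -> g \in L2f ->
  (forall k, u k \in L2f) ->
  (fun k => mip (fun x => u k x - f x) (fun x => u k x - f x)) @ \oo --> 0 ->
  (fun k => mip g (u k)) @ \oo --> mip g f.
Proof.
move=> lf lg lu uf.
have nuf : (fun k => mnorm (fun x => u k x - f x)) @ \oo --> 0.
  rewrite -(sqrtr0 R); apply: continuous_cvg => //; exact: sqrt_continuous.
have {}nuf : (fun k => mnorm g * mnorm (fun x => u k x - f x)) @ \oo --> 0.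
  by rewrite -(mulr0 (mnorm g)); apply: cvgM => //; exact: cvg_cst.
apply/cvgrPdist_le => e e0; have /cvgrPdist_le/(_ e e0) := nuf.
apply: filterS => k; rewrite sub0r normrN ger0_norm ?mulr_ge0 ?mnorm_ge0//.
apply: le_trans; rewrite -mipBr// mnormBC; apply: ler_norm_mip => //.
exact: Lfun2B.
Qed.

End square_integrable.

(** * Hyperplanes and simplices *)

Section euclidean_space.
Context {R : realType} (n : nat).
Local Notation leb := (lebesgue_rV R n).
Local Notation pt := 'rV[R]_n.

Lemma measurable_coord_itv (i : 'I_n) (I : set R) : measurable I ->
  measurable [set x : pt | I (x 0 i)].
Proof. by move=> mI; rewrite -[X in measurable X]setTI; exact: measurable_coord. Qed.

Lemma measurable_forall_coord m (B : 'I_m -> set pt) :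
  (forall i, measurable (B i)) -> measurable [set x | forall i, B i x].
Proof.
move=> mB; rewrite (_ : [set _ | _] = \bigcap_(i in [set: 'I_m]) B i).
  by apply: fin_bigcap_measurable => [|i _]; [exact: finite_finset|exact: mB].
by apply/seteqP; split => x /= h i; [move=> _|]; exact: h.
Qed.

(** The sigma-algebra is generated by the coordinates, so open sets have to be recovered: each is
    the union of the countably many boxes with rational centre and half-width that it contains. *)
Lemma open_measurable_rV (U : set pt) : open U -> measurable U.
Proof.
move=> oU.
pose box (p : 'rV[rat]_n * rat) : set pt :=
  [set x | forall i, `|x 0 i - ratr (p.1 0 i)| < ratr p.2].
rewrite (_ : U = \bigcup_p (if `[< box p `<=` U >] then box p else set0)).
  apply: countable_bigcupT_measurable => [|p]; first exact: countableP.
  case: ifP => // _; apply: measurable_forall_coord => i.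
  rewrite [X in measurable X](_ : _ = [set x : pt | `]ratr (p.1 0 i) - ratr p.2,
      ratr (p.1 0 i) + ratr p.2[%classic (x 0 i)]).
    exact: measurable_coord_itv.
  by apply/seteqP; split => x /=; rewrite in_itv/= ltr_distl.
apply/seteqP; split => [x Ux|x [p _]]; last by case: asboolP => // + bx; exact.
have /nbhs_ballP[e /= e0 eU] := open_nbhs_nbhs (conj oU Ux).
(* A box of half-width k that contains x stays within 2k < e of x. *)
have [k] := rat_in_itvoo (divr_gt0 e0 (@ltr0n R 2)).
rewrite in_itv/= => /andP[k0 ke].
have ck (i : 'I_n) : exists q : rat, x 0 i - ratr k < ratr q < x 0 i + ratr k.
  have [|q] := @rat_in_itvoo R (x 0 i - ratr k) (x 0 i + ratr k); first lra.
  by rewrite in_itv/= => h; exists q.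
have [c hc] := choice ck.
exists (\row_i c i, k) => //.
have bU : box (\row_i c i, k) `<=` U.
  move=> y yb; apply: eU; split=> // i j; rewrite (ord1 i).
  have := yb j; have := hc j; rewrite /= !mxE /ball/= => /andP[? ?].
  by rewrite !ltr_norml => /andP[? ?]; apply/andP; split; lra.
rewrite asboolT// => i /=; have := hc i; rewrite !mxE => /andP[? ?].
by rewrite ltr_norml; apply/andP; split; lra.
Qed.

Lemma measurable_dotp (a : pt) : measurable_fun setT (dotp a).
Proof.
rewrite (_ : dotp a = fun x => \sum_(i < n) (a 0 i * x 0 i)); last first.
  by apply/funext.
apply: measurable_sum => i; apply: measurable_funM => //; exact: measurable_coord.
Qed.

Lemma measurable_hyperplane (a : pt) (b : R) : measurable [set x | dotp a x = b].
Proof.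
have := measurable_dotp a measurableT (measurable_set1 b).
by rewrite setTI.
Qed.

Lemma dotpBl (a b x : pt) : dotp (a - b) x = dotp a x - dotp b x.
Proof.
by rewrite /dotp -sumrB; apply: eq_bigr => i _; rewrite !mxE mulrBl.
Qed.

End euclidean_space.

Lemma dotp_cons_rV (R : realType) n (a : 'rV[R]_n.+1) (p : R * 'rV[R]_n) :
  dotp a (cons_rV p) = a 0 ord0 * p.1 + dotp (\row_j a 0 (lift ord0 j)) p.2.
Proof.
rewrite /dotp big_ord_recl /cons_rV !mxE unlift_none/=; congr (_ + _).
by apply: eq_bigr => i _; rewrite !mxE liftK.
Qed.

(** Induction on the dimension. If the first coefficient vanishes, the sections at a fixed first
    coordinate are hyperplanes of lower dimension; otherwise Tonelli's theorem allows slicing along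
    the first coordinate, where each section is a single point. *)
Lemma hyperplane_null (R : realType) n (a : 'rV[R]_n) (b : R) :
  a != 0 -> lebesgue_rV R n [set x | dotp a x = b] = 0%E.
Proof.
elim: n a b => [a b|n IH a b a0].
  by rewrite (_ : a = 0) ?eqxx//; apply/rowP => -[].
rewrite /= /lebesgue_cons.
set A := _ @^-1` _.
have mA : measurable A.
  rewrite -[X in measurable X]setTI; apply: measurable_cons_rV => //.
  exact: measurable_hyperplane.
have [a00|a00] := eqVneq (a 0 ord0) 0.
  rewrite [LHS]integral0_eq// => t _ /=.
  rewrite -(IH (\row_j a 0 (lift ord0 j)) b); last first.
    apply: contra a0 => /eqP h; apply/eqP/rowP => i; rewrite !mxE.
    case: (unliftP ord0 i) => [j ->|->//].
    by move/rowP : h => /(_ j); rewrite !mxE.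
  congr (lebesgue_rV R n _); apply/seteqP; split => x;
    by rewrite /xsection/= inE /A/= dotp_cons_rV a00 mul0r add0r.
have := @indic_fubini_tonelli _ _ _ _ _ (@lebesgue_measure R) (lebesgue_rV R n) A mA.
rewrite indic_fubini_tonelli_FE// indic_fubini_tonelli_GE// => H.
rewrite [LHS]H integral0_eq// => x _ /=.
rewrite (_ : ysection A x =
  [set (b - dotp (\row_j a 0 (lift ord0 j)) x) / a 0 ord0]).
  exact: lebesgue_measure_set1.
apply/seteqP; split => t; rewrite /ysection/= inE /A/= dotp_cons_rV/=.
  by move=> <-; field.
by move=> ->; field.
Qed.

Section simplices.
Context {R : realType} (n : nat).
Local Notation leb := (lebesgue_rV R n).
Local Notation pt := 'rV[R]_n.
Implicit Type K : 'M[R]_(n.+1, n).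

Let cons_rV0 (x : pt) : cons_rV (1, x) 0 ord0 = 1.
Proof. by rewrite mxE unlift_none. Qed.

Let cons_rVS (x : pt) j : cons_rV (1, x) 0 (lift ord0 j) = x 0 j.
Proof. by rewrite mxE liftK. Qed.

(** A leading 1 turns affine relations, with coefficients of sum zero, into linear relations, so
    affine independence becomes invertibility of a square matrix. *)
Definition homogenized_vertices K : 'M[R]_n.+1 :=
  \matrix_i cons_rV (1, row i K).

Let rowP_lift (x y : 'rV[R]_n.+1) : x 0 ord0 = y 0 ord0 ->
  (forall j, x 0 (lift ord0 j) = y 0 (lift ord0 j)) -> x = y.
Proof.
by move=> h0 hS; apply/rowP => k; case: (unliftP ord0 k) => [j ->|->//].
Qed.

Lemma homogenized_vertices_unit K :
  affinely_independent K -> homogenized_vertices K \in unitmx.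
Proof.
move=> aK; rewrite -row_free_unit; apply: inj_row_free => c.
rewrite mulmx_sum_row => cK; apply/rowP => i; rewrite mxE; apply: aK.
  have /rowP/(_ ord0) := cK; rewrite summxE [RHS]mxE => e; rewrite -[RHS]e.
  by apply: eq_bigr => j _; rewrite rowK [RHS]mxE cons_rV0 mulr1.
apply/rowP => k; have /rowP/(_ (lift ord0 k)) := cK.
rewrite !summxE [RHS]mxE => e; rewrite [RHS]mxE -[RHS]e.
by apply: eq_bigr => j _; rewrite rowK !mxE liftK/= ?mxE.
Qed.

Let cons_rV_comb m (p : 'I_m -> pt) (c : 'I_m -> R) : \sum_i c i = 1 ->
  cons_rV (1, \sum_i c i *: p i) = \sum_i c i *: cons_rV (1, p i).
Proof.
move=> c1; apply: rowP_lift => [|j].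
  by rewrite cons_rV0 summxE -[LHS]c1; apply: eq_bigr => i _;
    rewrite mxE cons_rV0 mulr1.
by rewrite cons_rVS !summxE; apply: eq_bigr => i _; rewrite !mxE liftK.
Qed.

(* The coordinates of (1, x) in the basis of the homogenized vertices are the
   barycentric coordinates of x. *)
Lemma simplexP K x : affinely_independent K -> simplex K x <->
  forall i, 0 <= (cons_rV (1, x) *m invmx (homogenized_vertices K)) 0 i.
Proof.
move=> aK; have uK := homogenized_vertices_unit aK; split.
  move=> [m [p [c [pK c0 c1 ->]]]] i.
  rewrite cons_rV_comb// mulmx_suml summxE sumr_ge0// => j _.
  have [k _ <-] := pK j; rewrite -scalemxAl mxE.
  have -> : cons_rV (1, row k K) = row k (homogenized_vertices K) by rewrite rowK.
  by rewrite -row_mul mulmxV// mulr_ge0// !mxE ler0n.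
set c := _ *m _ => c0.
have : c *m homogenized_vertices K = cons_rV (1, x) by rewrite /c mulmxKV.
rewrite mulmx_sum_row; clearbody c => e.
have c1 : \sum_i c 0 i = 1.
  have /rowP/(_ ord0) := e.
  rewrite summxE cons_rV0 => <-; apply: eq_bigr => i _.
  by rewrite rowK [RHS]mxE cons_rV0 mulr1.
exists n.+1, (fun i => row i K), (fun i => c 0 i); split => // [i|]; first by exists i.
apply/rowP => k; have /rowP/(_ (lift ord0 k)) := e; rewrite cons_rVS => <-.
by rewrite !summxE; apply: eq_bigr => i _; rewrite rowK !mxE liftK/= ?mxE.
Qed.

Lemma measurable_simplex K : affinely_independent K -> measurable (simplex K).
Proof.
move=> aK; rewrite (_ : simplex K = [set x | forall i, [set y : pt |
    0 <= (cons_rV (1, y) *m invmx (homogenized_vertices K)) 0 i] x]).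
  pose B := fun i => [set y : pt |
    0 <= (cons_rV (1, y) *m invmx (homogenized_vertices K)) 0 i].
  apply: (measurable_forall_coord (B := B)) => i; rewrite /B.
  rewrite [X in measurable X](_ : _ = [set: pt] `&`
    (fun x : pt => (cons_rV (1, x) *m invmx (homogenized_vertices K)) 0 i)
      @^-1` `[0, +oo[%classic).
    suff : measurable_fun [set: pt] (fun x : pt =>
        (cons_rV (1, x) *m invmx (homogenized_vertices K)) 0 i) by exact.
    under eq_fun do rewrite mxE.
    apply: measurable_sum => j; apply: measurable_funM => //.
    case: (unliftP ord0 j) => [k ->|->].
      by under eq_fun do rewrite cons_rVS; exact: measurable_coord.
    by under eq_fun do rewrite cons_rV0; exact: measurable_cst.
  by apply/seteqP; split => x /=; rewrite in_itv/= andbT; [split|case].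
by apply/seteqP; split => x; [move=> /simplexP|move=> h; apply/simplexP]; exact.
Qed.

Lemma simplex_lty K : affinely_independent K -> (leb (simplex K) < +oo)%E.
Proof.
(* [B] bounds every coordinate of every vertex, hence of every convex combination of vertices: the
   simplex lies in a cube. *)
move=> aK; pose B := \sum_i \sum_j `|K i j|.
apply: (@le_lt_trans _ _ (leb [set x | forall i, `[- B, B]%classic (x 0 i)])).
  apply: le_measure; rewrite ?inE.
  - exact: measurable_simplex.
  - by apply: measurable_forall_coord => i; exact: measurable_coord_itv.
  - move=> x [m [p [c [pK c0 c1 ->]]]] k /=; rewrite in_itv/= -ler_norml summxE.
    apply: (le_trans (ler_norm_sum _ _ _)).
    rewrite -[B]mul1r -c1 mulr_suml; apply: ler_sum => i _.
    rewrite mxE normrM ger0_norm// ler_wpM2l//.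
    have [j _ <-] := pK i; rewrite mxE /B.
    rewrite (bigD1 j)//= (bigD1 k)//= -addrA lerDl addr_ge0//.
      by apply: sumr_ge0 => ? _; exact: normr_ge0.
    by apply: sumr_ge0 => ? _; apply: sumr_ge0 => ? _; exact: normr_ge0.
rewrite (@lebesgue_rV_box R n (fun=> ([set` `[- B, B]] : set R)))//.
suff /andP[//] : (0 <= \prod_(i < n) lebesgue_measure (`[(- B)%R, B]%classic : set R)
    < +oo)%E.
apply: (big_ind (fun z : \bar R => 0 <= z < +oo)%E) => [|x y /andP[x0 xy] /andP[y0 yy]|i _].
- by rewrite lee01 ltry.
- by rewrite mule_ge0// lte_mul_pinfty// ge0_fin_numE.
- by rewrite measure_ge0/= lebesgue_measure_itv/=; case: ifP => _; rewrite ltry.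
Qed.

End simplices.

Section Lfun_indic.
Context d (T : measurableType d) (R : realType).
Variable mu : {measure set T -> \bar R}.

Lemma Lfun2_indic (S : set T) : measurable S -> (mu S < +oo)%E ->
  (\1_S : T -> R) \in Lfun mu 2%:E.
Proof.
move=> mS fS; apply/Lfun2P; split; first exact: measurable_indic.
rewrite (_ : (\int[mu]_x _)%E = mu S)// -[in RHS](setIT S) -integral_indic//.
apply: eq_integral => x _; rewrite indicE; congr EFin.
by case: (_ \in _); rewrite ?expr1n ?expr0n.
Qed.

Lemma Lfun2_mul_indic (S : set T) (f : T -> R) : measurable S ->
  f \in Lfun mu 2%:E -> (fun x => f x * \1_S x) \in Lfun mu 2%:E.
Proof.
move=> mS /[dup] lf /Lfun2P[mf fy]; apply/Lfun2P; split.
  by apply: measurable_funM => //; exact: measurable_indic.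
apply: le_lt_trans fy; apply: ge0_le_integral_nomeas => x _.
  by rewrite lee_fin sqr_ge0.
rewrite lee_fin indicE; case: (_ \in _); rewrite ?mulr1// mulr0 expr0n/=.
exact: sqr_ge0.
Qed.

End Lfun_indic.

Lemma ae_forall_seq d (T : measurableType d) (R : realType)
    (mu : {measure set T -> \bar R}) (I : eqType) (s : seq I)
    (Q : I -> T -> Prop) :
  (forall i, i \in s -> {ae mu, forall x, Q i x}) ->
  {ae mu, forall x, forall i, i \in s -> Q i x}.
Proof.
elim: s => [_|i s IH h]; first exact: aeW.
have hi := h i (mem_head _ _).
have {}IH : {ae mu, forall x, forall j, j \in s -> Q j x}.
  by apply: IH => j js; apply: h; rewrite inE js orbT.
by apply: filterS2 hi IH => x hi hs j; rewrite inE => /predU1P[->//|]; exact: hs.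
Qed.

(** * Gradients of finite element functions *)

Section gradients.
Context {R : realType} (n : nat) (O : set 'rV[R]_n).
Local Notation leb := (lebesgue_rV R n).
Local Notation pt := 'rV[R]_n.

(** If the slopes differ, the two affine functions agree only on a hyperplane, which is null, so
    almost no point lies in both simplices. This makes the choice of a slope harmless where elements
    overlap. *)
Lemma affine_eq_slope (K L : 'M[R]_(n.+1, n)) (v : pt -> R) (a a' : pt) (b b' : R) :
  {ae leb, forall x, simplex K x -> v x = dotp a x + b} ->
  {ae leb, forall x, simplex L x -> v x = dotp a' x + b'} ->
  {ae leb, forall x, simplex K x -> simplex L x -> a = a'}.
Proof.
move=> hK hL; have [->|aa'] := eqVneq a a'; first exact: aeW.
have : {ae leb, forall x, ~ dotp (a - a') x = b' - b}.
  exists [set x | dotp (a - a') x = b' - b]; split.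
  - exact: measurable_hyperplane.
  - by apply: hyperplane_null; rewrite subr_eq0.
  - by move=> x /= /contrapT.
apply: filterS3 hK hL => x hK hL + Kx Lx; rewrite dotpBl => /(_ _)[].
by have := hK Kx; rewrite (hL Lx) => e; lra.
Qed.

(** Elements share faces, so a choice is made: the slope on the first element of the list that
    contains the point, and 0 outside the mesh. *)
Definition piecewise_slope (a : 'M[R]_(n.+1, n) -> pt) (i : 'I_n)
    (mesh : seq 'M[R]_(n.+1, n)) : pt -> R :=
  foldr (fun K f x => if `[< simplex K x >] then a K 0 i else f x) (fun=> 0) mesh.

Lemma piecewise_slopeP a mesh x K : K \in mesh -> simplex K x ->
  exists2 L, L \in mesh /\ simplex L x &
    forall i, piecewise_slope a i mesh x = a L 0 i.
Proof.
elim: mesh => // L mesh IH KL Kx /=; case: asboolP => Lx.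
  by exists L; rewrite ?mem_head.
move: KL; rewrite inE => /predU1P[KL|Km]; first by move: Kx; rewrite KL.
by have [M [Mm Mx] h] := IH Km Kx; exists M => //; rewrite inE Mm orbT.
Qed.

Lemma L2_piecewise_slope a i mesh : open O ->
  (forall K, K \in mesh -> affinely_independent K) ->
  L2 O (piecewise_slope a i mesh).
Proof.
move=> oO; have mO := open_measurable_rV oO; rewrite /L2/=.
elim: mesh => [_|K mesh IH hK].
  rewrite (_ : _ \_ O = (fun=> 0)); first exact: Lfun2_0.
  by apply/funext => x; rewrite patchE; case: ifP.
have aK : affinely_independent K by apply: hK; rewrite mem_head.
have mK := measurable_simplex aK.
have {}IH : piecewise_slope a i mesh \_ O \in Lfun leb 2%:E.
  by apply: IH => L Lm; apply: hK; rewrite inE Lm orbT.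
rewrite (_ : _ \_ O = (fun x => a K 0 i * \1_(simplex K `&` O) x +
  (((piecewise_slope a i mesh) \_ O) x -
   ((piecewise_slope a i mesh) \_ O) x * \1_(simplex K) x))).
  apply: Lfun2D; last by apply: Lfun2B => //; exact: Lfun2_mul_indic.
  apply: Lfun2Z; apply: Lfun2_indic; first exact: measurableI.
  apply: le_lt_trans (simplex_lty aK); apply: le_measure; rewrite ?inE//.
  exact: measurableI.
apply/funext => x; rewrite !patchE !indicE in_setI; case: ifPn => xO /=.
  by case: asboolP => xK; rewrite ?(mem_set xK) ?(memNset xK)/= ?mulr1; ring.
by rewrite andbF mulr0 mul0r subr0 addr0.
Qed.

(** [is_discrete_laplacian] gives its identity only for functions that come with a gradient; this
    provides one for every element of [Vh]. *)
Lemma Vh_grad mesh v : open O ->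
  (forall K, K \in mesh -> affinely_independent K) ->
  Vh O mesh v -> exists G, is_grad O mesh v G.
Proof.
move=> oO hmesh [_ hv].
have /choice[ab hab] : forall K, exists ab : pt * R, K \in mesh ->
    {ae leb, forall x, simplex K x -> v x = dotp ab.1 x + ab.2}.
  move=> K; have [Km|Km] := boolP (K \in mesh); last by exists (0, 0).
  by have [a [b h]] := hv K Km; exists (a, b).
pose a K := (ab K).1.
exists (fun i => piecewise_slope a i mesh); split => [i|K Km].
  exact: L2_piecewise_slope.
exists (a K), (ab K).2.
have H : {ae leb, forall x, forall L, L \in mesh ->
    simplex K x -> simplex L x -> a K = a L}.
  by apply: ae_forall_seq => L Lm; exact: affine_eq_slope (hab K Km) (hab L Lm).
apply: filterS2 (hab K Km) H => x h1 h2 Kx; split; first exact: h1.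
have [L [Lm Lx] e] := piecewise_slopeP a Km Kx.
by move=> i; rewrite e (h2 L Lm Kx Lx).
Qed.

End gradients.

Lemma List_Forall_all I (Q : I -> Prop) (s : seq I) :
  (forall i, Q i) -> List.Forall Q s.
Proof. by move=> h; elim: s => [|i s IH]; constructor. Qed.

(** * The inner product and the norm of L^2(O) *)

Section restrict.
Context {R : realType} (T : Type) (O : set T).
Implicit Types u v : T -> R.

Lemma restrict_add u v :
  (fun x => u x + v x) \_ O = (fun x => (u \_ O) x + (v \_ O) x).
Proof. by apply/funext => x; rewrite !patchE; case: ifP; rewrite ?addr0. Qed.

Lemma restrict_sub u v :
  (fun x => u x - v x) \_ O = (fun x => (u \_ O) x - (v \_ O) x).
Proof. by apply/funext => x; rewrite !patchE; case: ifP; rewrite ?subr0. Qed.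

Lemma restrict_scale (a : R) u :
  (fun x => a * u x) \_ O = (fun x => a * (u \_ O) x).
Proof. by apply/funext => x; rewrite !patchE; case: ifP; rewrite ?mulr0. Qed.

Lemma restrict_sum I (s : seq I) (F : I -> T -> R) :
  (fun x => \sum_(i <- s) F i x) \_ O = (fun x => \sum_(i <- s) (F i \_ O) x).
Proof.
apply/funext => x; rewrite !patchE; case: ifPn => h.
  by apply: eq_bigr => i _; rewrite patchE h.
by rewrite big1// => i _; rewrite patchE (negbTE h).
Qed.

End restrict.

Section L2_inner_product.
Context {R : realType} (n : nat) (O : set 'rV[R]_n).
Local Notation leb := (lebesgue_rV R n).
Local Notation fn := ('rV[R]_n -> R).
Implicit Types u v w : fn.

(** Extension by zero outside [O] reduces L^2(O) to square-integrable functions on the whole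
    space. *)
Lemma L2ipE u v : L2ip O u v = mip leb (u \_ O) (v \_ O).
Proof.
rewrite /L2ip /mip Rintegral_mkcond; congr fine; apply: eq_integral => x _.
by rewrite !patchE; case: ifP; rewrite ?mulr0.
Qed.

Lemma L2D u v : L2 O u -> L2 O v -> L2 O (fun x => u x + v x).
Proof. by rewrite /L2/= restrict_add; exact: Lfun2D. Qed.

Lemma L2B u v : L2 O u -> L2 O v -> L2 O (fun x => u x - v x).
Proof. by rewrite /L2/= restrict_sub; exact: Lfun2B. Qed.

Lemma L2Z (a : R) u : L2 O u -> L2 O (fun x => a * u x).
Proof. by rewrite /L2/= restrict_scale; exact: Lfun2Z. Qed.

Lemma L2_sum I (s : seq I) (F : I -> fn) :
  List.Forall (fun i => L2 O (F i)) s -> L2 O (fun x => \sum_(i <- s) F i x).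
Proof. by rewrite /L2/= restrict_sum; exact: Lfun2_sum. Qed.

Lemma L2ipC u v : L2ip O u v = L2ip O v u.
Proof. by rewrite !L2ipE mipC. Qed.

Lemma L2ipDl u v w : L2 O u -> L2 O v -> L2 O w ->
  L2ip O (fun x => u x + v x) w = L2ip O u w + L2ip O v w.
Proof. by rewrite /L2/= !L2ipE restrict_add; exact: mipDl. Qed.

Lemma L2ipBl u v w : L2 O u -> L2 O v -> L2 O w ->
  L2ip O (fun x => u x - v x) w = L2ip O u w - L2ip O v w.
Proof. by rewrite /L2/= !L2ipE restrict_sub; exact: mipBl. Qed.

Lemma L2ipZl (a : R) u w : L2 O u -> L2 O w ->
  L2ip O (fun x => a * u x) w = a * L2ip O u w.
Proof. by rewrite /L2/= !L2ipE restrict_scale; exact: mipZl. Qed.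

Lemma L2ipBr u v w : L2 O u -> L2 O v -> L2 O w ->
  L2ip O w (fun x => u x - v x) = L2ip O w u - L2ip O w v.
Proof. by move=> lu lv lw; rewrite L2ipC L2ipBl// !(L2ipC w). Qed.

Lemma L2ipZr (a : R) u w : L2 O u -> L2 O w ->
  L2ip O w (fun x => a * u x) = a * L2ip O w u.
Proof. by move=> lu lw; rewrite L2ipC L2ipZl// L2ipC. Qed.

Lemma L2ip_suml I (s : seq I) (F : I -> fn) w :
  List.Forall (fun i => L2 O (F i)) s -> L2 O w ->
  L2ip O (fun x => \sum_(i <- s) F i x) w = \sum_(i <- s) L2ip O (F i) w.
Proof.
rewrite /L2/= L2ipE restrict_sum => hs lw; rewrite mip_suml//.
by apply: eq_bigr => i _; rewrite L2ipE.
Qed.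

Lemma L2ip_ge0 u : 0 <= L2ip O u u.
Proof. by rewrite L2ipE mip_ge0. Qed.

Lemma CauchySchwarz_L2ip u v : L2 O u -> L2 O v ->
  L2ip O u v ^+ 2 <= L2ip O u u * L2ip O v v.
Proof. by rewrite /L2/= !L2ipE; exact: CauchySchwarz_mip. Qed.

Lemma L2normE u : L2 O u -> L2norm O u = (Num.sqrt (L2ip O u u))%:E.
Proof.
move=> lu; rewrite /L2norm unlock/= L2ipE.
rewrite (_ : (\int[leb]_x _)%E = (mip leb (u \_ O) (u \_ O))%:E).
  by rewrite poweR_EFin powR12_sqrt// mip_ge0.
rewrite mip_sqrE//; apply: eq_integral => x _ /=.
by rewrite powR_mulrn// real_normK// num_real.
Qed.

Lemma sqr_L2norm u : L2 O u -> (L2norm O u ^+ 2)%E = (L2ip O u u)%:E.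
Proof.
by move=> lu; rewrite L2normE// -EFin_expe sqr_sqrtr// L2ip_ge0.
Qed.

Lemma ler_norm_L2ip u v : L2 O u -> L2 O v ->
  (`|L2ip O u v|%:E <= L2norm O u * L2norm O v)%E.
Proof.
move=> lu lv; rewrite !L2normE// -EFinM lee_fin !L2ipE.
exact: ler_norm_mip.
Qed.

Lemma L2eq_patch u v : L2eq O u v -> u \_ O = v \_ O %[ae leb].
Proof.
apply: filterS => x h _; rewrite !patchE; case: ifPn => // /set_mem.
exact: h.
Qed.

Lemma L2eq_ip u v w : L2 O u -> L2 O v -> L2 O w -> L2eq O u v ->
  L2ip O u w = L2ip O v w.
Proof.
rewrite /L2/= => /Lfun2_measurable mu /Lfun2_measurable mv /Lfun2_measurable mw uv.
by rewrite !L2ipE; apply: ae_eq_mip => //; [exact: L2eq_patch|exact: aeW].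
Qed.

End L2_inner_product.

(** * Orthonormal bases of the finite element space *)

Section orthonormal_basis.
Context {R : realType} (n : nat) (O : set 'rV[R]_n)
  (mesh : seq 'M[R]_(n.+1, n)).
Local Notation leb := (lebesgue_rV R n).
Local Notation fn := ('rV[R]_n -> R).

Lemma Vh_L2 v : Vh O mesh v -> L2 O v.
Proof. by case=> -[]. Qed.

Definition orthonormal m (e : 'I_m -> fn) :=
  (forall i, Vh O mesh (e i)) /\
  forall i j, L2ip O (e i) (e j) = (i == j)%:R.

(** A function of [Vh] is determined on [O], up to a null set, by n + 1 affine coefficients per
    element. A family larger than the number of coefficients has a linear relation between its
    coefficient vectors, hence a nontrivial combination vanishing almost everywhere in [O], which
    orthonormality excludes. *)
Lemma orthonormal_bound m (e : 'I_m -> fn) :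
  O `<=` [set x | exists2 K, K \in mesh & simplex K x] ->
  orthonormal e -> (m <= size mesh * n.+1)%N.
Proof.
move=> Omesh [Ve oe]; rewrite leqNgt; apply/negP => mN.
have /choice[c hc] : forall p : 'I_m * 'I_(size mesh),
    exists c : R * 'rV[R]_n,
    {ae leb, forall x, simplex (tnth (in_tuple mesh) p.2) x ->
      e p.1 x = dotp c.2 x + c.1}.
  move=> [i k]; have [_ /(_ (tnth (in_tuple mesh) k))] := Ve i.
  by move=> /(_ (mem_tnth _ _))[a [b h]]; exists (b, a).
(* Row i lists the coefficients of [e i] on all elements, the constant term first on each. *)
pose M : 'M[R]_(m, size mesh * n.+1) :=
  \matrix_i mxvec (\matrix_k cons_rV (c (i, k))).
have : kermx M != 0.
  rewrite kermx_eq0 /row_free; apply/eqP => rM.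
  by have := rank_leq_col M; rewrite rM leqNgt mN.
move=> /rowV0Pn[z /sub_kermxP zM z0].
have {}zM k l : \sum_i z 0 i * cons_rV (c (i, k)) 0 l = 0.
  have := zM; rewrite mulmx_sum_row => /rowP/(_ (mxvec_index k l)).
  rewrite summxE [RHS]mxE => e0; rewrite -[RHS]e0; apply: eq_bigr => i _.
  by rewrite [RHS]mxE rowK mxvecE [in RHS]mxE.
have ezO : L2eq O (fun x => \sum_i z 0 i * e i x) (fun=> 0).
  have : {ae leb, forall x, forall k, k \in enum 'I_(size mesh) ->
      forall i, i \in enum 'I_m -> simplex (tnth (in_tuple mesh) k) x ->
      e i x = dotp (c (i, k)).2 x + (c (i, k)).1}.
    by apply: ae_forall_seq => k _; apply: ae_forall_seq => i _; exact: hc (i, k).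
  apply: filterS => x h Ox.
  have [K Km Kx] := Omesh _ Ox.
  have /tnthP[k eK] : K \in in_tuple mesh by [].
  rewrite eK in Kx.
  have eE i : e i x = dotp (cons_rV (c (i, k))) (cons_rV (1, x)).
    rewrite (h k _ i)// ?mem_enum// dotp_cons_rV mulr1 mxE unlift_none/= addrC.
    by congr (_ + dotp _ x); apply/rowP => l; rewrite !mxE liftK.
  under eq_bigr do rewrite eE /dotp mulr_sumr.
  rewrite exchange_big/= big1// => l _.
  by under eq_bigr do rewrite mulrA; rewrite -mulr_suml zM mul0r.
apply/negP: z0; apply/negPn/eqP/rowP => j; rewrite mxE.
have Le i : L2 O (e i) by exact: Vh_L2.
have := L2eq_ip _ _ (Le j) ezO; rewrite L2ip_suml//; last first.
  by apply: List_Forall_all => i; exact: L2Z.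
rewrite L2ipE (_ : (fun=> 0) \_ O = (fun=> 0)); last first.
  by apply/funext => x; rewrite patchE; case: ifP.
rewrite mip0l => <-; last 2 first.
- by apply: L2_sum; apply: List_Forall_all => i; exact: L2Z.
- rewrite /L2/= (_ : (fun=> 0) \_ O = (fun=> 0)); first exact: Lfun2_0.
  by apply/funext => x; rewrite patchE; case: ifP.
rewrite (bigD1 j)//= L2ipZl// oe eqxx mulr1 big1 ?addr0// => i ij.
by rewrite L2ipZl// oe (negbTE ij) mulr0.
Qed.

(** Gram-Schmidt, with [Qh] in the place of linear combinations inside [Vh]: [v - y] is orthogonal
    to the family, and so is its projection [r], whose product with [v] is the defect in Parseval's
    identity; hence [r] is not zero. *)
Lemma orthonormal_extend m (e : 'I_m -> fn) (Qh : fn -> fn) v :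
  is_L2_projection O mesh Qh -> orthonormal e -> Vh O mesh v ->
  L2ip O v v != \sum_i L2ip O v (e i) ^+ 2 ->
  exists e' : 'I_m.+1 -> fn, orthonormal e'.
Proof.
move=> pQ [Ve oe] Vv vv.
have Le i : L2 O (e i) by exact: Vh_L2.
have Lv := Vh_L2 Vv.
pose y : fn := fun x => \sum_i L2ip O v (e i) * e i x.
have Ly : L2 O y by apply: L2_sum; apply: List_Forall_all => i; exact: L2Z.
have ipy w : L2 O w -> L2ip O y w = \sum_i L2ip O v (e i) * L2ip O (e i) w.
  move=> Lw; rewrite L2ip_suml//; last by apply: List_Forall_all => i; exact: L2Z.
  by apply: eq_bigr => i _; rewrite L2ipZl.
pose x : fn := fun t => v t - y t.
have Lx : L2 O x by exact: L2B.
have [Vr rP] := pQ x Lx; set r := Qh x in Vr rP.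
have Lr := Vh_L2 Vr.
have re i : L2ip O r (e i) = 0.
  rewrite rP// L2ipBl// ipy// (bigD1 i)//= oe eqxx mulr1 big1 ?addr0 ?subrr//.
  by move=> j ji; rewrite oe (negbTE ji) mulr0.
have rv : L2ip O r v != 0.
  rewrite rP// L2ipBl// ipy// subr_eq0; apply: contra vv => /eqP ->.
  by apply/eqP/eq_bigr => i _; rewrite (L2ipC _ (e i)) expr2.
have rr : 0 < L2ip O r r.
  rewrite lt_neqAle L2ip_ge0 andbT eq_sym; apply: contra rv => /eqP r0.
  rewrite -sqrf_eq0 eq_le sqr_ge0 andbT.
  by rewrite (le_trans (CauchySchwarz_L2ip Lr Lv))// r0 mul0r.
pose s := (Num.sqrt (L2ip O r r))^-1.
have Lsx : L2 O (fun t => s * x t) by exact: L2Z.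
(* The normalized vector is the projection of [s] times [x], so that it lies in [Vh]; against
   elements of [Vh] it acts as [s] times [r]. *)
have [Vp pP] := pQ _ Lsx; set p := Qh _ in Vp pP.
have ipp w : Vh O mesh w -> L2ip O p w = s * L2ip O r w.
  by move=> Vw; rewrite pP// L2ipZl ?rP//; exact: Vh_L2.
have pp : L2ip O p p = 1.
  rewrite ipp// L2ipC ipp// mulrA -expr2 /s exprVn sqr_sqrtr ?L2ip_ge0// mulVf//.
  by rewrite gt_eqF.
exists (fun i => oapp e p (unlift ord0 i)); split => [i|i j].
  by case: (unliftP ord0 i) => [k _|_] /=.
case: (unliftP ord0 i) => [k ->|->]; case: (unliftP ord0 j) => [l ->|->] /=.
- by rewrite oe (inj_eq lift_inj).
- by rewrite L2ipC ipp// re mulr0.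
- by rewrite ipp// re mulr0.
- by rewrite pp.
Qed.

(** The family is an orthonormal one of maximal size, which exists by the dimension bound; a failure
    of Parseval's identity would allow it to be enlarged. *)
Lemma orthonormal_basis (Qh : fn -> fn) :
  O `<=` [set x | exists2 K, K \in mesh & simplex K x] ->
  is_L2_projection O mesh Qh ->
  exists m (e : 'I_m -> fn), orthonormal e /\
    forall v, Vh O mesh v -> L2ip O v v = \sum_i L2ip O v (e i) ^+ 2.
Proof.
move=> Omesh pQ.
pose Q m := `[< exists e : 'I_m -> fn, orthonormal e >].
have exQ : exists m, Q m.
  exists 0%N; apply/asboolP; have e : 'I_0 -> fn by case.
  by exists e; split; case.
have ubQ m : Q m -> (m <= size mesh * n.+1)%N.
  by move=> /asboolP[e oe]; exact: orthonormal_bound oe.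
case: (ex_maxnP exQ ubQ) => m /asboolP[e oe] maxm.
exists m, e; split => // v Vv; apply/eqP; apply: contraT => vv.
have [e' oe'] := orthonormal_extend pQ oe Vv vv.
by have := maxm m.+1 (asboolT (ex_intro _ e' oe')); rewrite ltnn.
Qed.

End orthonormal_basis.

(** * Moments of the normal distribution *)

Section gaussian_moments.
Context {R : realType}.
Notation mu := (@lebesgue_measure R).
Import gauss_integral_proof.

Let sg (x : R) : R := x ^+ 2 * gauss_fun x.

Let sg_ge0 x : 0 <= sg x.
Proof. by rewrite mulr_ge0// ?sqr_ge0// gauss_fun_ge0. Qed.

Let continuous_sg : continuous sg.
Proof.
move=> x; apply: cvgM; last exact: continuous_gauss_fun.
exact: exprn_continuous.
Qed.

Let cvg_Mgauss : x * gauss_fun x @[x --> +oo] --> (0 : R).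
Proof.
apply: (@squeeze_cvgr _ _ _ _ (cst 0) (fun x : R => x^-1)).
- near=> x; have x0 : 0 < x by near: x; exact: nbhs_pinfty_gt.
  (* e^(-x^2) <= x^-2, because x^2 <= 1 + x^2 <= e^(x^2). *)
  rewrite /= mulr_ge0 ?gauss_fun_ge0 ?(ltW x0)//= /gauss_fun expRN.
  rewrite ler_pdivrMr ?expR_gt0// ler_pdivlMl//.
  by rewrite -expr2 (le_trans _ (expR_ge1Dx _))// lerDr.
- exact: cvg_cst.
- by apply/(gtr0_cvgV0 (f := id)) => //; exact: nbhs_pinfty_gt.
Unshelve. all: end_near. Qed.

Let cvg_integral0_gauss : @integral0_gauss R x @[x --> +oo] --> Num.sqrt pi / 2.
Proof.
have -> : Num.sqrt pi / 2 = Num.sqrt (pi / 4) :> R.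
  rewrite sqrtrM ?pi_ge0// sqrtrV//; congr (_ / _).
  by rewrite (_ : 4 = 2 ^+ 2) ?sqrtr_sqr ?ger0_norm//; ring.
rewrite (_ : integral0_gauss = fun x => Num.sqrt (@integral0_gauss R x ^+ 2)).
  apply: continuous_cvg; [exact: sqrt_continuous|exact: cvg_integral0_gauss_sqr].
by apply/funext => x; rewrite sqrtr_sqr ger0_norm// integral0_gauss_ge0.
Qed.

Let derive_integral0_gauss (x : R) : 0 < x ->
  is_derive x 1 (@integral0_gauss R) (gauss_fun x).
Proof.
move=> x0.
have [] := @continuous_FTC1_closed R gauss_fun 0 x (x + 1).
- by rewrite ltrDl.
- apply: continuous_compact_integrable => //; first exact: segment_compact.
  by apply: continuous_subspaceT; exact: continuous_gauss_fun.
- by [].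
- exact: continuous_gauss_fun.
- move=> h1 h2; apply: DeriveDef; [exact: h1|rewrite -derive1E; exact: h2].
Qed.

Let derive_gauss (x : R) : is_derive x 1 (@gauss_fun R) (- (2 * x) * gauss_fun x).
Proof.
rewrite /gauss_fun; apply: is_derive_eq; rewrite /GRing.scale/=; ring.
Qed.

Let integral0y_sg : (\int[mu]_(x in `[0%R, +oo[) (sg x)%:E)%E = (Num.sqrt pi / 4)%:E.
Proof.
(* Integration by parts: the derivative of x e^(-x^2) is e^(-x^2) - 2 x^2 e^(-x^2), so [F] is a
   primitive of [sg]. *)
pose F (x : R) := (integral0_gauss x - x * gauss_fun x) / 2.
have dF (x : R) : 0 < x -> is_derive x 1 F (sg x).
  move=> x0; have := derive_integral0_gauss x0; have := derive_gauss x.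
  by move=> d1 d2; apply: is_derive_eq; rewrite /sg /GRing.scale/=; field.
have F0 : F 0 = 0.
  by rewrite /F /integral0_gauss set_itv1 Rintegral_set1 mul0r subrr mul0r.
have := @ge0_continuous_FTC2y R sg F 0 (Num.sqrt pi / 4).
rewrite F0 sube0; apply.
- by move=> x _; exact: sg_ge0.
- by apply: continuous_subspaceT; exact: continuous_sg.
- rewrite (_ : Num.sqrt pi / 4 = (Num.sqrt pi / 2 - 0) / 2); last by field.
  by apply: cvgM; [apply: cvgB|exact: cvg_cst].
- by move=> x x0; have := dF x x0; case.
- rewrite [X in _ --> X](_ : _ = (0 - 0 * gauss_fun 0) / 2 :> R); last first.
    by rewrite mul0r subrr mul0r.
  apply: cvgM; last exact: cvg_cst.
  apply: cvgB; apply: cvg_at_right_filter; last first.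
    by apply: cvgM; [exact: cvg_id|exact: continuous_gauss_fun].
  apply: (@parameterized_integral_cvg_left R 0 1 gauss_fun ltr01).
  apply: continuous_compact_integrable => //; first exact: segment_compact.
  by apply: continuous_subspaceT; exact: continuous_gauss_fun.
- move=> x; rewrite in_itv/= andbT => x0; rewrite derive1E.
  by have := dF x x0; case.
Qed.

Lemma integral_sqr_gauss :
  (\int[mu]_x (x ^+ 2 * gauss_fun x)%:E)%E = (Num.sqrt pi / 2)%:E.
Proof.
rewrite (@ge0_symfun_integralT _ sg)//.
- rewrite (_ : [set x | _] = `[0, +oo[%classic); last first.
    by apply/seteqP; split => x/=; rewrite in_itv/= andbT.
  by rewrite integral0y_sg -EFinM; congr EFin; field.
- by move=> x/=; rewrite /sg /gauss_fun sqrrN.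
Qed.

(** The change of variables is phrased with a Radon-Nikodym derivative; this derivative and the
    density have equal integrals over all measurable sets, hence agree almost everywhere. *)
Lemma integral_density (f : R -> \bar R) (s : R) : measurable_fun setT f ->
  (forall x, 0 <= f x)%E ->
  (\int[normal_prob 0 s]_x f x = \int[mu]_x (f x * (normal_pdf 0 s x)%:E))%E.
Proof.
move=> mf f0.
have nm := normal_prob_dominates (0 : R) s.
pose rn := Radon_Nikodym_SigmaFinite.f (normal_prob 0 s) mu.
have rnE : ae_eq mu setT rn (fun x => (normal_pdf 0 s x)%:E).
  apply: integral_ae_eq => //.
  - exact: Radon_Nikodym_SigmaFinite.f_integrable.
  - by apply/measurable_EFinP; exact: measurable_normal_pdf.
  - by move=> E _ mE; rewrite -Radon_Nikodym_SigmaFinite.f_integral.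
have := Radon_Nikodym_SigmaFinite.change_of_variables nm f0 measurableT mf.
move=> <-; apply: ae_eq_integral => //.
- apply: emeasurable_funM => //.
  have := Radon_Nikodym_SigmaFinite.f_integrable nm; exact: measurable_int.
- apply: emeasurable_funM => //.
  by apply/measurable_EFinP; exact: measurable_normal_pdf.
- by apply: filterS rnE => x /= /[apply] <-.
Qed.

(** The substitution x -> x / c with c = sqrt 2 * s turns the exponential of the normal density into
    e^(-x^2), for which [integral_sqr_gauss] applies. *)
Lemma normal_variance (s : R) : 0 < s ->
  (\int[normal_prob 0 s]_x (x ^+ 2)%:E)%E = (s ^+ 2)%:E.
Proof.
move=> s0; rewrite integral_density; last 2 first.
- by apply/measurable_EFinP; exact: measurable_funX.
- by move=> x; rewrite lee_fin sqr_ge0.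
pose c := Num.sqrt 2 * s.
have c0 : 0 < c by rewrite mulr_gt0// sqrtr_gt0.
have c2 : c ^+ 2 = 2 * s ^+ 2 by rewrite exprMn sqr_sqrtr.
pose F (x : R) := c^-1 * x.
have dF (x : R) : is_derive x 1 F c^-1.
  by apply: is_derive_eq; rewrite /GRing.scale/= mulr1.
have F'E : F^`()%classic = cst c^-1.
  by apply/funext => x; rewrite derive1E; have := dF x; case.
have := @increasing_ge0_integration_by_substitutionT R F sg.
rewrite F'E integral_sqr_gauss => H.
have {}H := H _ _ _ _ _ _ _ continuous_sg sg_ge0.
have {}H : ((Num.sqrt pi / 2)%:E =
    \int[mu]_x (((sg \o F) * cst c^-1)%R x)%:E)%E.
  apply: H.
  - by move=> x y xy; rewrite ltr_pM2l// invr_gt0.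
  - by move=> x; exact: cvg_cst.
  - exact: is_cvg_cst.
  - exact: is_cvg_cst.
  - by move=> x; have := dF x; case.
  - by apply: gt0_cvgMrNy; [rewrite invr_gt0|exact: cvg_id].
  - by apply: gt0_cvgMry; [rewrite invr_gt0|exact: cvg_id].
have pi0 : 0 < Num.sqrt pi :> R by rewrite sqrtr_gt0 pi_gt0.
transitivity (((c ^+ 2 / Num.sqrt pi)%:E *
    \int[mu]_x (((sg \o F) * cst c^-1)%R x)%:E)%E).
  rewrite -ge0_integralZl//; last 3 first.
  - apply/measurable_EFinP; apply: measurable_funM => //.
    apply: measurableT_comp => //; first exact: continuous_measurable_fun.
    exact: measurable_funM.
  - by move=> x _; rewrite lee_fin mulr_ge0//= ?sg_ge0// invr_ge0 ltW.
  - by rewrite lee_fin divr_ge0// ?sqr_ge0// ltW.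
  apply: eq_integral => x _; rewrite -!EFinM; congr EFin.
  have -> : normal_pdf 0 s x = normal_peak s * expR (- (c^-1 * x) ^+ 2).
    rewrite /normal_pdf gt_eqF//; congr (_ * expR _).
    by rewrite exprMn exprVn c2 subr0 -mulr_natr; field; rewrite !gt_eqF.
  rewrite /normal_peak /sg /= /gauss_fun /F.
  rewrite (_ : Num.sqrt (s ^+ 2 * pi *+ 2) = c * Num.sqrt pi); last first.
    have -> : s ^+ 2 * pi *+ 2 = 2 * s ^+ 2 * pi by rewrite -mulr_natr; ring.
    have h : 0 <= 2 * s ^+ 2 by rewrite mulr_ge0 ?sqr_ge0.
    by rewrite (sqrtrM pi h) (sqrtrM (s ^+ 2) (ler0n R 2)) sqrtr_sqr (gtr0_norm s0).
  rewrite [X in _ = _ * X](_ : _ =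
    (c^-1 * x) ^+ 2 * expR (- (c^-1 * x) ^+ 2) * c^-1)//.
  by field; rewrite !gt_eqF.
rewrite -H -EFinM c2; congr EFin; field.
by rewrite gt_eqF.
Qed.

Lemma Lfun2_normal_id (s : R) : 0 < s ->
  (id : R -> R) \in Lfun (normal_prob 0 s) 2%:E.
Proof. by move=> s0; apply/Lfun2P; split=> //; rewrite normal_variance// ltry. Qed.

Let normal_pdfN (s x : R) : 0 < s -> normal_pdf 0 s (- x) = normal_pdf 0 s x.
Proof.
move=> s0; rewrite /normal_pdf gt_eqF//; congr (normal_peak s * _).
by rewrite /normal_fun !subr0 sqrrN.
Qed.

(** The density is even, so the positive and negative parts have the same integral; integrability
    makes it finite and the difference zero. *)
Lemma normal_mean (s : R) : 0 < s -> (\int[normal_prob 0 s]_x x = 0)%R.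
Proof.
move=> s0.
have iid : (normal_prob 0 s).-integrable setT (EFin \o (id : R -> R)).
  apply/Lfun1_integrable; apply: Lfun_subset12; last exact: Lfun2_normal_id.
  exact: fin_num_measure.
pose f := fun x : R => ((EFin \o (id : R -> R))^\+ x)%E.
have mf : measurable_fun setT f.
  by apply: measurable_funepos; exact: measurable_int iid.
have fN (x : R) : ((EFin \o (id : R -> R))^\- x)%E = f (- x).
  by rewrite /f funeposE funenegE /= EFinN.
have : (\int[normal_prob 0 s]_x f x = \int[normal_prob 0 s]_x f (- x)%R)%E.
  have f0 x : (0 <= f x)%E by exact: funepos_ge0.
  rewrite !integral_density//; last exact: measurableT_comp.
  pose h x := (f (- x)%R * (normal_pdf 0 s x)%:E)%E.
  have mh : measurable_fun setT h.
    apply: emeasurable_funM; first exact: measurableT_comp.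
    by apply/measurable_EFinP; exact: measurable_normal_pdf.
  have h0 x : (0 <= h x)%E by rewrite mule_ge0// lee_fin normal_pdf_ge0.
  transitivity (\int[mu]_(x in (-%R : _ -> measurableTypeR R) @^-1` setT)
      (h \o (-%R : _ -> measurableTypeR R)) x)%E.
    rewrite preimage_setT; apply: eq_integral => x _; rewrite /h /= opprK.
    by rewrite normal_pdfN.
  rewrite -ge0_integral_pushforward//=.
  by apply: eq_measure_integral => A mA _; exact: lebesgue_measureN.
rewrite /Rintegral integralE => ->.
rewrite [X in (_ - X)%E](_ : _ = \int[normal_prob 0 s]_x f (- x)%R)%E; last first.
  by apply: eq_integral => x _; rewrite fN.
rewrite subee//.
have := integrable_neg_fin_num measurableT iid.
by under eq_integral do rewrite fN.
Qed.

End gaussian_moments.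

(** The hypothesis on rectangles identifies the joint law of [X] and [Y] with the product of the law
    of [X] and [m], by uniqueness of product measures; Fubini's theorem then factors the
    expectation. The function [psi] is used for y and for y^2. *)
Lemma Rintegral_indep d (T : measurableType d) (R : realType)
    (P : probability T R) (X Y : T -> R) (m : probability (measurableTypeR R) R) (psi : R -> R) :
  measurable_fun setT X -> measurable_fun setT Y -> measurable_fun setT psi ->
  (forall A B : set R, measurable A -> measurable B ->
     P (X @^-1` A `&` Y @^-1` B) = (P (X @^-1` A) * m B)%E) ->
  P.-integrable setT (EFin \o X) -> m.-integrable setT (EFin \o psi) ->
  P.-integrable setT (fun w => (X w * psi (Y w))%:E) ->
  (\int[P]_w (X w * psi (Y w)) = (\int[P]_w X w) * (\int[m]_y psi y))%R.
Proof.
move=> mX mY mpsi indep iX ipsi iXY.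
have X_mfun : (X : T -> measurableTypeR R) \in mfun by rewrite inE.
pose muX := distribution P (mfun_Sub X_mfun).
pose XY (w : T) : measurableTypeR R * measurableTypeR R := (X w, Y w).
have mXY : measurable_fun setT XY by exact: measurable_fun_pair.
have XY_mfun : XY \in mfun by rewrite inE.
pose law := distribution P (mfun_Sub XY_mfun).
have lawE D : measurable D -> (muX \x m)%E D = law D.
  apply: product_measure_unique => A B mA mB.
  by rewrite -(indep A B mA mB).
pose f (p : measurableTypeR R * measurableTypeR R) : \bar R := (p.1 * psi p.2)%:E.
have mf : measurable_fun setT f.
  apply/measurable_EFinP/measurable_funM; first exact: measurable_fst.
  by apply: measurableT_comp => //; exact: measurable_snd.
have ilaw : (\int[law]_p f p = \int[P]_w (X w * psi (Y w))%:E)%E.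
  by rewrite integral_distribution.
have if_ : (muX \x m)%E.-integrable setT f.
  apply/integrableP; split => //.
  rewrite (@eq_measure_integral _ _ _ _ law); last by move=> A mA _; exact: lawE.
  rewrite ge0_integral_distribution//; last exact: measurableT_comp.
  by have /integrableP[] := iXY.
have E1 : (\int[P]_w X w = \int[muX]_x x)%R.
  by rewrite /Rintegral integral_distribution.
rewrite E1 -RintegralZr//; last first.
  apply/integrableP; split; first by apply/measurable_EFinP.
  rewrite ge0_integral_distribution//; last first.
    by apply: measurableT_comp => //; exact/measurable_EFinP.
  by have /integrableP[] := iX.
congr fine.
rewrite -ilaw; have -> : (\int[law]_p f p = \int[(muX \x m)%E]_p f p)%E.
  by apply: eq_measure_integral => A mA _; apply/esym/lawE.
rewrite -integral12_prod_meas1//; apply: eq_integral => x _.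
rewrite /fubini_F /f /=.
under eq_integral do rewrite EFinM.
rewrite integralZl// EFinM /Rintegral fineK//.
exact: integrable_fin_num.
Qed.

(** * Brownian increments *)

Section brownian.
Context (R : realType) (d : measure_display) (Omega : measurableType d)
  (P : probability Omega R) (W : R -> Omega -> R).
Hypothesis BW : brownian_motion P W.

Local Notation F := (natural_filtration W).
Local Notation dW s t := (fun w => W t w - W s w).

Let F_gen (t : R) : set (set Omega) := [set A | exists (s : R) (B : set R),
  [/\ 0 <= s <= t, measurable B & A = W s @^-1` B]].

(** [g_sigma_algebraType] equips Omega with F_t as its sigma-algebra, so that adapted variables
    inherit the closure properties of measurable functions. *)
Definition adapted (t : R) (X : Omega -> R) : Prop :=
  @measurable_fun _ _ (g_sigma_algebraType (F_gen t)) R setT X.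

Lemma measurable_W (t : R) : 0 <= t -> measurable_fun setT (W t).
Proof. by case: BW => + _ _ _ _; exact. Qed.

Lemma natural_filtration_measurable (t : R) (A : set Omega) :
  F t A -> measurable A.
Proof.
move: A; apply: smallest_sub; first exact: sigma_algebra_measurable.
move=> _ [s [B [/andP[s0 st] mB ->]]].
by rewrite -[X in measurable X]setTI; exact: measurable_W.
Qed.

Lemma natural_filtrationS (s t : R) : s <= t -> F s `<=` F t.
Proof.
move=> st; apply: smallest_sub; first exact: smallest_sigma_algebra.
move=> _ [u [B [/andP[u0 us] mB ->]]]; apply: sub_sigma_algebra.
by exists u, B; split => //; rewrite u0 (le_trans us).
Qed.

Lemma natural_filtrationI (t : R) (A B : set Omega) :
  F t A -> F t B -> F t (A `&` B).
Proof.
by move=> FA FB; exact: (@measurableI _ (g_sigma_algebraType (F_gen t))).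
Qed.

Lemma adaptedP (t : R) (X : Omega -> R) :
  adapted t X <-> forall B, measurable B -> F t (X @^-1` B).
Proof.
split => [aX B mB|aX _ B mB]; last by rewrite setTI; exact: aX.
by have := aX measurableT B mB; rewrite setTI.
Qed.

Lemma adaptedS (s t : R) (X : Omega -> R) : s <= t -> adapted s X -> adapted t X.
Proof.
move=> st /adaptedP aX; apply/adaptedP => B mB.
exact: natural_filtrationS st _ (aX B mB).
Qed.

Lemma adapted_measurable (t : R) (X : Omega -> R) :
  adapted t X -> measurable_fun setT X.
Proof.
move=> /adaptedP aX _ B mB; rewrite setTI.
exact: natural_filtration_measurable (aX B mB).
Qed.

Lemma adaptedM (t : R) (X Y : Omega -> R) :
  adapted t X -> adapted t Y -> adapted t (fun w => X w * Y w).
Proof. exact: measurable_funM. Qed.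

Lemma adapted_indic (t : R) (A : set Omega) : F t A -> adapted t (\1_A).
Proof. by move=> FA; exact: measurable_indic. Qed.

Lemma adapted_increment (s t u : R) : 0 <= s <= t -> t <= u -> adapted u (dW s t).
Proof.
move=> /andP[s0 st] tu; apply: measurable_funB; apply/adaptedP => B mB;
  apply: sub_sigma_algebra.
- by exists t, B; split => //; rewrite (le_trans s0).
- by exists s, B; split => //; rewrite s0 (le_trans st).
Qed.

Lemma increment_law (s t : R) (B : set R) : 0 <= s < t -> measurable B ->
  P (dW s t @^-1` B) = normal_prob 0 (Num.sqrt (t - s)) B.
Proof. by case: BW => _ _ _ + _; exact. Qed.

Lemma increment_indep (s t : R) (X : Omega -> R) (A B : set R) : 0 <= s < t ->
  adapted s X -> measurable A -> measurable B ->
  P (X @^-1` A `&` dW s t @^-1` B) =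
  (P (X @^-1` A) * normal_prob 0 (Num.sqrt (t - s)) B)%E.
Proof.
move=> st /adaptedP aX mA mB; rewrite -increment_law//.
by case: BW => _ _ _ _; apply => //; exact: aX.
Qed.

Lemma measurable_increment (s t : R) : 0 <= s -> 0 <= t ->
  measurable_fun setT (dW s t).
Proof. by move=> s0 t0; apply: measurable_funB; exact: measurable_W. Qed.

Lemma increment_second_moment (s t : R) : 0 <= s <= t ->
  (\int[P]_w ((dW s t w) ^+ 2)%:E)%E = (t - s)%:E.
Proof.
move=> /andP[s0]; rewrite le_eqVlt => /predU1P[<-|st].
  rewrite subrr integral0_eq// => w _; by rewrite subrr expr0n.
have t0 : 0 <= t by rewrite ltW// (le_lt_trans s0).
have mD := measurable_increment s0 t0.
have D_mfun : (dW s t : Omega -> measurableTypeR R) \in mfun by rewrite inE.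
have := @ge0_integral_distribution _ _ _ _ _ P (mfun_Sub D_mfun)
  (fun x : R => (x ^+ 2)%:E).
rewrite /= => <-; last 2 first.
- by apply/measurable_EFinP; exact: measurable_funX.
- by move=> x; rewrite lee_fin sqr_ge0.
transitivity (\int[normal_prob 0 (Num.sqrt (t - s))]_x (x ^+ 2)%:E)%E.
  apply: eq_measure_integral => A mA _.
  by apply: (increment_law _ mA); rewrite s0.
by rewrite normal_variance ?sqr_sqrtr ?subr_ge0 ?(ltW st)// sqrtr_gt0 subr_gt0.
Qed.

Lemma Lfun2_increment (s t : R) : 0 <= s <= t -> dW s t \in Lfun P 2%:E.
Proof.
move=> /[dup] st /andP[s0 le_st]; apply/Lfun2P; split.
  by apply: measurable_increment => //; exact: le_trans le_st.
by rewrite increment_second_moment// ltry.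
Qed.

(** Independence and zero mean of the increment. The case s = t is treated apart, since law and
    independence are given for s < t only. *)
Lemma mip_adapted_increment (s t : R) (X : Omega -> R) : 0 <= s <= t ->
  X \in Lfun P 2%:E -> adapted s X -> mip P X (dW s t) = 0.
Proof.
move=> /[dup] hst /andP[s0]; rewrite le_eqVlt => /predU1P[<-|st] lX aX.
  rewrite /mip /Rintegral integral0_eq// => w _; by rewrite subrr mulr0.
have sst : 0 < Num.sqrt (t - s) by rewrite sqrtr_gt0 subr_gt0.
have lD := Lfun2_increment hst.
have := @Rintegral_indep _ _ _ P X (dW s t) (normal_prob 0 (Num.sqrt (t - s))) id.
rewrite normal_mean// mulr0; apply => //.
- exact: Lfun2_measurable lX.
- exact: Lfun2_measurable lD.
- by move=> A B mA mB; apply: increment_indep => //; rewrite s0.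
- apply/Lfun1_integrable; apply: Lfun_subset12 lX; exact: fin_num_measure.
- apply/Lfun1_integrable; apply: Lfun_subset12; last exact: Lfun2_normal_id.
  exact: fin_num_measure.
- exact: (Lfun2M lX lD).
Qed.

Lemma mip_indic_increment (s t : R) (B : set Omega) : 0 <= s <= t -> F s B ->
  mip P (fun w => \1_B w * dW s t w) (dW s t) = fine (P B) * (t - s).
Proof.
move=> /[dup] hst /andP[s0]; rewrite le_eqVlt => /predU1P[<-|st] FB.
  by rewrite subrr mulr0 /mip /Rintegral integral0_eq// => w _; rewrite subrr mulr0.
have mB := natural_filtration_measurable FB.
have sst : 0 < Num.sqrt (t - s) by rewrite sqrtr_gt0 subr_gt0.
have lD := Lfun2_increment hst.
have := @Rintegral_indep _ _ _ P \1_B (dW s t) (normal_prob 0 (Num.sqrt (t - s)))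
  (fun x => x ^+ 2).
rewrite (_ : (\int[P]_w \1_B w)%R = fine (P B)); last first.
  by rewrite /Rintegral integral_indic// setIT.
rewrite (_ : (\int[normal_prob 0 (Num.sqrt (t - s))]_y (y ^+ 2))%R = t - s); last first.
  by rewrite /Rintegral normal_variance//= sqr_sqrtr// subr_ge0 ltW.
move=> <-.
- by rewrite /mip; congr fine; apply: eq_integral => w _; rewrite expr2 mulrA.
- exact: measurable_indic.
- exact: Lfun2_measurable lD.
- exact: measurable_funX.
- move=> A B' mA mB'; apply: increment_indep => //; first by rewrite s0.
  exact: adapted_indic.
- exact: integrable_indic.
- exact: Lfun2_integrable_sqr (Lfun2_normal_id sst).
- have := Lfun2M (Lfun2_mul_indic mB lD) lD.
  by apply: eq_integrable => // w _; congr EFin; rewrite /= expr2; ring.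
Qed.

End brownian.

Lemma eq_mip d (T : measurableType d) (R : realType)
    (mu : {measure set T -> \bar R}) (f g f' g' : T -> R) :
  (forall x, f x * g x = f' x * g' x) -> mip mu f g = mip mu f' g'.
Proof. by move=> e; congr fine; apply: eq_integral => x _; rewrite e. Qed.

Lemma eq_big_Forall (V : nmodType) I (Q : I -> Prop) (s : seq I) (F G : I -> V) :
  List.Forall Q s -> (forall i, Q i -> F i = G i) ->
  \sum_(i <- s) F i = \sum_(i <- s) G i.
Proof.
move=> + FG; elim: s => [_|i s IH h]; first by rewrite !big_nil.
by inversion h; subst; rewrite !big_cons FG// IH.
Qed.

(** * The Ito isometry for coordinates *)

Section ito_isometry.
Context (R : realType) (d : measure_display) (Omega : measurableType d)
  (P : probability Omega R) (W : R -> Omega -> R).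
Hypothesis BW : brownian_motion P W.

Local Notation F := (natural_filtration W).
Local Notation dW s t := (fun w => W t w - W s w).
Local Notation leb := (@lebesgue_measure R).
Local Notation mu := (leb \x P)%E.

(** By symmetry r <= r' may be assumed. The longer increment is the shorter one plus an increment
    after r, which is orthogonal to square-integrable F_r-measurable variables. *)
Lemma mip_increment_same_start (u r r' : R) (B : set Omega) :
  0 <= u <= r -> u <= r' -> F u B ->
  mip P (fun w => \1_B w * dW u r w) (dW u r') =
  fine (P B) * (Num.min r r' - u).
Proof.
wlog rr' : r r' / r <= r'.
  move=> H ur ur' FB; have [rr'|r'r] := leP r r'; first by rewrite H// min_l.
  rewrite (@eq_mip _ _ _ P _ _ (fun w => \1_B w * dW u r' w) (dW u r)).
    by have /andP[u0 ur0] := ur; rewrite H ?u0 ?(ltW r'r)// min_l// ltW.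
  by move=> w; ring.
move=> /[dup] hur /andP[u0 ur] ur' FB; rewrite min_l//.
have mB := natural_filtration_measurable BW FB.
have r0 : 0 <= r by exact: le_trans ur.
have l1 := Lfun2_increment BW hur.
have l2 : dW r r' \in Lfun P 2%:E by apply: Lfun2_increment; rewrite ?r0.
have lB : (fun w => \1_B w * dW u r w) \in Lfun P 2%:E.
  by under eq_fun do rewrite mulrC; exact: Lfun2_mul_indic.
rewrite (@eq_mip _ _ _ P _ _ (fun w => \1_B w * dW u r w)
  (fun w => dW u r w + dW r r' w)); last by move=> w; ring.
rewrite mipDr// (mip_indic_increment BW)// (mip_adapted_increment BW) ?addr0//.
  by rewrite r0.
apply: adaptedM; last exact: adapted_increment.
by apply: adaptedS ur _; exact: adapted_indic.
Qed.

(** Take s <= s'. If r <= s', the first factor is known at time s' and the second increment is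
    orthogonal to it. Otherwise the first increment is cut at s': the part before is orthogonal for
    the same reason, and the rest starts at the same time as the second increment. *)
Lemma mip_increments (s r s' r' : R) (A A' : set Omega) :
  0 <= s <= r -> 0 <= s' <= r' -> F s A -> F s' A' ->
  mip P (fun w => \1_A w * dW s r w) (fun w => \1_A' w * dW s' r' w) =
  fine (P (A `&` A')) * Num.max 0 (Num.min r r' - Num.max s s').
Proof.
wlog ss' : s r s' r' A A' / s <= s'.
  move=> H h h' FA FA'; have [ss'|s's] := leP s s'.
    by rewrite H// (max_r ss').
  by rewrite mipC H ?(ltW s's)// setIC minC (max_r (ltW s's)).
move=> /[dup] h /andP[s0 sr] /[dup] h' /andP[s'0 s'r'] FA FA'.
rewrite (max_r ss').
have mA := natural_filtration_measurable BW FA.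
have mA' := natural_filtration_measurable BW FA'.
have aA : adapted W s' \1_A.
  by apply: adaptedS ss' _; exact: adapted_indic.
have aA' : adapted W s' \1_A' by exact: adapted_indic.
have lind B (f : Omega -> R) : measurable B -> f \in Lfun P 2%:E ->
    (fun w => \1_B w * f w) \in Lfun P 2%:E.
  by move=> mB lf; under eq_fun do rewrite mulrC; exact: Lfun2_mul_indic.
have ld' := Lfun2_increment BW h'.
have [rs'|s'r] := leP r s'.
  rewrite max_l ?mulr0; last first.
    by rewrite subr_le0 (le_trans _ rs')// ge_min lexx.
  rewrite (@eq_mip _ _ _ P _ _ (fun w => \1_A' w * (\1_A w * dW s r w))
    (dW s' r')); last by move=> w; ring.
  apply: (mip_adapted_increment BW) => //.
    by apply: (lind _ _ mA'); apply: lind => //; exact: Lfun2_increment.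
  apply: adaptedM => //; apply: adaptedM => //.
  exact: adapted_increment.
have hss' : 0 <= s <= s' by rewrite s0.
rewrite (@eq_mip _ _ _ P _ _
  (fun w => \1_A' w * (\1_A w * dW s s' w) + \1_(A `&` A') w * dW s' r w)
  (dW s' r')); last by move=> w; rewrite indicI/=; ring.
rewrite mipDl//; last 2 first.
- by apply: (lind _ _ mA'); apply: lind => //; exact: Lfun2_increment.
- apply: lind; first exact: measurableI.
  by apply: Lfun2_increment; rewrite // s'0 ltW.
rewrite (mip_adapted_increment BW) ?add0r//; last 2 first.
- by apply: (lind _ _ mA'); apply: lind => //; exact: Lfun2_increment.
- apply: adaptedM => //; apply: adaptedM => //.
  exact: adapted_increment.
rewrite mip_increment_same_start ?s'0 ?(ltW s'r)//; last first.
  by apply: natural_filtrationI => //; exact: natural_filtrationS FA.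
by rewrite max_r// subr_ge0 le_min (ltW s'r).
Qed.

(** The counterpart of [mip_increments] on the product of Lebesgue measure and [P]; equality of the
    two values, extended bilinearly, is the isometry for elementary processes. *)
Lemma mip_product_indic (a b s r s' r' : R) (A A' : set Omega) :
  a <= s <= r -> r <= b -> a <= s' <= r' -> r' <= b -> measurable A -> measurable A' ->
  mip mu ((fun p : R * Omega => \1_A p.2 * \1_`]s, r]%classic p.1 : R) \_ (`]a, b[ `*` setT))
         ((fun p : R * Omega => \1_A' p.2 * \1_`]s', r']%classic p.1 : R) \_ (`]a, b[ `*` setT)) =
  fine (P (A `&` A')) * Num.max 0 (Num.min r r' - Num.max s s').
Proof.
move=> /andP[as_ sr] rb /andP[as' s'r'] r'b mA mA'.
pose M := Num.max s s'; pose m := Num.min r r'.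
pose S : set R := `]s, r] `&` `]s', r'] `&` `]a, b[.
have mS : measurable S by do 2 apply: measurableI => //.
(* [S] contains ]M, m[ and is contained in ]M, m], so the open strip and the half-open intervals of
   elementary processes give the same length. *)
have lS : leb S = (Num.max 0 (m - M))%:E.
  apply/eqP; rewrite eq_le; apply/andP; split.
  - apply: (@le_trans _ _ (leb (`]M, m]%classic : set R))).
      apply: le_measure; rewrite ?inE//.
      move=> x [[]]; rewrite /= !in_itv/= => /andP[? ?] /andP[? ?] _.
      by rewrite gt_max le_min; do 2 (apply/andP; split).
    rewrite lebesgue_measure_itv/= lte_fin; case: ltP => Mm.
      by rewrite -EFinB lee_fin le_max lexx orbT.
    by rewrite lee_fin le_max lexx.
  - apply: (@le_trans _ _ (leb (`]M, m[%classic : set R))); last first.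
      apply: le_measure; rewrite ?inE//.
      move=> x; rewrite /= in_itv/= gt_max lt_min => /andP[/andP[? ?] /andP[? ?]].
      split; first by split; rewrite /= in_itv/=; apply/andP; split => //; exact: ltW.
      rewrite /= in_itv/= (le_lt_trans as_)//=.
      by apply: lt_le_trans rb.
    rewrite lebesgue_measure_itv/= lte_fin; case: ltP => Mm.
      by rewrite -EFinB lee_fin ge_max lexx subr_ge0 (ltW Mm).
    by rewrite lee_fin ge_max lexx subr_le0.
rewrite /mip /Rintegral.
rewrite (_ : (\int[mu]_x _)%E = mu (S `*` (A `&` A'))); last first.
  transitivity (\int[mu]_x (\1_(S `*` (A `&` A')) x)%:E)%E; last first.
    rewrite integral_indic ?setIT//.
    by apply: measurableX => //; exact: measurableI.
  apply: eq_integral => -[t w] _; rewrite !patchE /=; congr EFin.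
  rewrite !indicE /S !in_setX/= !in_setI !in_setT andbT.
  case: (t \in `]a, b[%classic) => /=; rewrite ?mul0r ?andbF//.
  case: (w \in A); case: (w \in A');
    case: (t \in `]s, r]%classic); case: (t \in `]s', r']%classic) => /=;
    by rewrite ?(mulr0, mul0r, mulr1).
have mAA' := measurableI _ _ mA mA'.
rewrite [X in fine X](_ : _ = ((Num.max 0 (m - M))%:E * P (A `&` A'))%E).
  by rewrite fineM ?fin_num_measure// mulrC.
by rewrite -lS; exact: product_measure1E.
Qed.

Lemma Lfun2_product_indic (a b s r : R) (A : set Omega) : measurable A ->
  ((fun p : R * Omega => \1_A p.2 * \1_`]s, r]%classic p.1 : R)
    \_ (`]a, b[ `*` setT)) \in Lfun mu 2%:E.
Proof.
move=> mA.
have mS : measurable (`]a, b[%classic `&` `]s, r]%classic : set R).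
  exact: measurableI.
rewrite (_ : _ \_ _ = (\1_((`]a, b[ `&` `]s, r]) `*` A) : R * Omega -> R)).
  apply: Lfun2_indic; first exact: measurableX.
  rewrite [ltLHS](_ : _ = (leb (`]a, b[%classic `&` `]s, r]%classic : set R) * P A)%E);
    last exact: product_measure1E.
  rewrite lte_mul_pinfty// ?ge0_fin_numE//.
    apply: le_lt_trans (_ : leb (`]s, r]%classic : set R) < +oo)%E.
      by apply: le_measure; rewrite ?inE//; exact: subIsetr.
    by rewrite lebesgue_measure_itv/=; case: ifP => _; rewrite ltry.
  by rewrite ltey_eq fin_num_measure.
apply/funext => -[t w]; rewrite !patchE !indicE !in_setX/= in_setI in_setT andbT.
case: (t \in `]a, b[%classic) => //=; case: (w \in A);
  by case: (t \in `]s, r]%classic) => /=; rewrite ?(mulr0, mul0r, mulr1).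
Qed.

Section scalar_terms.
Context (n : nat) (O : set 'rV[R]_n) (f : 'rV[R]_n -> R) (a b : R).
Hypotheses (a0 : 0 <= a) (Lf : L2 O f).

Local Notation D := (`]a, b[ `*` [set: Omega]).

Let coef (e : ito_term R Omega n) : R := L2ip O (term_value e) f.

Let iterm (e : ito_term R Omega n) (w : Omega) : R :=
  \1_(term_event e) w * dW (term_start e) (term_end e) w.

Let zterm (e : ito_term R Omega n) : R * Omega -> R :=
  (fun p : R * Omega => \1_(term_event e) p.2 *
    \1_`]term_start e, term_end e]%classic p.1 : R) \_ D.

Let on := ito_term_on W O a b.

Let on_measurable e : on e -> measurable (term_event e).
Proof. by case=> _ _ _ FA _; exact: (natural_filtration_measurable BW FA). Qed.

Let Lfun2_iterm e : on e -> iterm e \in Lfun P 2%:E.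
Proof.
move=> /[dup] /on_measurable mA [as_ sr _ _ _].
rewrite /iterm; under eq_fun do rewrite mulrC.
apply: Lfun2_mul_indic => //; apply: Lfun2_increment => //.
by rewrite (le_trans a0).
Qed.

Let Lfun2_zterm e : on e -> zterm e \in Lfun mu 2%:E.
Proof. by move=> /on_measurable; exact: Lfun2_product_indic. Qed.

Let Forall_coef (d' : measure_display) (T' : measurableType d')
    (m : {measure set T' -> \bar R}) (h : ito_term R Omega n -> T' -> R) l :
  (forall e, on e -> h e \in Lfun m 2%:E) -> List.Forall on l ->
  List.Forall (fun e => (fun x => coef e * h e x) \in Lfun m 2%:E) l.
Proof.
by move=> hh; apply: List.Forall_impl => e /hh; exact: Lfun2Z.
Qed.

Lemma L2ip_elementary_integral l w : List.Forall on l ->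
  L2ip O (elementary_integral W l w) f = \sum_(e <- l) coef e * iterm e w.
Proof.
move=> hl; rewrite L2ip_suml//; last first.
  by apply: List.Forall_impl hl => e [_ _ _ _ Le]; exact: L2Z.
apply: (eq_big_Forall hl) => e [_ _ _ _ Le].
by rewrite L2ipZl// mulrC.
Qed.

Lemma L2ip_elementary_process l : List.Forall on l ->
  (fun p : R * Omega => L2ip O (elementary_process l p.1 p.2) f) \_ D =
  (fun p => \sum_(e <- l) coef e * zterm e p).
Proof.
move=> hl; apply/funext => p; rewrite patchE; case: ifPn => pD; last first.
  by rewrite big1// => e _; rewrite /zterm patchE (negbTE pD) mulr0.
rewrite L2ip_suml//; last first.
  by apply: List.Forall_impl hl => e [_ _ _ _ Le]; exact: L2Z.
apply: (eq_big_Forall hl) => e [_ _ _ _ Le].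
by rewrite L2ipZl// /zterm patchE pD mulrC.
Qed.

Lemma Lfun2_elementary_integral l : List.Forall on l ->
  (fun w => L2ip O (elementary_integral W l w) f) \in Lfun P 2%:E.
Proof.
move=> hl; under eq_fun do rewrite L2ip_elementary_integral//.
by apply: Lfun2_sum; exact: Forall_coef.
Qed.

Lemma Lfun2_elementary_process l : List.Forall on l ->
  ((fun p : R * Omega => L2ip O (elementary_process l p.1 p.2) f) \_ D)
    \in Lfun mu 2%:E.
Proof.
move=> hl; rewrite L2ip_elementary_process//.
by apply: Lfun2_sum; exact: Forall_coef.
Qed.

Let mip_double_sum (d' : measure_display) (T' : measurableType d')
    (m : {measure set T' -> \bar R}) (h : ito_term R Omega n -> T' -> R) l :
  (forall e, on e -> h e \in Lfun m 2%:E) -> List.Forall on l ->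
  mip m (fun x => \sum_(e <- l) coef e * h e x)
        (fun x => \sum_(e <- l) coef e * h e x) =
  \sum_(e <- l) \sum_(e' <- l) coef e * (coef e' * mip m (h e) (h e')).
Proof.
move=> hh hl; have hs := Forall_coef hh hl.
rewrite mip_suml//; last exact: Lfun2_sum.
apply: (eq_big_Forall hl) => e /hh he; rewrite mip_sumr//; last exact: Lfun2Z.
apply: (eq_big_Forall hl) => e' /hh he'.
by rewrite mipZl ?mipZr//; exact: Lfun2Z.
Qed.

Lemma elementary_isometry l : List.Forall on l ->
  mip P (fun w => L2ip O (elementary_integral W l w) f)
        (fun w => L2ip O (elementary_integral W l w) f) =
  mip mu ((fun p : R * Omega => L2ip O (elementary_process l p.1 p.2) f) \_ D)
         ((fun p : R * Omega => L2ip O (elementary_process l p.1 p.2) f) \_ D).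
Proof.
move=> hl; rewrite L2ip_elementary_process//.
under eq_fun do rewrite L2ip_elementary_integral//.
rewrite !mip_double_sum//.
apply: (eq_big_Forall hl) => e he; apply: (eq_big_Forall hl) => e' he'.
have mA := on_measurable he; have mA' := on_measurable he'.
case: he he' => as_ sr rb FA _ [as' sr' rb' FA' _].
congr (_ * (_ * _)).
rewrite mip_increments ?(le_trans a0)// /zterm mip_product_indic//.
- by rewrite as_.
- by rewrite as'.
Qed.

(* [X] is adapted only right after [a]; the mean-square continuity of the
   Brownian motion at [a] makes up for it. *)
Lemma mip_elementary_integral (X : Omega -> R) l : X \in Lfun P 2%:E ->
  (forall u, a < u < b -> adapted W u X) -> List.Forall on l ->
  mip P X (fun w => L2ip O (elementary_integral W l w) f) = 0.
Proof.
move=> lX aX hl; under eq_fun do rewrite L2ip_elementary_integral//.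
rewrite mip_sumr//; last exact: Forall_coef.
rewrite (eq_big_Forall (G := fun=> 0) hl) ?big1// => e he.
rewrite mipZr//; last exact: Lfun2_iterm.
suff -> : mip P X (iterm e) = 0 by rewrite mulr0.
have mA := on_measurable he.
have {he} [as_ sr rb FA _] := he.
move: sr; rewrite le_eqVlt => /predU1P[sr|sr].
  rewrite /mip /Rintegral integral0_eq// => w _.
  by rewrite /iterm sr subrr !mulr0.
have s0 : 0 <= term_start e by exact: le_trans as_.
have lA Y : Y \in Lfun P 2%:E -> (fun w => Y w * \1_(term_event e) w) \in Lfun P 2%:E.
  exact: Lfun2_mul_indic.
have rbl : term_start e < b by exact: lt_le_trans rb.
have -> : mip P X (iterm e) = mip P (fun w => X w * \1_(term_event e) w)
    (dW (term_start e) (term_end e)) by apply: eq_mip => w; rewrite /iterm mulrA.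
have key u : a < u < b -> term_start e <= u <= term_end e ->
    mip P (fun w => X w * \1_(term_event e) w) (dW u (term_end e)) = 0.
  move=> aub /andP[su ur]; apply: (mip_adapted_increment BW).
  - by rewrite (le_trans s0 su).
  - exact: lA.
  - apply: adaptedM; first exact: aX.
    by apply: adaptedS su _; exact: adapted_indic.
(* Terms that start after [a] are settled by [key] at their starting time. A term that starts
   exactly at [a] remains, where [X] is not known to be F_a-measurable. *)
move: as_; rewrite le_eqVlt => /predU1P[as_|as_]; last first.
  by apply: key; rewrite ?as_ ?rbl// lexx ltW.
pose Y := fun w => X w * \1_(term_event e) w.
rewrite -/Y in key *; set c := mip _ _ _.
have lY : Y \in Lfun P 2%:E by exact: lA.
(* [Y] is orthogonal to the increment after u, so c comes from (a, u) alone, where the increment has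
   second moment u - a. *)
have bound u : a < u < term_end e -> c ^+ 2 <= mip P Y Y * (u - a).
  move=> /andP[au ur].
  have hau : 0 <= a <= u by rewrite a0 ltW.
  have hur : 0 <= u <= term_end e by rewrite (le_trans a0) ltW.
  have l1 := Lfun2_increment BW hau; have l2 := Lfun2_increment BW hur.
  have -> : c = mip P Y (dW a u).
    rewrite /c -as_ (@eq_mip _ _ _ P _ _ Y (fun w => dW a u w + dW u (term_end e) w)).
      rewrite mipDr// key ?addr0//; first by rewrite au (lt_le_trans ur).
      by rewrite -as_ !ltW.
    by move=> w; ring.
  have -> : u - a = mip P (dW a u) (dW a u).
    by apply/EFin_inj; rewrite mip_sqrE// increment_second_moment.
  exact: CauchySchwarz_mip.
apply/eqP; rewrite -sqrf_eq0; apply: contraT => c0.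
have {}c0 : 0 < c ^+ 2 by rewrite lt_neqAle eq_sym c0 sqr_ge0.
have Y0 := mip_ge0 P Y.
(* With this [v], |Y|^2 v < c^2, which contradicts [bound] at a point within [v] of [a]; the added 1
   guards against |Y| = 0. *)
pose v := c ^+ 2 / (2 * (mip P Y Y + 1)).
have v0 : 0 < v by rewrite divr_gt0// mulr_gt0// ltr_wpDl.
pose u := a + Num.min ((term_end e - a) / 2) v.
have ra : 0 < (term_end e - a) / 2 by rewrite divr_gt0// subr_gt0 as_.
have hu : a < u < term_end e.
  rewrite /u ltrDl lt_min ra v0/= -ltrBrDl gt_min; apply/orP; left; lra.
have := bound u hu; rewrite leNgt => /negP[].
apply: (@le_lt_trans _ _ (mip P Y Y * v)).
  by apply: ler_wpM2l => //; rewrite /u addrAC subrr add0r ge_min lexx orbT.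
rewrite /v mulrA ltr_pdivrMr ?mulr_gt0 ?ltr_wpDl//.
by rewrite mulrC ltr_pM2l//; lra.
Qed.

End scalar_terms.

End ito_isometry.

(** * Mean-square limits and Tonelli's theorem on time strips *)

Lemma Lfun2_cvg d (T : measurableType d) (R : realType)
    (mu : {measure set T -> \bar R}) (u : nat -> T -> R) (f : T -> R)
    (c : R) (x : nat -> \bar R) :
  0 < c -> measurable_fun setT f -> (forall k, u k \in Lfun mu 2%:E) ->
  (forall k, (\int[mu]_t (c^-1 * (u k t - f t) ^+ 2)%:E <= x k)%E) ->
  x @ \oo --> 0%E ->
  f \in Lfun mu 2%:E /\
  (fun k => mip mu (fun t => u k t - f t) (fun t => u k t - f t)) @ \oo --> 0.
Proof.
move=> c0 mf lu ux x0.
have mu_ k : measurable_fun setT (fun t => (u k t - f t) ^+ 2).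
  by apply: measurable_funX; apply: measurable_funB => //; exact: Lfun2_measurable.
have {}ux k : (\int[mu]_t ((u k t - f t) ^+ 2)%:E <= c%:E * x k)%E.
  rewrite -lee_pdivrMl//; apply: le_trans (ux k).
  under [leRHS]eq_integral do rewrite EFinM.
  rewrite ge0_integralZl//.
  - exact/measurable_EFinP.
  - by move=> t _; rewrite lee_fin sqr_ge0.
  - by rewrite lee_fin invr_ge0 ltW.
have cx0 : (fun k => c%:E * x k)%E @ \oo --> 0%E.
  by rewrite -(mule0 c%:E); apply: cvgeZl.
have /fine_cvgP[fin cvg0] :
    (fun k => \int[mu]_t ((u k t - f t) ^+ 2)%:E)%E @ \oo --> 0%E.
  apply: (squeeze_cvge _ (cvg_cst 0%E) cx0).
  apply: nearW => k; rewrite ux andbT; apply: integral_ge0 => t _.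
  by rewrite lee_fin sqr_ge0.
split.
  (* Some error is finite, so [f] is the difference of two square-integrable functions. *)
  have [k _ hk] := fin; have {}hk := hk k (leqnn k).
  rewrite (_ : f = fun t => u k t - (u k t - f t)).
    apply: Lfun2B => //; apply/Lfun2P; split; last by rewrite ltey_eq hk.
    by apply: measurable_funB => //; exact: Lfun2_measurable.
  by apply/funext => t; rewrite subKr.
rewrite (_ : (fun k => _) = fine \o
  (fun k => \int[mu]_t ((u k t - f t) ^+ 2)%:E)%E)//.
Qed.

Section tonelli_strip.
Context (R : realType) (d : measure_display) (Omega : measurableType d)
  (P : probability Omega R) (S : set R) (h : R * Omega -> \bar R).
Local Notation leb := (@lebesgue_measure R).
Local Notation D := (S `*` [set: Omega]).
Hypotheses (h0 : forall p, (0 <= h p)%E)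
  (mh : measurable_fun setT (h \_ D)).
Local Open Scope ereal_scope.

Let hD0 p : 0 <= (h \_ D) p.
Proof. by rewrite patchE; case: ifP. Qed.

Lemma tonelli_strip : \int[leb \x P]_p (h \_ D) p =
  \int[leb]_(t in S) \int[P]_w h (t, w).
Proof.
rewrite fubini_tonelli1// [RHS]integral_mkcond; apply: eq_integral => t _.
rewrite /fubini_F patchE; case: ifPn => tS.
  by apply: eq_integral => w _; rewrite patchE in_setX/= tS in_setT.
by rewrite integral0_eq// => w _; rewrite patchE in_setX/= (negbTE tS).
Qed.

Lemma tonelli_strip2 : \int[leb \x P]_p (h \_ D) p =
  \int[P]_w \int[leb]_(t in S) h (t, w).
Proof.
rewrite fubini_tonelli2//; apply: eq_integral => w _.
rewrite /fubini_G [RHS]integral_mkcond; apply: eq_integral => t _.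
by rewrite !patchE in_setX/= in_setT andbT.
Qed.

End tonelli_strip.

Lemma restrict_sqr T (R : realType) (D : set T) (h : T -> R) :
  (fun p => (((h \_ D) p) ^+ 2)%:E) = ((fun p => ((h p) ^+ 2)%:E) \_ D)%E.
Proof.
by apply/funext => p; rewrite !patchE; case: ifP => //; rewrite expr0n.
Qed.

(** * The Ito isometry and orthogonality in the limit *)

Section ito_limit.
Context (R : realType) (d : measure_display) (Omega : measurableType d)
  (P : probability Omega R) (W : R -> Omega -> R).
Hypothesis BW : brownian_motion P W.
Context (n : nat) (O : set 'rV[R]_n) (f : 'rV[R]_n -> R) (a b : R)
  (z : R -> Omega -> 'rV[R]_n -> R) (I : Omega -> 'rV[R]_n -> R).
Local Notation leb := (@lebesgue_measure R).
Local Notation mu := (leb \x P)%E.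
Local Notation D := (`]a, b[ `*` [set: Omega]).
Local Notation zf := ((fun p : R * Omega => L2ip O (z p.1 p.2) f) \_ D).
Local Notation If := (fun w => L2ip O (I w) f).

Hypotheses (a0 : 0 <= a) (Lf : L2 O f)
  (Lz : forall t w, a < t < b -> L2 O (z t w))
  (mz : measurable_fun setT zf) (mI : measurable_fun setT If)
  (zI : is_ito P W O a b z I).

(** A Cauchy-Schwarz constant; the added 1 keeps it invertible when [f] has norm 0. *)
Let c := L2ip O f f + 1.
Let c0 : 0 < c. Proof. by rewrite ltr_wpDl// L2ip_ge0. Qed.

Let L2ip_sqr_le u : L2 O u -> ((c^-1 * L2ip O u f ^+ 2)%:E <= L2norm O u ^+ 2)%E.
Proof.
move=> Lu; rewrite sqr_L2norm// lee_fin ler_pdivrMl//.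
apply: le_trans (CauchySchwarz_L2ip Lu Lf) _; rewrite mulrC.
by apply: ler_wpM2r; rewrite ?L2ip_ge0// /c lerDl.
Qed.

Let L2_elementary_integral l w : List.Forall (ito_term_on W O a b) l ->
  L2 O (elementary_integral W l w).
Proof.
by move=> hl; apply: L2_sum; apply: List.Forall_impl hl => e [_ _ _ _ Le]; exact: L2Z.
Qed.

Let L2_elementary_process l t w : List.Forall (ito_term_on W O a b) l ->
  L2 O (elementary_process l t w).
Proof.
by move=> hl; apply: L2_sum; apply: List.Forall_impl hl => e [_ _ _ _ Le]; exact: L2Z.
Qed.

(** The same elementary processes approximate the integrand and the integral; pairing with [f] and
    the bound [L2ip_sqr_le] turn both errors into scalar mean-square errors. *)
Lemma ito_approximation : exists l : nat -> seq (ito_term R Omega n),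
  [/\ forall k, List.Forall (ito_term_on W O a b) (l k),
    If \in Lfun P 2%:E /\ (fun k =>
      let D k w := L2ip O (elementary_integral W (l k) w) f - If w in
      mip P (D k) (D k)) @ \oo --> 0 &
    zf \in Lfun mu 2%:E /\ (fun k =>
      let D k p := ((fun p : R * Omega =>
        L2ip O (elementary_process (l k) p.1 p.2) f) \_ D) p - zf p in
      mip mu (D k) (D k)) @ \oo --> 0].
Proof.
have [LI _ [l [hl cz cI]]] := zI; exists l; split => //=.
- apply: (Lfun2_cvg (c := c) _ _ _ _ cI) => // k.
    exact: (Lfun2_elementary_integral BW a0 Lf (hl k)).
  apply: ge0_le_integral_nomeas => w _.
    by rewrite lee_fin mulr_ge0 ?sqr_ge0// invr_ge0 ltW.
  have L1 := L2_elementary_integral w (hl k).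
  by rewrite -L2ipBl//; apply: L2ip_sqr_le; exact: L2B.
- apply: (Lfun2_cvg (c := c) _ _ _ _ cz) => // k.
    exact: (Lfun2_elementary_process BW Lf (hl k)).
  pose h (p : R * Omega) := L2ip O (elementary_process (l k) p.1 p.2) f -
    L2ip O (z p.1 p.2) f.
  have mh : measurable_fun setT (h \_ D).
    rewrite restrict_sub; apply: measurable_funB => //.
    exact: (Lfun2_measurable (Lfun2_elementary_process BW Lf (hl k))).
  rewrite (_ : (\int[mu]_t _)%E =
      \int[mu]_p (((fun p => (c^-1 * h p ^+ 2)%:E) \_ D)%E p))%E; last first.
    apply: eq_integral => p _; rewrite !patchE /h; case: ifP => //.
    by rewrite subrr expr0n mulr0.
  rewrite tonelli_strip; last 2 first.
  - by move=> p; rewrite lee_fin mulr_ge0 ?sqr_ge0// invr_ge0 ltW.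
  - rewrite (_ : _ \_ _ = (fun p => (c^-1 * ((h \_ D) p) ^+ 2)%:E)).
      by apply/measurable_EFinP; apply: measurable_funM => //; exact: measurable_funX.
    by apply/funext => p; rewrite !patchE; case: ifP => //; rewrite expr0n mulr0.
  apply: ge0_le_integral_nomeas => t tab.
    apply: integral_ge0 => w _.
    by rewrite lee_fin mulr_ge0 ?sqr_ge0// invr_ge0 ltW.
  apply: ge0_le_integral_nomeas => w _.
    by rewrite lee_fin mulr_ge0 ?sqr_ge0// invr_ge0 ltW.
  have L1 := L2_elementary_process t w (hl k).
  have L2 : L2 O (z t w) by apply: Lz; move: tab; rewrite /= in_itv.
  by rewrite /h -L2ipBl//; apply: L2ip_sqr_le; exact: L2B.
Qed.

(** The isometry of elementary processes passes to the limit because squared norms are continuous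
    for mean-square convergence. *)
Lemma ito_isometry : If \in Lfun P 2%:E /\ mip P If If = mip mu zf zf.
Proof.
have [l [hl [lI cI] [lz cz]]] := ito_approximation; split => //.
have hI := cvg_mnorm lI (fun k => Lfun2_elementary_integral BW a0 Lf (hl k)) cI.
have hz := cvg_mnorm lz (fun k => Lfun2_elementary_process BW Lf (hl k)) cz.
apply: cvg_unique hI _ => //.
rewrite (_ : (fun k => _) = (fun k => mip mu ((fun p : R * Omega =>
  L2ip O (elementary_process (l k) p.1 p.2) f) \_ D) ((fun p : R * Omega =>
  L2ip O (elementary_process (l k) p.1 p.2) f) \_ D)))//.
by apply/funext => k; exact: elementary_isometry.
Qed.

Lemma ito_orthogonal (X : Omega -> R) : X \in Lfun P 2%:E ->
  (forall u, a < u < b -> adapted W u X) -> mip P X If = 0.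
Proof.
move=> lX aX; have [l [hl [lI cI] _]] := ito_approximation.
have hI := cvg_mip lI lX (fun k => Lfun2_elementary_integral BW a0 Lf (hl k)) cI.
apply: cvg_unique hI _ => //.
rewrite (_ : (fun k => _) = (fun=> 0)); first exact: cvg_cst.
by apply/funext => k; exact: (mip_elementary_integral BW a0 Lf lX aX (hl k)).
Qed.

End ito_limit.

(** * Open sets of L^2(O) *)

Section L2_open_sets.
Context {R : realType} (n : nat) (O : set 'rV[R]_n).
Local Notation fn := ('rV[R]_n -> R).

Let L2norm_lt (u : fn) (e : R) : L2 O u -> 0 < e -> (L2norm O u < e%:E)%E ->
  L2ip O u u <= e ^+ 2.
Proof.
move=> Lu e0; rewrite L2normE// lte_fin => h.
rewrite -(sqr_sqrtr (L2ip_ge0 O u)).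
by rewrite ler_sqr ?nnegrE ?sqrtr_ge0 ?(ltW e0)// ltW.
Qed.

(** [L2measurable] quantifies over open sets of L^2(O); open superlevel sets turn it into
    measurability of coordinates. *)
Lemma L2open_gt_ip (f : fn) (c : R) : L2 O f -> L2open O [set u | c < L2ip O u f].
Proof.
move=> Lf u Lu /= cu.
pose q := L2ip O f f + 1.
have q0 : 0 < q by rewrite ltr_wpDl// L2ip_ge0.
have e0 : 0 < (L2ip O u f - c) ^+ 2 / (2 * q).
  by apply: divr_gt0; [rewrite exprn_gt0// subr_gt0|rewrite mulr_gt0].
(* For v within this radius, <v, f> <= c would give d^2 <= d^2 / 2 with d = <u, f> - c > 0. *)
exists (Num.sqrt ((L2ip O u f - c) ^+ 2 / (2 * q))); first by rewrite sqrtr_gt0.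
move=> v Lv /(L2norm_lt (L2B Lv Lu)); rewrite sqrtr_gt0 => /(_ e0).
rewrite sqr_sqrtr ?(ltW e0)// => h.
rewrite ltNge; apply/negP => vc.
have hCS := CauchySchwarz_L2ip (L2B Lv Lu) Lf.
rewrite L2ipBl// in hCS.
have : (L2ip O u f - c) ^+ 2 <= (L2ip O u f - c) ^+ 2 / 2.
  apply: (@le_trans _ _ ((L2ip O v f - L2ip O u f) ^+ 2)).
    by rewrite -(sqrrN (L2ip O v f - _)) opprB ler_sqr ?nnegrE; lra.
  apply: (le_trans hCS); apply: (le_trans (ler_wpM2r (L2ip_ge0 _ _) h)).
  have fq : L2ip O f f / q <= 1 by rewrite ler_pdivrMr// mul1r lerDl.
  rewrite [leLHS](_ : _ = (L2ip O u f - c) ^+ 2 / 2 * (L2ip O f f / q)).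
    by apply: ler_piMr => //; rewrite divr_ge0// sqr_ge0.
  by field; rewrite gt_eqF.
have : 0 < (L2ip O u f - c) ^+ 2 by rewrite exprn_gt0// subr_gt0.
lra.
Qed.

(** For c < 0 every function qualifies; otherwise the ball of radius |u| - sqrt c works by the
    reverse triangle inequality. *)
Lemma L2open_gt_sqr (c : R) : L2open O [set u | c < L2ip O u u].
Proof.
move=> u Lu /= cu.
have [c0|c0] := ltP c 0.
  by exists 1 => // v _ _; exact: lt_le_trans c0 (L2ip_ge0 _ _).
exists (Num.sqrt (L2ip O u u) - Num.sqrt c).
  by rewrite subr_gt0 ltr_sqrt// (le_lt_trans c0).
move=> v Lv; rewrite (L2normE (L2B Lv Lu)) lte_fin !L2ipE restrict_sub => h.
have := le_lt_trans (ler_dist_mnorm Lv Lu) h.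
rewrite -/(mnorm _ _) ltr_norml => /andP[h1 _].
have {}h1 : Num.sqrt c < mnorm (lebesgue_rV R n) (v \_ O) by rewrite /mnorm in h1 *; lra.
rewrite -(sqr_sqrtr c0) -sqr_mnorm ltr_sqr ?nnegrE ?sqrtr_ge0//.
Qed.

Lemma L2measurable_gt_ip (X : Type) (G : set (set X)) (D : set X) (F : X -> fn)
    (f : fn) (c : R) : L2measurable O G D F -> L2 O f ->
  G (D `&` [set x | c < L2ip O (F x) f]).
Proof. move=> mF Lf; have := mF _ (L2open_gt_ip (c := c) Lf). exact. Qed.

Lemma L2measurable_gt_sqr (X : Type) (G : set (set X)) (D : set X) (F : X -> fn)
    (c : R) : L2measurable O G D F ->
  G (D `&` [set x | c < L2ip O (F x) (F x)]).
Proof. move=> mF; have := mF _ (L2open_gt_sqr (c := c)). exact. Qed.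

End L2_open_sets.

Lemma measurable_fun_gt d (T : measurableType d) (R : realType) (D : set T)
    (h : T -> R) :
  (forall c, measurable (D `&` [set x | c < h x])) -> measurable_fun D h.
Proof.
move=> mh; apply: (measurability _ (RGenOInfty.measurableE R)) => //.
move=> _ [_ [c ->] <-]; rewrite (_ : _ @^-1` _ = [set x | c < h x])//.
by apply/seteqP; split => x /=; rewrite in_itv/= andbT.
Qed.

(** * Measurability of coordinates *)

Section scalar_measurability.
Context (R : realType) (d : measure_display) (Omega : measurableType d)
  (P : probability Omega R) (W : R -> Omega -> R).
Hypothesis BW : brownian_motion P W.
Context (n : nat) (O : set 'rV[R]_n).
Local Notation fn := ('rV[R]_n -> R).

Lemma prod_sigma_measurable (t : R) (S : set (R * Omega)) :
  prod_sigma (natural_filtration W t) S -> measurable S.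
Proof.
move: S; apply: smallest_sub; first exact: sigma_algebra_measurable.
move=> _ [A [B [mA FB ->]]]; apply: measurableX => //.
exact: (natural_filtration_measurable BW FB).
Qed.

(** This is how progressive measurability yields adaptedness: the sets with F_t-measurable sections
    form a sigma-algebra that contains the rectangles. *)
Lemma prod_sigma_section (t u : R) (S : set (R * Omega)) :
  prod_sigma (natural_filtration W t) S ->
  natural_filtration W t [set w | S (u, w)].
Proof.
move: S; apply: smallest_sub.
  split => /=.
  - exact: sigma_algebra0.
  - move=> S hS; rewrite (_ : [set w | _] = setT `\` [set w | S (u, w)]).
      exact: sigma_algebraCD.
    by apply/seteqP; split => w /=; [case|].
  - move=> S hS; rewrite (_ : [set w | _] = \bigcup_i [set w | S i (u, w)]).
      exact: sigma_algebra_bigcup.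
    by apply/seteqP; split => w /= [i _ h]; exists i.
move=> _ [A [B [mA FB ->]]] /=.
have [uA|uA] := pselect (A u).
  rewrite (_ : [set _ | _] = B)//.
  by apply/seteqP; split => w /=; [case|].
rewrite (_ : [set _ | _] = set0); first exact: sigma_algebra0.
by apply/seteqP; split => w //= [].
Qed.

(** The interval (0, T) is the union of the intervals (0, tk k], on each of which progressive
    measurability applies. The functional [phi] stands for a coordinate or for the squared norm. *)
Lemma progressive_measurable (T : R) (Z : R -> Omega -> fn) (phi : fn -> R) :
  0 < T -> progressively_measurable W O T Z ->
  (forall (G : set (set (R * Omega))) D c,
    L2measurable O G D (fun p => Z p.1 p.2) ->
    G (D `&` [set p | c < phi (Z p.1 p.2)])) ->
  measurable_fun (`]0, T[ `*` [set: Omega]) (fun p => phi (Z p.1 p.2)).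
Proof.
move=> T0 pZ hphi; apply: measurable_fun_gt => c.
(* The shift by 2 makes [tk 0] equal to T / 2, already positive. *)
pose tk (k : nat) := T - T / k.+2%:R.
have tk0 k : 0 < tk k < T.
  rewrite /tk subr_gt0 ltr_pdivrMr// ltr_pMr// ltr1n/=.
  by rewrite gtrBl divr_gt0.
rewrite (_ : _ `&` _ = \bigcup_k ((`]0, tk k] `*` [set: Omega]) `&`
    [set p | c < phi (Z p.1 p.2)])).
  apply: bigcup_measurable => k _.
  apply: (@prod_sigma_measurable (tk k)); apply: hphi.
  exact: pZ.
apply/seteqP; split => [[t w] [[/= + _] h]|[t w] [k _ [[/= + _] h]]].
  rewrite in_itv/= => /andP[t0 tT].
  have [k hk] : exists k : nat, T / (T - t) < k%:R.
    have := archi_boundP (_ : 0 <= T / (T - t)).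
    by move=> /(_ _) h'; eexists; apply: h'; rewrite divr_ge0 ?subr_ge0// ltW.
  exists k => //; split => //; split => //=; rewrite in_itv/= t0/= /tk.
  rewrite lerBrDr addrC -lerBrDr ler_pdivrMr// mulrC -ler_pdivrMr ?subr_gt0//.
  by rewrite (le_trans (ltW hk))// ler_nat -addn2 leq_addr.
rewrite in_itv/= => /andP[t0 tT]; split => //; split => //=.
by rewrite in_itv/= t0/= (le_lt_trans tT)//; have /andP[] := tk0 k.
Qed.

Lemma L2F_measurable_ip (T : R) (X : set fn) (Z : R -> Omega -> fn) (f : fn) :
  0 < T -> L2F P W O T X Z -> L2 O f ->
  measurable_fun (`]0, T[ `*` [set: Omega]) (fun p => L2ip O (Z p.1 p.2) f).
Proof.
move=> T0 [_ pZ _] Lf.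
apply: (progressive_measurable T0 pZ (phi := fun u => L2ip O u f)) => G D c mZ.
exact: L2measurable_gt_ip mZ Lf.
Qed.

Lemma L2F_measurable_sqr (T : R) (X : set fn) (Z : R -> Omega -> fn) :
  0 < T -> L2F P W O T X Z ->
  measurable_fun (`]0, T[ `*` [set: Omega])
    (fun p => L2ip O (Z p.1 p.2) (Z p.1 p.2)).
Proof.
move=> T0 [_ pZ _].
apply: (progressive_measurable T0 pZ (phi := fun u => L2ip O u u)) => G D c mZ.
exact: L2measurable_gt_sqr mZ.
Qed.

(** Progressive measurability up to time u, read on the section at the right end of (0, u]. *)
Lemma L2F_adapted_ip (T u : R) (X : set fn) (Z : R -> Omega -> fn) (f : fn) :
  0 < u < T -> L2F P W O T X Z -> L2 O f ->
  adapted W u (fun w => L2ip O (Z u w) f).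
Proof.
move=> /[dup] uT /andP[u0 _] [_ pZ _] Lf; apply: measurable_fun_gt => c.
have := L2measurable_gt_ip c (pZ u uT) Lf => /(@prod_sigma_section _ u).
rewrite (_ : [set w | _] = setT `&` [set w | c < L2ip O (Z u w) f])//.
by apply/seteqP; split => w /=; [case|move=> [_ h]; split => //; split => //=;
  rewrite in_itv/= u0 lexx].
Qed.

End scalar_measurability.

(** * Coordinates of Bochner integrals *)

Section bochner_coordinates.
Context {R : realType} (n : nat) (O : set 'rV[R]_n).
Local Notation fn := ('rV[R]_n -> R).
Local Notation leb := (@lebesgue_measure R).
Context (a b : R) (F : R -> fn) (I f : fn).
Hypotheses (Lf : L2 O f) (FI : is_bochner O a b F I).
Local Notation phi := (fun t => L2ip O (F t) f).
Local Notation ab := (`]a, b[%classic : set R).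

Let c := Num.sqrt (L2ip O f f) + 1.
Let c0 : 0 < c. Proof. by rewrite ltr_wpDl// sqrtr_ge0. Qed.

Let le_c u : L2 O u -> (`|L2ip O u f|%:E <= c%:E * L2norm O u)%E.
Proof.
move=> Lu; apply: le_trans (ler_norm_L2ip Lu Lf) _; rewrite muleC.
apply: lee_wpmul2r; first exact: Lnorm_ge0.
by rewrite L2normE// lee_fin lerDl.
Qed.

Let ok (l : seq (set R * fn)) := List.Forall (fun e => measurable e.1 /\ L2 O e.2) l.

Let L2_simple_fun l t : ok l -> L2 O (simple_fun l t).
Proof.
by move=> hl; apply: L2_sum; apply: List.Forall_impl hl => e [_ Le]; exact: L2Z.
Qed.

Let L2_simple_integral l : ok l -> L2 O (simple_integral a b l).
Proof.
by move=> hl; apply: L2_sum; apply: List.Forall_impl hl => e [_ Le]; exact: L2Z.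
Qed.

Let leb_ab : (leb ab < +oo)%E.
Proof. by rewrite lebesgue_measure_itv/=; case: ifP => _; rewrite ltry. Qed.

Let ip_simple_fun l t : ok l ->
  L2ip O (simple_fun l t) f = \sum_(e <- l) \1_(e.1) t * L2ip O e.2 f.
Proof.
move=> hl; rewrite L2ip_suml//; last first.
  by apply: List.Forall_impl hl => e [_ Le]; exact: L2Z.
by apply: (eq_big_Forall hl) => e [_ Le]; rewrite L2ipZl.
Qed.

Let integrable_indic_ab (A : set R) (v : R) : measurable A ->
  leb.-integrable ab (fun t => (\1_A t * v)%:E).
Proof.
move=> mA.
rewrite (_ : (fun t => _) = (fun t => v%:E * (\1_A t)%:E)%E); last first.
  by apply/funext => t; rewrite mulrC EFinM.
apply: integrableZl => //; apply/integrableP; split.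
  by apply/measurable_EFinP; exact: measurable_indic.
apply: le_lt_trans leb_ab.
under eq_integral do rewrite gee0_abs ?lee_fin//.
rewrite integral_indic//; apply: le_measure; rewrite ?inE//.
exact: measurableI.
Qed.

Let simple_ip l : ok l ->
  leb.-integrable ab (fun t => (L2ip O (simple_fun l t) f)%:E) /\
  (\int[leb]_(t in ab) L2ip O (simple_fun l t) f)%R =
    L2ip O (simple_integral a b l) f.
Proof.
move=> hl.
rewrite (_ : (fun t => (L2ip O (simple_fun l t) f)%:E) =
  (fun t => (\sum_(e <- l) \1_(e.1) t * L2ip O e.2 f)%:E)); last first.
  by apply/funext => t; rewrite ip_simple_fun.
rewrite (_ : (\int[leb]_(t in ab) _)%R =
  (\int[leb]_(t in ab) \sum_(e <- l) \1_(e.1) t * L2ip O e.2 f)%R); last first.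
  by apply: eq_Rintegral => t _; rewrite ip_simple_fun.
have -> : L2ip O (simple_integral a b l) f =
    \sum_(e <- l) fine (leb (e.1 `&` ab)) * L2ip O e.2 f.
  rewrite L2ip_suml//; last first.
    by apply: List.Forall_impl hl => e [_ Le]; exact: L2Z.
  by apply: (eq_big_Forall hl) => e [_ Le]; rewrite L2ipZl.
elim: l hl => [_|e l IH hl].
  split.
    rewrite (_ : (fun t => _) = cst 0%E); first exact: integrable0.
    by apply/funext => t; rewrite big_nil.
  rewrite big_nil; under eq_Rintegral do rewrite big_nil.
  by rewrite /Rintegral integral0.
inversion hl as [|e' l' [me _] hl']; subst.
have [i1 e1] := IH hl'; have i0 := integrable_indic_ab (L2ip O e.2 f) me; split.
  rewrite (_ : (fun t => _) = (fun t => (\1_(e.1) t * L2ip O e.2 f)%:E +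
    (\sum_(e' <- l) \1_(e'.1) t * L2ip O e'.2 f)%:E)%E).
    exact: integrableD.
  by apply/funext => t; rewrite big_cons EFinD.
rewrite big_cons -e1; under eq_Rintegral do rewrite big_cons.
rewrite RintegralD//; congr (_ + _).
rewrite RintegralZr//; last first.
  have := integrable_indic_ab 1 me; congr (integrable _ _ _).
  by apply/funext => t; rewrite mulr1.
by congr (_ * _); rewrite /Rintegral integral_indic.
Qed.

(** For simple functions this is linearity. In general, the pairing with [f] is bounded by [c] times
    the norm, so each side differs from its value for a simple function by at most [c] times one of
    the two errors in the definition. *)
Lemma bochner_ip : leb.-integrable ab (EFin \o phi) ->
  L2ip O I f = (\int[leb]_(t in ab) phi t)%R.
Proof.
move=> iphi; have [LF _ LI [l [hl cF cI]]] := FI.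
set J := (\int[leb]_(t in ab) phi t)%R.
pose x k := (\int[leb]_(t in ab) L2norm O (simple_fun (l k) t \- F t)%R)%E.
pose y k := L2norm O (simple_integral a b (l k) \- I)%R.
have bnd k : (`|L2ip O I f - J|%:E <= c%:E * (x k + y k))%E.
  have [ik ek] := simple_ip (hl k).
  have x0 : (0 <= x k)%E by apply: integral_ge0 => t _; exact: Lnorm_ge0.
  have y0 : (0 <= y k)%E by exact: Lnorm_ge0.
  rewrite ge0_muleDr// addeC.
  apply: (@le_trans _ _ (`|L2ip O (simple_integral a b (l k)) f - L2ip O I f|%:E +
      `|L2ip O (simple_integral a b (l k)) f - J|%:E)%E).
    by rewrite -EFinD lee_fin (distrC _ (L2ip O I f)) ler_distD.
  apply: leeD.
    rewrite -L2ipBl//; last exact: L2_simple_integral.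
    by apply: le_c; apply: L2B => //; exact: L2_simple_integral.
  rewrite -ek /J -RintegralB//.
  have mB : measurable_fun ab (fun t => L2ip O (simple_fun (l k) t) f - phi t).
    by apply: measurable_funB; apply/measurable_EFinP;
      [exact: measurable_int ik|exact: measurable_int iphi].
  have iB : leb.-integrable ab
      (EFin \o (fun t => L2ip O (simple_fun (l k) t) f - phi t)).
    rewrite (_ : EFin \o _ = (EFin \o (fun t => L2ip O (simple_fun (l k) t) f))
      \- (EFin \o phi))%E//.
    exact: integrableB.
  apply: (@le_trans _ _ (\int[leb]_(t in ab)
      `|L2ip O (simple_fun (l k) t) f - phi t|%:E)%E).
    rewrite -[leRHS]fineK; last first.
      apply: integrable_fin_num => //; exact: integrable_norm.
    by rewrite lee_fin; exact: le_normr_Rintegral.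
  rewrite -lee_pdivrMl// -ge0_integralZl//; last 2 first.
  - by apply/measurable_EFinP; exact: measurableT_comp.
  - by rewrite lee_fin invr_ge0 ltW.
  apply: ge0_le_integral_nomeas => t; first by rewrite mule_ge0// lee_fin invr_ge0 ltW.
  rewrite /= in_itv/= => tab.
  have L1 := L2_simple_fun t (hl k); have L2 := LF t tab.
  rewrite lee_pdivrMl// -L2ipBl//.
  by apply: le_c; exact: L2B.
have cxy : (fun k => c%:E * (x k + y k))%E @ \oo --> 0%E.
  by rewrite -(mule0 c%:E) -(adde0 0%E); apply: cvgeZl => //; apply: cvgeD.
have : (fun=> `|L2ip O I f - J|%:E) @ \oo --> 0%E.
  apply: (squeeze_cvge _ (cvg_cst 0%E) cxy).
  by apply: nearW => k; rewrite bnd lee_fin normr_ge0.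
move=> /(cvg_unique _ (cvg_cst _)) => /(_ (@ereal_hausdorff R))[]/eqP.
by rewrite normr_eq0 subr_eq0 => /eqP.
Qed.

End bochner_coordinates.

(** * Square norms of time integrals *)

Section time_integral.
Context (R : realType) (d : measure_display) (Omega : measurableType d)
  (P : probability Omega R) (a b : R) (h : R * Omega -> R).
Local Notation leb := (@lebesgue_measure R).
Local Notation mu := (leb \x P)%E.
Local Notation ab := (`]a, b[%classic : set R).
Hypotheses (ab_lt : a < b) (hD : h \_ (ab `*` setT) = h)
  (lh : h \in Lfun mu 2%:E).

Let leb_ab : leb ab = (b - a)%:E.
Proof. by rewrite lebesgue_measure_itv/= lte_fin ab_lt EFinB. Qed.

Let one_ab : (\1_ab : R -> R) \in Lfun leb 2%:E.
Proof.
by apply: Lfun2_indic => //; rewrite [ltLHS](_ : _ = (b - a)%:E) ?ltry//; exact: leb_ab.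
Qed.

Let ihh : mu.-integrable setT (EFin \o (fun p => h p ^+ 2)).
Proof. exact: Lfun2_integrable_sqr. Qed.

Let ih : mu.-integrable setT (EFin \o h).
Proof.
have lD : (\1_(ab `*` [set: Omega]) : R * Omega -> R) \in Lfun mu 2%:E.
  apply: Lfun2_indic; first exact: measurableX.
  rewrite [ltLHS](_ : _ = (leb ab * P setT)%E); last exact: product_measure1E.
  by rewrite probability_setT mule1 leb_ab ltry.
have := Lfun2M lh lD; apply: eq_integrable => // p _ /=.
have : h p = if p \in ab `*` [set: Omega] then h p else 0 by rewrite -{1}hD patchE.
by rewrite indicE; case: (p \in _) => [_|->]; rewrite ?mulr1 ?mul0r.
Qed.

Let h_out t w : t \notin ab -> h (t, w) = 0.
Proof. by move=> tab; rewrite -hD patchE in_setX/= (negbTE tab). Qed.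

Let section_Lfun2 : {ae P, forall w, (fun t => h (t, w)) \in Lfun leb 2%:E}.
Proof.
have mh := Lfun2_measurable lh.
have := ae_integrable2 ihh; apply: filterS => w /= iw.
apply/Lfun2P; split; first exact: (measurableT_comp mh (pair2_measurable w)).
have /integrableP[_] := iw; apply: le_lt_trans.
by apply: ge0_le_integral_nomeas => t _ /=; rewrite ?lee_fin ?sqr_ge0 ?ler_norm.
Qed.

Definition time_integral (w : Omega) : R := (\int[leb]_(t in ab) h (t, w))%R.

Lemma ae_integrable_section :
  {ae P, forall w, leb.-integrable ab (fun t => (h (t, w))%:E)}.
Proof.
have := ae_integrable2 ih; apply: filterS => w /= iw.
exact: integrableS iw.
Qed.

Let time_integralE w : time_integral w = mip leb (fun t => h (t, w)) \1_ab.
Proof.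
rewrite /time_integral Rintegral_mkcond; congr fine; apply: eq_integral => t _.
by rewrite patchE indicE; case: ifPn; rewrite ?mulr1 ?mulr0.
Qed.

Let time_integral_sqr : {ae P, forall w, ((time_integral w ^+ 2)%:E <=
  (b - a)%:E * \int[leb]_t (h (t, w) ^+ 2)%:E)%E}.
Proof.
apply: filterS section_Lfun2 => w lw.
rewrite -mip_sqrE// -EFinM lee_fin time_integralE mulrC.
apply: le_trans (CauchySchwarz_mip lw one_ab) _; apply: ler_wpM2l.
  exact: mip_ge0.
suff -> : mip leb (\1_ab : R -> R) \1_ab = b - a by [].
apply/EFin_inj; rewrite mip_sqrE//; transitivity (leb ab); last exact: leb_ab.
transitivity (\int[leb]_t (\1_ab t)%:E)%E; last by rewrite integral_indic// setIT.
apply: eq_integral => t _; rewrite indicE.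
by case: (_ \in _); rewrite ?expr1n ?expr0n.
Qed.

Let measurable_time_integral : measurable_fun setT time_integral.
Proof.
rewrite (_ : time_integral = fine \o fubini_G leb (EFin \o h)).
  by apply: measurableT_comp; [exact: fine_measurable|exact: (measurable_fubini_G ih)].
apply/funext => w; rewrite /time_integral /Rintegral/= /fubini_G.
congr fine; rewrite [LHS]integral_mkcond; apply: eq_integral => t _.
by rewrite patchE; case: ifPn => // /h_out /= ->.
Qed.

(** For almost every omega, Cauchy-Schwarz in time against the indicator of (a, b), whose squared
    norm is b - a; then integration over omega by Fubini's theorem. *)
Lemma mip_time_integral : time_integral \in Lfun P 2%:E /\
  mip P time_integral time_integral <= (b - a) * mip mu h h.
Proof.
have bnd : (\int[P]_w (time_integral w ^+ 2)%:E <= ((b - a) * mip mu h h)%:E)%E.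
  have mG : measurable_fun setT (fun w => \int[leb]_t (h (t, w) ^+ 2)%:E)%E.
    by have := measurable_fubini_G ihh.
  apply: (@le_trans _ _ (\int[P]_w ((b - a)%:E * \int[leb]_t (h (t, w) ^+ 2)%:E))%E).
    apply: ae_ge0_le_integral => //.
    - by move=> w _; rewrite lee_fin sqr_ge0.
    - apply/measurable_EFinP; exact: (measurable_funX 2 measurable_time_integral).
    - move=> w _; apply: mule_ge0; first by rewrite lee_fin subr_ge0 ltW.
      by apply: integral_ge0 => t _; rewrite lee_fin sqr_ge0.
    - by apply: emeasurable_funM.
    - by apply: filterS time_integral_sqr => w hw _.
  rewrite ge0_integralZl//.
  - by rewrite EFinM mip_sqrE// -(integral21_prod_meas1 ihh).
  - by move=> w _; apply: integral_ge0 => t _; rewrite lee_fin sqr_ge0.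
  - by rewrite lee_fin subr_ge0 ltW.
have lA : time_integral \in Lfun P 2%:E.
  apply/Lfun2P; split; first exact: measurable_time_integral.
  by apply: (le_lt_trans bnd); rewrite ltry.
by split => //; rewrite -lee_fin mip_sqrE.
Qed.

End time_integral.

(** The recursion is unrolled from 0 up to k, with p_k left on the right-hand side; at k = J it
    vanishes. The factor 12 is 3 times the 4 of z_j / 4. *)
Lemma discrete_gronwall (R : realType) (J : nat) (r : R) (p z g : nat -> R) :
  0 <= r -> (forall j, 0 <= p j) -> (forall j, 0 <= z j) -> (forall j, 0 <= g j) ->
  (forall j, (j < J)%N -> p j + z j / 4 <= (1 + r) * p j.+1 + 3 * g j) ->
  p J = 0 ->
  \sum_(j < J) z j <= 12 * (1 + r) ^+ J * \sum_(j < J) g j.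
Proof.
move=> r0 p0 z0 g0 step pJ.
have H k : (k <= J)%N -> p 0%N + (\sum_(j < k) z j) / 4 <=
    (1 + r) ^+ k * (p k + 3 * \sum_(j < k) g j).
  elim: k => [_|k IH kJ]; first by rewrite !big_ord0 expr0; lra.
  have := IH (ltnW kJ); have := step k kJ; rewrite !big_ord_recr/= exprS.
  have : 1 <= (1 + r) ^+ k by rewrite exprn_ege1// lerDl.
  have Sg : 0 <= \sum_(j < k) g j by exact: sumr_ge0.
  have := z0 k; have := g0 k; have := p0 k.+1.
  set w := _ ^+ k; set G := \sum_(j < k) g j in Sg *; set Z := \sum_(j < k) z j.
  move=> p1 g1 z1 w1 h1 h2.
  have w0 : 0 <= w by lra.
  have h3 := ler_wpM2l w0 h1.
  (* The weight (1 + r)^k is at least 1, so it may be dropped from the z-term on the left. *)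
  have h4 : z k / 4 <= w * (z k / 4) by apply: ler_peMl => //; lra.
  have h5 : 0 <= r * w * G by rewrite !mulr_ge0.
  have h6 : 0 <= r * w * g k by rewrite !mulr_ge0.
  nra.
have := H J (leqnn J); rewrite pJ; have := p0 0%N.
set w := _ ^+ J; lra.
Qed.

(** * The implicit Euler step in coordinates *)

Section parseval.
Context {R : realType} (n : nat) (O : set 'rV[R]_n)
  (mesh : seq 'M[R]_(n.+1, n)) (m : nat) (e : 'I_m -> 'rV[R]_n -> R).
Hypotheses (oe : orthonormal O mesh e)
  (be : forall v, Vh O mesh v -> L2ip O v v = \sum_i L2ip O v (e i) ^+ 2).

Let Le i : L2 O (e i). Proof. by apply: Vh_L2; exact: oe.1. Qed.

Let proj (v : 'rV[R]_n -> R) : 'rV[R]_n -> R :=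
  fun x => \sum_i L2ip O v (e i) * e i x.

Let L2_proj v : L2 O (proj v).
Proof. by apply: L2_sum; apply: List_Forall_all => i; exact: L2Z. Qed.

Let proj_ip v w : L2 O w ->
  L2ip O (proj v) w = \sum_i L2ip O v (e i) * L2ip O (e i) w.
Proof.
move=> Lw; rewrite L2ip_suml//; last by apply: List_Forall_all => i; exact: L2Z.
by apply: eq_bigr => i _; rewrite L2ipZl.
Qed.

Let residual v : L2 O v ->
  L2ip O (fun x => v x - proj v x) (fun x => v x - proj v x) =
  L2ip O v v - \sum_i L2ip O v (e i) ^+ 2.
Proof.
move=> Lv; have Lp := L2_proj v.
rewrite (L2ipBl Lv Lp (L2B Lv Lp)) !L2ipBr//.
have pv : L2ip O (proj v) v = \sum_i L2ip O v (e i) ^+ 2.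
  by rewrite proj_ip//; apply: eq_bigr => i _; rewrite (L2ipC _ (e i)) expr2.
rewrite (L2ipC _ v (proj v)) pv proj_ip//.
rewrite (_ : \sum_i _ * _ = \sum_i L2ip O v (e i) ^+ 2) ?subrr ?subr0//.
apply: eq_bigr => i _; rewrite (L2ipC _ (e i)) proj_ip// (bigD1 i)//= oe.2 eqxx mulr1.
rewrite big1 ?addr0 ?expr2// => j ji.
by rewrite oe.2 (negbTE ji) mulr0.
Qed.

Lemma bessel v : L2 O v -> \sum_i L2ip O v (e i) ^+ 2 <= L2ip O v v.
Proof. by move=> Lv; rewrite -subr_ge0 -residual// L2ip_ge0. Qed.

(** The difference between [v] and its expansion has norm 0, so Cauchy-Schwarz makes its product
    with any [w] of L^2(O) vanish. *)
Lemma parseval v w : Vh O mesh v -> L2 O w ->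
  L2ip O v w = \sum_i L2ip O v (e i) * L2ip O w (e i).
Proof.
move=> Vv Lw; have Lv := Vh_L2 Vv; have Lp := L2_proj v.
have := CauchySchwarz_L2ip (L2B Lv Lp) Lw.
rewrite residual// -be// subrr mul0r => h.
have : L2ip O (fun x => v x - proj v x) w ^+ 2 == 0 by rewrite eq_le h sqr_ge0.
rewrite sqrf_eq0 L2ipBl// subr_eq0 => /eqP ->; rewrite proj_ip//.
by apply: eq_bigr => i _; rewrite (L2ipC _ (e i)).
Qed.

Hypotheses (oO : open O) (am : forall K, K \in mesh -> affinely_independent K).
Context (Dh : ('rV[R]_n -> R) -> 'rV[R]_n -> R).
Hypothesis hDh : is_discrete_laplacian O mesh Dh.

Lemma discrete_laplacian_sym v w : Vh O mesh v -> Vh O mesh w ->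
  L2ip O (Dh v) w = L2ip O v (Dh w).
Proof.
move=> Vv Vw.
have [G hG] := Vh_grad oO am Vv; have [H hH] := Vh_grad oO am Vw.
rewrite ((hDh Vv).2 _ _ _ Vw hG hH) [RHS]L2ipC ((hDh Vw).2 _ _ _ Vv hH hG).
by congr (- _); apply: eq_bigr => i _; rewrite L2ipC.
Qed.

Lemma discrete_laplacian_le0 v : Vh O mesh v -> L2ip O (Dh v) v <= 0.
Proof.
move=> Vv; have [G hG] := Vh_grad oO am Vv.
rewrite ((hDh Vv).2 _ _ _ Vv hG hG) oppr_le0; apply: sumr_ge0 => i _.
exact: L2ip_ge0.
Qed.

(* As [Dh] is symmetric, the right-hand side is the squared norm of [v - t Dh v]. *)
Lemma implicit_step_coords (t : R) v : 0 <= t -> Vh O mesh v ->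
  \sum_i L2ip O v (e i) ^+ 2 <=
  \sum_i L2ip O v (fun x => e i x - t * Dh (e i) x) ^+ 2.
Proof.
move=> t0 Vv; have Lv := Vh_L2 Vv; have VD := (hDh Vv).1; have LD := Vh_L2 VD.
have Ve := oe.1.
have E i : L2ip O v (fun x => e i x - t * Dh (e i) x) =
    L2ip O v (e i) - t * L2ip O (Dh v) (e i).
  have LDe : L2 O (Dh (e i)) by apply: Vh_L2; exact: (hDh (Ve i)).1.
  by rewrite L2ipBr// ?L2ipZr// ?discrete_laplacian_sym//; exact: L2Z.
(* By dissipativity and Parseval's identity the cross term of the expanded square has the favourable
   sign. *)
have /(ler_wpM2l t0) := discrete_laplacian_le0 Vv.
rewrite mulr0 (parseval VD Lv) => h.
under [leRHS]eq_bigr do rewrite E sqrrB.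
rewrite big_split/= sumrB.
have : 0 <= \sum_i (t * L2ip O (Dh v) (e i)) ^+ 2.
  by apply: sumr_ge0 => i _; exact: sqr_ge0.
rewrite (_ : \sum_i (_ *+ 2) =
    2 * (t * \sum_i L2ip O (Dh v) (e i) * L2ip O v (e i))); first lra.
by rewrite !mulr_sumr; apply: eq_bigr => i _; rewrite -mulr_natl; ring.
Qed.

End parseval.

(** The difference of the two sides is r^-1 |r f - g|^2. *)
Lemma mip_young d (T : measurableType d) (R : realType)
    (mu : {measure set T -> \bar R}) (f g : T -> R) (r : R) : 0 < r ->
  f \in Lfun mu 2%:E -> g \in Lfun mu 2%:E ->
  mip mu (fun x => f x + g x) (fun x => f x + g x) <=
  (1 + r) * mip mu f f + (1 + r^-1) * mip mu g g.
Proof.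
move=> r0 lf lg; have lrf := Lfun2Z r lf.
have := mip_ge0 mu (fun x => r * f x - g x).
rewrite (mipBl lrf lg (Lfun2B lrf lg)) !mipBr// !mipZl// mipZr// (mipC _ g).
rewrite mipZl// => h.
rewrite (mipDl lf lg (Lfun2D lf lg)) !mipDr// (mipC _ g f) -subr_ge0.
rewrite (_ : _ - _ = r^-1 * (r * (r * mip mu f f) - r * mip mu f g -
  (r * mip mu f g - mip mu g g))); last by field; rewrite gt_eqF.
by rewrite mulr_ge0// invr_ge0 ltW.
Qed.

Lemma sum_mip d (T : measurableType d) (R : realType)
    (mu : {measure set T -> \bar R}) m (f : 'I_m -> T -> R) :
  (forall i, f i \in Lfun mu 2%:E) ->
  ((\sum_i mip mu (f i) (f i))%:E = \int[mu]_x (\sum_i (f i x) ^+ 2)%:E)%E.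
Proof.
move=> lf; rewrite -sumEFin; under eq_integral do rewrite -sumEFin.
rewrite ge0_integral_sum//.
- by apply: eq_bigr => i _; rewrite mip_sqrE.
- move=> i; apply/measurable_EFinP; apply: measurable_funX.
  exact: Lfun2_measurable.
- by move=> i x _; rewrite lee_fin sqr_ge0.
Qed.

(** * Splitting (0, T) into time steps *)

Section strips.
Context (R : realType) (d : measure_display) (Omega : measurableType d)
  (P : probability Omega R) (T : R) (J : nat) (H : R * Omega -> \bar R).
Local Notation leb := (@lebesgue_measure R).
Local Notation mu := (leb \x P)%E.
Local Notation strip j :=
  (`]node T J j, node T J j.+1[%classic `*` [set: Omega]).
Hypotheses (T0 : 0 < T) (J0 : (0 < J)%N) (H0 : forall p, (0 <= H p)%E)
  (mH : measurable_fun (`]0, T[ `*` [set: Omega]) H).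

Lemma node_lt j : node T J j < node T J j.+1.
Proof. by rewrite /node ltr_pM2r ?ltr_nat// divr_gt0// ltr0n. Qed.

Lemma nodeJ : node T J J = T.
Proof. by rewrite /node mulrC divfK// pnatr_eq0 -lt0n. Qed.

Lemma node_le i j : (i <= j)%N -> node T J i <= node T J j.
Proof. by move=> ij; rewrite /node ler_pM2r ?ler_nat// divr_gt0// ltr0n. Qed.

Lemma node_ge0 j : 0 <= node T J j.
Proof. by rewrite /node mulr_ge0// divr_ge0// ltW. Qed.

Lemma nodeB j : node T J j.+1 - node T J j = T / J%:R.
Proof. by rewrite /node -mulrBl -natrB// subSnn mul1r. Qed.

Lemma node_itv j : (j < J)%N ->
  (`]node T J j, node T J j.+1[%classic : set R) `<=` `]0, T[%classic.
Proof.
move=> jJ t /=; rewrite !in_itv/= => /andP[h1 h2].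
rewrite (le_lt_trans (node_ge0 j) h1)/=.
by rewrite (lt_le_trans h2)// -[leRHS]nodeJ node_le.
Qed.

Lemma measurable_strip j : (j < J)%N -> measurable_fun setT (H \_ (strip j)).
Proof.
move=> jJ; apply/(measurable_restrictT _ _).1; first exact: measurableX.
apply: measurable_funS mH; first exact: measurableX.
by apply: setSX => //; exact: node_itv.
Qed.

(** By Tonelli's theorem both sides are integrals in time of the same function [N]; the open
    subintervals miss only the nodes, a null set. *)
Lemma integral_strips :
  (\int[P]_w \int[leb]_(t in `]0%R, T[) H (t, w) =
   \sum_(j < J) \int[mu]_p (H \_ (strip j)) p)%E.
Proof.
pose D := `]0, T[%classic `*` [set: Omega].
have mHD : measurable_fun setT (H \_ D).
  by apply/(measurable_restrictT _ _).1 => //; exact: measurableX.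
have HD0 p : (0 <= (H \_ D) p)%E by rewrite patchE; case: ifP.
pose N := fubini_F P (H \_ D).
have mN : measurable_fun setT N by exact: measurable_fun_fubini_tonelli_F.
have N0 t : (0 <= N t)%E by exact: integral_ge0.
have NE t : `]0, T[%classic t -> (\int[P]_w H (t, w) = N t)%E.
  move=> tT; apply: eq_integral => w _.
  by rewrite patchE in_setX/= (mem_set tT) in_setT.
rewrite -tonelli_strip2// tonelli_strip//.
rewrite (_ : (\int[leb]_(t in _) _)%E = (\int[leb]_(t in `]0%R, T[) N t)%E); last first.
  by apply: eq_integral => t /[!inE] /NE.
have stripN j : (j < J)%N -> (\int[mu]_p (H \_ (strip j)) p =
    \int[leb]_(t in `]node T J j, node T J j.+1[) N t)%E.
  move=> jJ; rewrite (tonelli_strip P H0 (measurable_strip jJ)).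
  by apply: eq_integral => t tj; apply: NE; exact/(node_itv jJ)/set_mem.
have main k : (\int[leb]_(t in `]0%R, node T J k[) N t =
    \sum_(j < k) \int[leb]_(t in `]node T J j, node T J j.+1[) N t)%E.
  elim: k => [|k IH].
    by rewrite big_ord0 /node mul0r set_itvoo0 ?integral_set0.
  rewrite big_ord_recr/= -IH (@integral_itv_bndo_bndc _ _ (node T J k)); last first.
    exact: measurable_funTS.
  rewrite (@itv_bndbnd_setU _ _ _ (BRight (node T J k))) ?bnd_simp ?node_ge0 ?node_lt//.
  rewrite ge0_integral_setU//; first exact: measurable_funTS.
  apply/disj_set2P; rewrite -subset0 => t [] /=; rewrite !in_itv/=.
  by move=> /andP[_ h1] /andP[h2 _]; move: h2; rewrite ltNge h1.
rewrite -{1}nodeJ main; apply: eq_bigr => j _.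
by rewrite stripN.
Qed.

End strips.

Section scheme.
Context (R : realType) (d : measure_display) (Omega : measurableType d)
  (P : probability Omega R) (W : R -> Omega -> R).
Context (n : nat) (O : set 'rV[R]_n) (mesh : seq 'M[R]_(n.+1, n)) (T : R) (J : nat).
Local Notation fn := ('rV[R]_n -> R).
Local Notation leb := (@lebesgue_measure R).
Local Notation mu := (leb \x P)%E.
Local Notation strip j :=
  (`]node T J j, node T J j.+1[%classic `*` [set: Omega]).
Local Notation tau := (T / J%:R).
Hypotheses (BW : brownian_motion P W) (T0 : 0 < T) (J0 : (0 < J)%N).

Section square_integrable_process.
Context (X : set fn) (Z : R -> Omega -> fn).
Hypotheses (XL2 : X `<=` L2 O) (LZ : L2F P W O T X Z).

Let zz (p : R * Omega) : \bar R := (L2ip O (Z p.1 p.2) (Z p.1 p.2))%:E.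

Lemma L2F_norm_strips :
  (\int[P]_w \int[leb]_(t in `]0%R, T[) (L2norm O (Z t w)) ^+ 2 =
   \sum_(j < J) \int[mu]_p (zz \_ (strip j)) p)%E.
Proof.
have [XZ _ _] := LZ.
have zz0 p : (0 <= zz p)%E by rewrite lee_fin L2ip_ge0.
have mzz : measurable_fun (`]0, T[ `*` [set: Omega]) zz.
  by apply/measurable_EFinP; exact: L2F_measurable_sqr LZ.
rewrite -(integral_strips P T0 J0 zz0 mzz).
apply: eq_integral => w _; apply: eq_integral => t tT.
have {}tT : 0 < t < T by move: tT; rewrite inE/= in_itv.
by rewrite sqr_L2norm//; apply: XL2; exact: XZ.
Qed.

(** [L2F] asks for finiteness with the time integral outside, whereas the norm has the expectation
    outside; Tonelli's theorem exchanges them. *)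
Lemma L2F_norm_lty :
  (\int[P]_w \int[leb]_(t in `]0%R, T[) (L2norm O (Z t w)) ^+ 2 < +oo)%E.
Proof.
have [XZ _ fZ] := LZ.
pose D := `]0, T[%classic `*` [set: Omega].
have zz0 p : (0 <= zz p)%E by rewrite lee_fin L2ip_ge0.
have mzz : measurable_fun setT (zz \_ D).
  apply/(measurable_restrictT _ _).1; first exact: measurableX.
  by apply/measurable_EFinP; exact: L2F_measurable_sqr LZ.
have E t w : t \in `]0, T[%classic -> ((L2norm O (Z t w)) ^+ 2 = zz (t, w))%E.
  move=> tT; have {}tT : 0 < t < T by move: tT; rewrite inE/= in_itv.
  by rewrite sqr_L2norm//; apply: XL2; exact: XZ.
rewrite (_ : (\int[P]_w _)%E = (\int[mu]_p (zz \_ D) p)%E).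
  rewrite (tonelli_strip P zz0 mzz); apply: le_lt_trans fZ.
  rewrite le_eqVlt; apply/orP; left; apply/eqP.
  by apply: eq_integral => t tT; apply: eq_integral => w _; rewrite E.
rewrite (tonelli_strip2 P zz0 mzz).
by apply: eq_integral => w _; apply: eq_integral => t tT; rewrite E.
Qed.

(** The square of the coordinate is at most |f|^2 |Z|^2, and one strip contributes no more than the
    whole finite norm. *)
Lemma Lfun2_coord j f : (j < J)%N -> L2 O f ->
  ((fun p : R * Omega => L2ip O (Z p.1 p.2) f) \_ (strip j)) \in Lfun mu 2%:E.
Proof.
move=> jJ Lf; have [XZ _ _] := LZ.
have mS : measurable (strip j) by exact: measurableX.
have mzz : measurable_fun setT (zz \_ (strip j)).
  apply/(measurable_restrictT _ _).1 => //.
  apply: (@measurable_funS _ _ _ _ (`]0, T[%classic `*` [set: Omega])).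
  - exact: measurableX.
  - by apply: setSX => //; exact: node_itv.
  - by apply/measurable_EFinP; exact: L2F_measurable_sqr LZ.
apply/Lfun2P; split.
  apply/(measurable_restrictT _ _).1 => //.
  apply: (@measurable_funS _ _ _ _ (`]0, T[%classic `*` [set: Omega])).
  - exact: measurableX.
  - by apply: setSX => //; exact: node_itv.
  - exact: L2F_measurable_ip LZ Lf.
apply: (@le_lt_trans _ _ ((L2ip O f f)%:E * \int[mu]_p (zz \_ (strip j)) p)%E).
  rewrite -ge0_integralZl//; last 2 first.
  - by move=> p _; rewrite patchE; case: ifP => // _; rewrite lee_fin L2ip_ge0.
  - by rewrite lee_fin L2ip_ge0.
  apply: ge0_le_integral_nomeas => p _; first by rewrite lee_fin sqr_ge0.
  rewrite !patchE; case: ifPn => [|_]; last by rewrite expr0n mule0.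
  rewrite inE => -[/= pj _]; rewrite /zz -EFinM lee_fin mulrC.
  apply: CauchySchwarz_L2ip => //; apply: XL2; apply: XZ.
  by have := node_itv T0 J0 jJ pj; rewrite /= in_itv.
have := L2F_norm_lty; rewrite L2F_norm_strips (bigD1 (Ordinal jJ))//= => h.
rewrite lte_mul_pinfty// ?lee_fin ?L2ip_ge0//.
apply: le_lt_trans h; rewrite leeDl//; apply: sume_ge0 => i _.
apply: integral_ge0 => p _; rewrite patchE; case: ifP => // _.
by rewrite lee_fin L2ip_ge0.
Qed.

End square_integrable_process.

End scheme.

(** Rescaling by the 3/5 that bounds the time factor: 3/5 * 5/4 = 3/4 and 3/5 * 5 = 3. The weight
    1/4 keeps the coefficient of the z-term below 1. *)
Lemma young_rescale (R : realFieldType) (a b c : R) :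
  a <= (1 + 4^-1) * b + (1 + 4) * c -> 3 / 5 * a <= 3 / 4 * b + 3 * c.
Proof. by move=> ?; lra. Qed.

Lemma absorb_quarter (R : realFieldType) (a b c x y : R) :
  a <= b -> b + c <= x + (3 / 4 * c + 3 * y) -> a + c / 4 <= x + 3 * y.
Proof. by move=> ? ?; lra. Qed.

(** * The energy estimate *)

Section scheme_estimate.
Context (R : realType) (d : measure_display) (Omega : measurableType d)
  (P : probability Omega R) (W : R -> Omega -> R).
Context (n : nat) (O : set 'rV[R]_n) (mesh : seq 'M[R]_(n.+1, n)) (T : R) (J : nat).
Local Notation fn := ('rV[R]_n -> R).
Local Notation leb := (@lebesgue_measure R).
Local Notation mu := (leb \x P)%E.
Local Notation strip j :=
  (`]node T J j, node T J j.+1[%classic `*` [set: Omega]).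
Local Notation tau := (T / J%:R).
Context (Qh Dh : fn -> fn) (g p z : R -> Omega -> fn).
Context (m : nat) (e : 'I_m -> fn).
Hypotheses (BW : brownian_motion P W) (T0 : 0 < T) (J0 : (0 < J)%N)
  (tau_lt : tau < 2 / 5) (oO : open O)
  (am : forall K, K \in mesh -> affinely_independent K)
  (pQ : is_L2_projection O mesh Qh) (hDh : is_discrete_laplacian O mesh Dh)
  (Lg : L2F P W O T (L2 O) g) (hS : is_S1_S2 P W O mesh T J Qh Dh g p z)
  (oe : orthonormal O mesh e)
  (be : forall v, Vh O mesh v -> L2ip O v v = \sum_i L2ip O v (e i) ^+ 2).

Let tau0 : 0 < tau. Proof. by rewrite divr_gt0// ltr0n. Qed.

Let Ve i : Vh O mesh (e i). Proof. exact: oe.1. Qed.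

Let Le i : L2 O (e i). Proof. exact: Vh_L2. Qed.

Let VhL2 : Vh O mesh `<=` L2 O. Proof. by move=> v; exact: Vh_L2. Qed.

Let Lp : L2F P W O T (Vh O mesh) p. Proof. by case: hS => -[]. Qed.

Let Lz : L2F P W O T (Vh O mesh) z. Proof. by case: hS. Qed.

Let node_itvT j : (j <= J)%N -> 0 <= node T J j <= T.
Proof. by move=> jJ; rewrite node_ge0//= -[leRHS](nodeJ T J0) node_le. Qed.

Let Vp t w : 0 <= t <= T -> Vh O mesh (p t w).
Proof. by case: hS => -[_ + _] _ _ _; exact. Qed.

Let p_const j t w f : (j < J)%N -> node T J j <= t < node T J j.+1 -> L2 O f ->
  L2ip O (p t w) f = L2ip O (p (node T J j) w) f.
Proof.
move=> jJ jt Lf.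
have tT : 0 <= t <= T.
  have /andP[h1 _] := node_itvT (ltnW jJ); have /andP[_ h2] := node_itvT jJ.
  by case/andP: jt => h3 h4; rewrite (le_trans h1 h3)/= (le_trans (ltW h4) h2).
apply: L2eq_ip => //; [by apply/Vh_L2/Vp|by apply/Vh_L2/Vp/node_itvT/ltnW|].
by case: hS => -[_ _ + _] _ _; exact.
Qed.

(** [p] is constant on the step, so its coordinates at the node are those at u, where progressive
    measurability applies; at the node 0 it gives nothing. *)
Let adapted_p j f : (j < J)%N -> L2 O f ->
  forall u, node T J j < u < node T J j.+1 ->
  adapted W u (fun w => L2ip O (p (node T J j) w) f).
Proof.
move=> jJ Lf u /andP[h1 h2].
rewrite (_ : (fun w => _) = (fun w => L2ip O (p u w) f)).
  apply: (L2F_adapted_ip _ Lp Lf).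
  have /andP[h3 _] := node_itvT (ltnW jJ); have /andP[_ h4] := node_itvT jJ.
  by rewrite (le_lt_trans h3 h1) (lt_le_trans h2 h4).
by apply/funext => w; rewrite (p_const w jJ)// (ltW h1).
Qed.

Let Lfun2_p j f : (j < J)%N -> L2 O f ->
  (fun w => L2ip O (p (node T J j) w) f) \in Lfun P 2%:E.
Proof.
move=> jJ Lf; set c := fun w => _.
have jj := node_lt T0 J0 j.
have mc : measurable_fun setT c.
  apply: (adapted_measurable BW (t := (node T J j + node T J j.+1) / 2)).
  by apply: adapted_p => //; apply/andP; split; lra.
have /Lfun2P[mp] := Lfun2_coord BW T0 J0 VhL2 Lp jJ Lf.
rewrite restrict_sqr => fp; apply/Lfun2P; split => //.
set K := (\int[P]_w ((c w) ^+ 2)%:E)%E.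
have h0 (q : R * Omega) : (0 <= ((L2ip O (p q.1 q.2) f) ^+ 2)%:E)%E.
  by rewrite lee_fin sqr_ge0.
have mh : measurable_fun setT
    ((fun q : R * Omega => ((L2ip O (p q.1 q.2) f) ^+ 2)%:E) \_ (strip j)).
  by rewrite -restrict_sqr; apply/measurable_EFinP; exact: measurable_funX.
(* The coordinate does not depend on time within the step, so its integral over the strip is tau
   times its second moment; finiteness of the former gives that of the latter. *)
have KE : (\int[mu]_q ((fun q : R * Omega =>
    ((L2ip O (p q.1 q.2) f) ^+ 2)%:E) \_ (strip j)) q = K * tau%:E)%E.
  rewrite (tonelli_strip P h0 mh) (eq_integral (fun=> K)); last first.
    move=> t; rewrite inE/= in_itv/= => /andP[h1 h2].
    by apply: eq_integral => w _; rewrite (p_const w jJ)// (ltW h1).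
  rewrite integral_cst//; congr (_ * _)%E; apply: (etrans (lebesgue_measure_itv _)).
  by rewrite /= lte_fin jj -EFinD nodeB.
have {}fp : (K * tau%:E < +oo)%E by rewrite -KE.
by rewrite ltey; apply/eqP => Ky; move: fp; rewrite Ky gt0_mulye.
Qed.

Let zc i j := (fun q : R * Omega => L2ip O (z q.1 q.2) (e i)) \_ (strip j).
Let gc i j := (fun q : R * Omega => L2ip O (g q.1 q.2) (e i)) \_ (strip j).
(** Set to 0 from j = J on: the terminal condition holds only almost surely, and this makes [Psum J]
    vanish outright. *)
Let pc i j w := if (j < J)%N then L2ip O (p (node T J j) w) (e i) else 0.

Let Lzc i j : (j < J)%N -> zc i j \in Lfun mu 2%:E.
Proof. by move=> jJ; exact: (Lfun2_coord BW T0 J0 VhL2 Lz jJ (Le i)). Qed.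

Let Lgc i j : (j < J)%N -> gc i j \in Lfun mu 2%:E.
Proof. by move=> jJ; exact: (Lfun2_coord BW T0 J0 _ Lg jJ (Le i)). Qed.

Let Lpc i j : pc i j \in Lfun P 2%:E.
Proof.
rewrite /pc; case: ltnP => jJ; last exact: Lfun2_0.
exact: Lfun2_p.
Qed.

Let Psum j := \sum_i mip P (pc i j) (pc i j).
Let Zsum j := \sum_i mip mu (zc i j) (zc i j).
Let Gsum j := \sum_i mip mu (gc i j) (gc i j).

(** By symmetry of [Dh], pairing p_j with this function gives the i-th coordinate of p_j - tau Dh
    p_j, as an inner product of p_j with a fixed function, whose measurability is known. *)
Let implicit i : fn := fun x => e i x - tau * Dh (e i) x.

Let L2_De i : L2 O (Dh (e i)).
Proof. by apply: Vh_L2; exact: (hDh (Ve i)).1. Qed.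

Let L2_implicit i : L2 O (implicit i).
Proof. by apply: L2B => //; exact: L2Z. Qed.

Let Psum_le j : (j < J)%N -> Psum j <= \sum_i
  mip P (fun w => L2ip O (p (node T J j) w) (implicit i))
        (fun w => L2ip O (p (node T J j) w) (implicit i)).
Proof.
move=> jJ; rewrite -lee_fin !sum_mip//; last by move=> i; exact: Lfun2_p.
apply: ge0_le_integral_nomeas => w _.
  by rewrite lee_fin sumr_ge0// => i _; exact: sqr_ge0.
rewrite lee_fin /pc jJ.
apply: (implicit_step_coords oe be oO am hDh (ltW tau0)).
exact/Vp/node_itvT/ltnW.
Qed.

(** The scheme paired with [e i]. Symmetry moves [Dh] onto [e i], the Bochner integral becomes a
    scalar time integral, and the projection disappears from [Qh g] because [e i] lies in [Vh]. *)
Let ae_equation j A I i : (j < J)%N ->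
  (forall w, L2 O (I w)) ->
  {ae P, forall w,
    is_bochner O (node T J j) (node T J j.+1)
      (fun t => z t w \+ Qh (g t w)) (A w) /\
    L2eq O (p (node T J j) w \- p (node T J j.+1) w)
      (fun x => tau * Dh (p (node T J j) w) x + A w x - I w x)} ->
  {ae P, forall w,
    L2ip O (p (node T J j) w) (implicit i) + L2ip O (I w) (e i) =
    pc i j.+1 w + time_integral (node T J j) (node T J j.+1)
      (fun q => zc i j q + gc i j q) w}.
Proof.
move=> jJ LI hA.
have lh : (fun q => zc i j q + gc i j q) \in Lfun mu 2%:E.
  by apply: Lfun2D; [exact: Lzc|exact: Lgc].
have hD : (fun q => zc i j q + gc i j q) \_ (strip j) =
    (fun q => zc i j q + gc i j q).
  apply/funext => q; rewrite patchE; case: ifPn => // qn.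
  by rewrite /zc /gc !patchE (negbTE qn) addr0.
have := ae_integrable_section (node_lt T0 J0 j) hD lh.
have pJ : {ae P, forall w, L2eq O (p (node T J J) w) (cst 0)} by case: hS.
apply: filterS3 pJ hA => w pJ [hb heq] iw.
have LA : L2 O (A w) by case: hb.
have L0 : L2 O (p (node T J j) w) by exact/Vh_L2/Vp/node_itvT/ltnW.
have L1 : L2 O (p (node T J j.+1) w) by exact/Vh_L2/Vp/node_itvT.
have V0 : Vh O mesh (p (node T J j) w) by exact/Vp/node_itvT/ltnW.
have LD : L2 O (Dh (p (node T J j) w)) by apply: Vh_L2; exact: (hDh V0).1.
have jT t : node T J j < t < node T J j.+1 -> 0 < t < T.
  move=> jt; have := @node_itv _ T J T0 J0 j jJ t.
  by rewrite /= !in_itv/=; exact.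
have fE t : node T J j < t < node T J j.+1 ->
    L2ip O (z t w \+ Qh (g t w)) (e i) = zc i j (t, w) + gc i j (t, w).
  move=> jt; have /jT tT := jt.
  have Lzt : L2 O (z t w) by apply: Vh_L2; case: Lz => + _ _; exact.
  have Lgt : L2 O (g t w) by case: Lg => + _ _; exact.
  have [VQ QE] := pQ Lgt.
  rewrite (L2ipDl Lzt (Vh_L2 VQ) (Le i)).
  have tj : t \in (`]node T J j, node T J j.+1[%classic : set R).
    by apply/mem_set; rewrite /= in_itv/= jt.
  by rewrite QE// /zc /gc !patchE !in_setX/= !in_setT tj.
have AE : L2ip O (A w) (e i) = time_integral (node T J j) (node T J j.+1)
    (fun q => zc i j q + gc i j q) w.
  rewrite (bochner_ip (Le i) hb); last first.
    apply: eq_integrable iw => // t; rewrite inE/= in_itv/= => jt.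
    by rewrite -fE.
  apply: eq_Rintegral => t; rewrite inE/= in_itv/= => jt.
  exact: fE.
(* In the last step the terminal condition identifies the coordinate of p_J with the default value
   0. *)
have p1E : pc i j.+1 w = L2ip O (p (node T J j.+1) w) (e i).
  rewrite /pc; case: ltnP => // Jj.
  have jE : j.+1 = J by apply/eqP; rewrite eqn_leq jJ.
  have c0 : cst 0 \_ O = (fun=> 0) :> ('rV[R]_n -> R).
    by apply/funext => x; rewrite patchE; case: ifP.
  have Lc0 : L2 O (cst 0) by rewrite /L2/= c0; exact: Lfun2_0.
  have nE : node T J j.+1 = node T J J by congr node.
  rewrite -nE in pJ.
  by rewrite (L2eq_ip L1 Lc0 (Le i) pJ) L2ipE c0 mip0l.
have Lrhs : L2 O (fun x => tau * Dh (p (node T J j) w) x + A w x).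
  by apply: L2D => //; exact: L2Z.
have := L2eq_ip (L2B L0 L1) (L2B Lrhs (LI w)) (Le i) heq.
rewrite (L2ipBl L0 L1 (Le i)) (L2ipBl Lrhs (LI w) (Le i)).
rewrite (L2ipDl (L2Z tau LD) LA (Le i)) (L2ipZl tau LD (Le i)).
rewrite (discrete_laplacian_sym oO am hDh V0 (Ve i)) AE -p1E => E.
by rewrite /implicit L2ipBr ?L2ipZr//; [lra|exact: L2Z].
Qed.

Let one_step j : (j < J)%N ->
  Psum j + Zsum j / 4 <= (1 + 5 * tau) * Psum j.+1 + 3 * Gsum j.
Proof.
move=> jJ; have [_ _ _ /(_ j jJ)[A [I [zI hA]]]] := hS.
have [LI mI _] := zI.
pose q i w := L2ip O (p (node T J j) w) (implicit i).
pose Ic i w := L2ip O (I w) (e i).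
pose h i := fun y => zc i j y + gc i j y.
pose Ac i := time_integral (node T J j) (node T J j.+1) (h i).
have lq i : q i \in Lfun P 2%:E by exact: Lfun2_p.
have lh i : h i \in Lfun mu 2%:E by apply: Lfun2D; [exact: Lzc|exact: Lgc].
have mIc i : measurable_fun setT (Ic i).
  by apply: measurable_fun_gt => c; exact: L2measurable_gt_ip mI (Le i).
have Lzt t w : node T J j < t < node T J j.+1 -> L2 O (z t w).
  move=> jt; apply: Vh_L2; case: Lz => + _ _; apply.
  by have := @node_itv _ T J T0 J0 j jJ t; rewrite /= !in_itv/=; exact.
have aj0 : 0 <= node T J j by exact: node_ge0.
have mz i : measurable_fun setT (zc i j) by exact: Lfun2_measurable (Lzc i jJ).
have iso i := ito_isometry BW aj0 (Le i) Lzt (mz i) (mIc i) zI.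
have orth i : mip P (q i) (Ic i) = 0.
  apply: (ito_orthogonal BW aj0 (Le i) Lzt (mz i) (mIc i) zI) => //.
  exact: adapted_p.
have time i : Ac i \in Lfun P 2%:E /\ mip P (Ac i) (Ac i) <= tau * mip mu (h i) (h i).
  rewrite -(nodeB T J j); apply: mip_time_integral => //; first exact: node_lt.
  apply/funext => y; rewrite patchE; case: ifPn => // yn.
  by rewrite /h /zc /gc !patchE (negbTE yn) addr0.
have pythagoras i : mip P (q i) (q i) + mip mu (zc i j) (zc i j) <=
    (1 + 5 * tau) * mip P (pc i j.+1) (pc i j.+1) +
    (3 / 4 * mip mu (zc i j) (zc i j) + 3 * mip mu (gc i j) (gc i j)).
  have [lI eI] := iso i; have [lA hA2] := time i.
  have -> : mip P (q i) (q i) + mip mu (zc i j) (zc i j) =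
      mip P (fun w => q i w + Ic i w) (fun w => q i w + Ic i w).
    rewrite -eI -/(Ic i) (mipDl (lq i) lI (Lfun2D (lq i) lI)) !mipDr// (mipC _ (Ic i) (q i)).
    by rewrite orth addr0 add0r.
  have ae_eq := ae_equation i jJ LI hA.
  have lS : (fun w => pc i j.+1 w + Ac i w) \in Lfun P 2%:E by exact: Lfun2D.
  have mS := Lfun2_measurable lS.
  have mq := Lfun2_measurable (Lfun2D (lq i) lI).
  have ae_eq' : (fun w => q i w + Ic i w) = (fun w => pc i j.+1 w + Ac i w) %[ae P].
    by apply: filterS ae_eq => w hw _.
  rewrite (ae_eq_mip mq mS mq mS ae_eq' ae_eq').
  have t5 : 0 < 5 * tau by rewrite mulr_gt0.
  apply: le_trans (mip_young t5 (Lpc i j.+1) lA) _; rewrite lerD2l.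
  have q4 : 0 < 4^-1 :> R by rewrite invr_gt0.
  have hy : mip mu (h i) (h i) <= (1 + 4^-1) * mip mu (zc i j) (zc i j) +
      (1 + 4) * mip mu (gc i j) (gc i j).
    by have := mip_young q4 (Lzc i jJ) (Lgc i jJ); rewrite invrK.
  (* (1 + 1 / (5 tau)) tau = tau + 1/5 <= 3/5 *)
  apply: (@le_trans _ _ (3 / 5 * mip mu (h i) (h i))); last first.
    exact: young_rescale hy.
  apply: (@le_trans _ _ ((1 + (5 * tau)^-1) * (tau * mip mu (h i) (h i)))).
    by apply: ler_wpM2l => //; rewrite addr_ge0// invr_ge0 ltW.
  have -> : (1 + (5 * tau)^-1) * (tau * mip mu (h i) (h i)) =
      (tau + 5^-1) * mip mu (h i) (h i).
    by rewrite [LHS]mulrA mulrDl mul1r invfM mulfVK ?gt_eqF.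
  apply: ler_wpM2r; first exact: mip_ge0.
  by rewrite (_ : 3 / 5 = 2 / 5 + 5^-1) ?lerD2r ?ltW// [3]mulrSr mulrDl mul1r.
have := Psum_le jJ; rewrite -/(q _) => h1.
have h2 : \sum_i mip P (q i) (q i) + Zsum j <=
    (1 + 5 * tau) * Psum j.+1 + (3 / 4 * Zsum j + 3 * Gsum j).
  rewrite /Zsum /Gsum /Psum !mulr_sumr -!big_split/=; apply: ler_sum => i _.
  exact: pythagoras.
exact: absorb_quarter h1 h2.
Qed.

(** Summation over steps and coordinates. As z takes values in [Vh], Parseval's identity makes its
    coordinates add up to the squared norm; g takes values in L^2(O), and Bessel's inequality bounds
    its coordinates in the required direction. *)
Lemma S2_stability :
  (\int[P]_w \int[leb]_(t in `]0%R, T[) (L2norm O (z t w)) ^+ 2 <=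
   (12 * expR (5 * T))%:E *
   \int[P]_w \int[leb]_(t in `]0%R, T[) (L2norm O (g t w)) ^+ 2)%E.
Proof.
have ZG : \sum_(j < J) Zsum j <= 12 * expR (5 * T) * \sum_(j < J) Gsum j.
  have t5 : 0 <= 5 * tau by rewrite mulr_ge0// ltW.
  have P0 j : 0 <= Psum j by apply: sumr_ge0 => i _; exact: mip_ge0.
  have Z0 j : 0 <= Zsum j by apply: sumr_ge0 => i _; exact: mip_ge0.
  have G0 j : 0 <= Gsum j by apply: sumr_ge0 => i _; exact: mip_ge0.
  have PJ : Psum J = 0.
    by apply: big1 => i _; rewrite /pc ltnn -[RHS](mip0l P (fun=> 0)).
  apply: le_trans (discrete_gronwall t5 P0 Z0 G0 one_step PJ) _.
  apply: ler_wpM2r; first exact: sumr_ge0.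
  rewrite ler_pM2l//.
  (* 1 + x <= e^x, raised to the power J, with J tau = T. *)
  apply: (@le_trans _ _ (expR (5 * tau) ^+ J)).
    by apply: lerXn2r; rewrite ?nnegrE ?expR_ge0 ?expR_ge1Dx// addr_ge0.
  rewrite -expRM_natl ler_expR (_ : J%:R * (5 * tau) = 5 * T)//.
  by field; rewrite pnatr_eq0 -lt0n.
rewrite (L2F_norm_strips BW T0 J0 VhL2 Lz) (L2F_norm_strips BW T0 J0 _ Lg)//.
have -> : (\sum_(j < J) \int[mu]_y
    ((fun y : R * Omega => (L2ip O (z y.1 y.2) (z y.1 y.2))%:E) \_ (strip j)) y =
    (\sum_(j < J) Zsum j)%:E)%E.
  rewrite -sumEFin; apply: eq_bigr => j _; rewrite sum_mip; last by move=> i; exact: Lzc.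
  apply: eq_integral => y _; rewrite /zc patchE; case: ifPn => yj; last first.
    by rewrite big1// => i _; rewrite patchE (negbTE yj) expr0n.
  congr EFin; rewrite be; first by apply: eq_bigr => i _; rewrite patchE yj.
  case: Lz => + _ _; apply; move: yj; rewrite inE => -[/= yj _].
  by have := node_itv T0 J0 (ltn_ord j) yj; rewrite /= in_itv.
apply: (@le_trans _ _ ((12 * expR (5 * T)) * \sum_(j < J) Gsum j)%:E).
  by rewrite lee_fin.
rewrite EFinM; apply: lee_wpmul2l.
  by rewrite lee_fin mulr_ge0// expR_ge0.
rewrite -sumEFin; apply: lee_sum => j _; rewrite sum_mip; last by move=> i; exact: Lgc.
apply: ge0_le_integral_nomeas => y _.
  by rewrite lee_fin sumr_ge0// => i _; exact: sqr_ge0.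
rewrite /gc patchE; case: ifPn => yj; last first.
  by rewrite big1// => i _; rewrite patchE (negbTE yj) expr0n.
rewrite lee_fin (eq_bigr (fun i => L2ip O (g y.1 y.2) (e i) ^+ 2)).
  apply: (bessel oe); case: Lg => + _ _; apply; move: yj; rewrite inE => -[/= yj _].
  by have := node_itv T0 J0 (ltn_ord j) yj; rewrite /= in_itv.
by move=> i _; rewrite patchE yj.
Qed.

End scheme_estimate.

(** * The uniform bound for S_2 *)

Theorem lemma4p17 (R : realType) (n : nat) (hn : (1 <= n <= 3)%N)
    (T : R) (hT : 0 < T)
    (O : set 'rV[R]_n) (hO : convex_polytope O) (s q : R) :
  exists2 C : R, 0 < C &
  forall (d : measure_display) (Omega : measurableType d)
    (P : probability Omega R) (W : R -> Omega -> R)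
    (mesh : seq 'M[R]_(n.+1, n)) (J : nat)
    (Qh Dh : ('rV[R]_n -> R) -> 'rV[R]_n -> R)
    (g S1g S2g : R -> Omega -> 'rV[R]_n -> R),
  measure_is_complete P ->
  brownian_motion P W ->
  triangulation O mesh ->
  shape_regular s mesh ->
  quasi_uniform q mesh ->
  (2 < J)%N ->
  T / J%:R < 2 / 5 ->
  is_L2_projection O mesh Qh ->
  is_discrete_laplacian O mesh Dh ->
  L2F P W O T (L2 O) g ->
  is_S1_S2 P W O mesh T J Qh Dh g S1g S2g ->
  (L2F_norm P O T S2g <= C%:E * L2F_norm P O T g)%E.
Proof.
(* The energy estimate concerns squared norms, hence the square root. *)
exists (Num.sqrt (12 * expR (5 * T))); first by rewrite sqrtr_gt0 mulr_gt0// expR_gt0.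
move=> d Omega P W mesh J Qh Dh g S1g S2g _ BW [am clO _] _ _ J2 tau_lt pQ hDh Lg hS.
have oO : open O by case: hO => _ [ps ->]; exact: open_interior.
have J0 : (0 < J)%N by exact: leq_trans J2.
have Omesh : O `<=` [set x | exists2 K, K \in mesh & simplex K x].
  by rewrite -clO; exact: subset_closure.
have [m [e [oe be]]] := orthonormal_basis Omesh pQ.
have := S2_stability BW hT J0 tau_lt oO am pQ hDh Lg hS oe be.
rewrite /L2F_norm; set X := (\int[P]_w _)%E; set Y := (\int[P]_w _)%E => XY.
have X0 : (0 <= X)%E.
  by apply: integral_ge0 => w _; apply: integral_ge0 => t _; by rewrite expe_ge0// Lnorm_ge0.
have Y0 : (0 <= Y)%E.
  by apply: integral_ge0 => w _; apply: integral_ge0 => t _; by rewrite expe_ge0// Lnorm_ge0.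
apply: (@le_trans _ _ (((12 * expR (5 * T))%:E * Y) `^ 2^-1)%E).
  by apply: gt0_ler_poweR; rewrite ?in_itv/= ?leey ?X0 ?mule_ge0// lee_fin.
by rewrite poweRM ?lee_fin// poweR_EFin powR12_sqrt.
Qed.
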